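(* Let $d\in\{3,4,5\}$. Let $\mu$ be a probability measure on $\mathbb N=\{0,1,2,\dots\}$ and let $\theta,\eta$ be probability measures on $\mathbb Z^d$ such that: (i) $\mu$ has mean $1$ and finite variance, and $\mu\not\equiv\delta_1$; (ii) $\eta$ is aperiodic, irreducible, with mean $0$ and finite $(d+1)$-th moment; (iii) $\theta$ is symmetric, irreducible, with some finite exponential moments. Assume furthermore that $\mu$ has finite third moment. Let $\mathcal T_n^{cond}$ be a Galton-Watson tree with offspring law $\mu$ conditioned to have exactly $n$ vertices (for those $n$ for which this event has positive probability), let $(V_u)_{u\in\mathcal T_n^{cond}}$ be the random walk with jump law $\theta$ indexed by $\mathcal T_n^{cond}$, and let $R_n^{cond}:=\{V_u:u\in\mathcal T_n^{cond}\}$. Then, in probability, as $n\to\infty$ (along such $n$), $$\mathtt{cap}_\eta R_n^{cond}=n^{\frac{d-2}{4}+o_{\tt p}(1)},$$ where $o_{\tt p}(1)$ denotes a quantity which converges to $0$ in probability as $n\to\infty$.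
   Context: Capacity: for a finite set $A\subset\mathbb Z^d$, $\mathtt{cap}_\eta A:=\sum_{x\in A}\mathsf P^\eta_x(\tau_A^+=\infty)$, where under $\mathsf P^\eta_x$, $(S_n)_{n\ge0}$ is a random walk on $\mathbb Z^d$ with i.i.d. jumps of law $\eta$ started at $x$, and $\tau_A^+:=\inf\{n\ge1: S_n\in A\}$. For a random set, this is the capacity of the realized set. Galton-Watson tree with offspring law $\mu$: starts from one initial ancestor (the root $\varnothing$), and every particle independently has a number of children of law $\mu$. Tree-indexed random walk: attach to the edges of the tree i.i.d. random variables of law $\theta$, independent of the tree. Put $V_\varnothing:=0$, and for $u\ne\varnothing$ let $V_u$ be the sum of the variables on the edges of the unique simple path from $\varnothing$ to $u$. Terminology: irreducible / aperiodic means that the random walk with that jump law is an irreducible / aperiodic Markov chain on $\mathbb Z^d$; symmetric means $\theta(x)=\theta(-x)$; ''some finite exponential moments'' means $\sum_x e^{\lambda|x|}\theta(x)<\infty$ for some $\lambda>0$. *)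

(* Defs.v *)
From HB Require Import structures.
From mathcomp Require Import all_boot all_order all_algebra finmap.
From mathcomp Require Import all_classical all_reals all_analysis.

Set Implicit Arguments.
Unset Strict Implicit.
Unset Printing Implicit Defensive.

Import Order.TTheory GRing.Theory Num.Theory.

Local Open Scope classical_set_scope.
Local Open Scope ring_scope.

(* Z^d with its discrete sigma-algebra.  An alias of 'rV[int]_d, so that the
   measurable structure is not put on matrices in general. *)
Definition lattice (d : nat) : Type := 'rV[int]_d.

HB.instance Definition _ d := Countable.on (lattice d).
HB.instance Definition _ d := GRing.Zmodule.on (lattice d).
HB.instance Definition _ d := isPointed.Build (lattice d) 0.
HB.instance Definition _ d := @isMeasurable.Build default_measure_display
  (lattice d) discrete_measurable (@discrete_measurable0 _)
  (@discrete_measurableC _) (@discrete_measurableU _).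

Definition lcoord (R : realType) (d : nat) (i : 'I_d) (x : lattice d) : R :=
  ((x : 'rV[int]_d) ord0 i)%:~R.

(* Euclidean norm; the norm provided by the library on 'rV[R]_d is the sup
   norm. *)
Definition enorm (R : realType) (d : nat) (x : lattice d) : R :=
  Num.sqrt (\sum_(i < d) lcoord R i x ^+ 2).

Section MarkovChain.
Local Open Scope ereal_scope.
Context {R : realType} {T : choiceType}.
Implicit Type p : T -> T -> \bar R.

Fixpoint iter_kernel p (n : nat) (x y : T) : \bar R :=
  if n is m.+1 then \esum_(z in [set: T]) (p x z * iter_kernel p m z y)
  else (x == y)%:R%:E.

Definition irreducible_chain p : Prop :=
  forall x y, exists n, 0 < iter_kernel p n x y.

(* For every x, gcd {n >= 1 | p^n(x, x) > 0} = 1; if that set is empty then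
   every g divides all its elements and the condition fails. *)
Definition aperiodic_chain p : Prop :=
  forall x (g : nat),
    (forall n, (0 < n)%N -> 0 < iter_kernel p n x x -> (g %| n)%N) -> g = 1%N.

End MarkovChain.

Definition walk_kernel (R : realType) (d : nat)
    (eta : probability (lattice d) R) (x y : lattice d) : \bar R :=
  eta [set y - x].

Definition symmetric_law (R : realType) (d : nat)
    (theta : probability (lattice d) R) : Prop :=
  forall x, theta [set x] = theta [set - x].

Section Independence.
Context {disp : measure_display} {Omega : measurableType disp} {R : realType}.
Implicit Type P : probability Omega R.

Definition mutually_independent P (I : choiceType)
    (G : I -> set (set Omega)) : Prop :=
  forall (J : {fset I}) (A : I -> set Omega),
    (forall i, i \in J -> G i (A i)) ->
    P (\bigcap_(i in [set` J]) A i) = (\prod_(i <- J) P (A i))%E.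

Definition sigma_rv (d' : measure_display) (T : measurableType d')
    (X : Omega -> T) : set (set Omega) :=
  preimage_set_system setT X measurable.

Definition cond_prob P (A B : set Omega) : R := fine (P (A `&` B)) / fine (P B).

End Independence.

Section Capacity.
Context {disp : measure_display} {Omega : measurableType disp} {R : realType}
  (P : probability Omega R) {d : nat}.

Definition iid_steps (eta : probability (lattice d) R)
    (xi : nat -> {RV P >-> lattice d}) : Prop :=
  (forall i, distribution P (xi i) =1 eta) /\
  mutually_independent P (fun i => sigma_rv (xi i)).

Definition walk (xi : nat -> {RV P >-> lattice d}) (x : lattice d) (n : nat)
    (w : Omega) : lattice d :=
  x + \sum_(i < n) xi i w.

Definition no_return (xi : nat -> {RV P >-> lattice d}) (A : set (lattice d))
    (x : lattice d) : set Omega :=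
  [set w | forall n, (0 < n)%N -> ~ A (walk xi x n w)].

(* Meaningful for finite A only: the finitely supported sum is 0 by
   convention when infinitely many terms are nonzero. *)
Definition capacity (xi : nat -> {RV P >-> lattice d}) (A : set (lattice d)) :
    R :=
  \sum_(x \in A) fine (P (no_return xi A x)).

End Capacity.

(* Vertices carry Ulam-Harris labels: [::] is the root and rcons u i is the
   i-th child of u (counted from 0), present iff u is and i < k u. *)
Definition gw_tree (k : seq nat -> nat) : set (seq nat) :=
  [set u | forall j, (j < size u)%N -> (nth 0 u j < k (take j u))%N].

(* X u is the variable on the edge between u and its parent; X [::] is never
   used. *)
Definition position (d : nat) (X : seq nat -> lattice d) (u : seq nat) :
    lattice d :=
  \sum_(j < size u) X (take j.+1 u).

Section BranchingWalk.
Context {disp : measure_display} {Omega : measurableType disp} {R : realType}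
  (P : probability Omega R) {d : nat}.
Implicit Types (k : seq nat -> {RV P >-> nat})
  (X : seq nat -> {RV P >-> lattice d}).

(* Offspring numbers and edge variables are attached to all labels, including
   those which do not belong to the tree. *)
Definition branching_walk (mu : probability nat R)
    (theta : probability (lattice d) R) k X : Prop :=
  [/\ forall u, distribution P (k u) =1 mu,
      forall u, distribution P (X u) =1 theta &
      mutually_independent P (fun a : seq nat + seq nat =>
        match a with
        | inl u => sigma_rv (k u)
        | inr u => sigma_rv (X u)
        end)].

Definition tree k (w : Omega) : set (seq nat) := gw_tree (fun u => k u w).

Definition tree_size_event k (n : nat) : set Omega :=
  [set w | (tree k w #= `I_n)%card].

Definition tree_range k X (w : Omega) : set (lattice d) :=
  position (fun u => X u w) @` tree k w.

End BranchingWalk.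

(* Main.v *)
(** The capacity of a finite set A is controlled by elementary potential
    theory.  If A lies in a box of side r, the last-exit decomposition gives
    cap A <= C r^(d-2).  If M bounds the sum of the Green function of eta over
    all ordered pairs of a family of n points of A, then restricting the family
    to its points of small potential and applying the maximum principle gives
    n^2 <= 4 M cap A.  The two bounds are applied to the positions of the
    conditioned tree: the first with a bound on the displacement, the second
    with a bound on the expected energy.  Losses of n^delta, with delta
    arbitrary, are harmless.

    The n-step laws of an irreducible walk are bounded by C n^(-d/2): some power
    of the averaging operator dominates a multiple of the uniform law on the
    corners of a box, and iterating this domination is a binomial smoothing in
    every coordinate.  Applied to theta and to eta, this bounds the expected
    Green function between two vertices at tree distance l by C l^(1-d/2).

    Trees with n vertices are counted with generating functions and Kemperman's
    formula.  The weighted number of pairs of vertices lying a and b generations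
    below a common ancestor at depth h is O((1+h+a+b) n^(-3/2)); the height
    exceeds n^(1/2+delta) with superpolynomially small probability; and the
    probability of having n vertices is at least kappa n^(-3/2) whenever it is
    positive and n is large.  Given a height at most n^(1/2+delta), summing over h, a, b bounds
    the expected energy by n^((10-d)/4+O(delta)), and an exponential moment bounds
    the displacement by n^(1/4+O(delta)). *)

Require Import Defs.
From HB Require Import structures.
From mathcomp Require Import all_boot all_order all_algebra finmap.
From mathcomp Require Import all_classical all_reals sequences exp.
From mathcomp Require Import ring lra zify.

Set Implicit Arguments.
Unset Strict Implicit.
Unset Printing Implicit Defensive.

Import Order.TTheory GRing.Theory Num.Theory.

Local Open Scope ring_scope.

(** * Binomial coefficients and inverse square roots *)

(** Everything is finite before it is probabilistic. The offspring law is cut at [n], which no tree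
    with [n] vertices notices, so generating functions are polynomials; by the third moment their
    mass and mean at 1 miss 1 by O(n^(-2)), and [n]-th powers still miss by only O(1/n). The
    conditioning event is a disjoint union over finitely many plane trees, and a conditional
    probability is a weighted sum over trees divided by the total weight. That weight is only of
    order n^(-3/2), so the energy estimate must itself carry this factor: hence the counting of
    pairs at fixed size, where a bound for the unconditioned tree would be too weak. The total
    weight may vanish outside a residue class, so its lower bound has to respect the span of the
    offspring law. Escape probabilities and Green functions also have a finite horizon, removed only
    when the capacity is reached. The dimension enters through the sum over a, b < H of
    (a+b+1)^(1-d/2), which is of order H^((6-d)/2) for d < 6: pairs of vertices at large distance
    dominate the energy. *)

Section RootEstimates.
Context {R : realType}.
Implicit Types (c y C : R) (d j n m l : nat).

(** The shift makes this (j+1)^(-1/2), finite at j = 0; bounds of order n^(-d/2) are written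
    [rsq n ^+ d] throughout. *)
Definition rsq j : R := (Num.sqrt j.+1%:R)^-1.

Lemma rsqE j : rsq j = (Num.sqrt j.+1%:R)^-1.
Proof. by []. Qed.

Lemma rsq_gt0 j : 0 < rsq j.
Proof. by rewrite invr_gt0 sqrtr_gt0. Qed.

Lemma rsq_ge0 j : 0 <= rsq j.
Proof. exact/ltW/rsq_gt0. Qed.

Lemma rsq_sqr j : rsq j ^+ 2 = j.+1%:R^-1.
Proof. by rewrite exprVn sqr_sqrtr. Qed.

Lemma ler_rsq i j : (i <= j)%N -> rsq j <= rsq i.
Proof.
move=> ij; rewrite lef_pV2 ?posrE ?sqrtr_gt0 //.
by rewrite ler_wsqrtr // ler_nat.
Qed.

Lemma rsq_le1 j : rsq j <= 1.
Proof. by rewrite invf_le1 ?sqrtr_gt0 // -[leLHS]sqrtr1 ler_wsqrtr // ler1n. Qed.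

Lemma bernoulli_ge (x : R) d : 0 <= x <= 1 -> 1 - d%:R * x <= (1 - x) ^+ d.
Proof.
move=> /andP[x0 x1]; elim: d => [|d IH]; first by rewrite mul0r subr0 expr0.
rewrite exprSr.
have h : (1 - d%:R * x) * (1 - x) <= (1 - x) ^+ d * (1 - x).
  by apply: ler_wpM2r => //; lra.
apply: le_trans h; rewrite -natr1.
have : 0 <= d%:R * x * x by rewrite !mulr_ge0.
lra.
Qed.

(** Convexity: the left side is the tangent at [y] of the function t^(-1/2). After squaring, the gap
    is an explicit product whose last factor is [3 - a / y]. *)
Lemma sqrtV_step y a : 1 <= y -> 0 <= a <= 1 ->
  (Num.sqrt y)^-1 * (1 - a / (2 * y)) <= (Num.sqrt (y + a))^-1.
Proof.
move=> y1 /andP[a0 a1].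
have y0 : 0 < y by lra.
have a2 : a / (2 * y) <= 1 by rewrite ler_pdivrMr ?mul1r; lra.
have a3 : 0 <= a / (2 * y) by rewrite divr_ge0 //; lra.
rewrite -(ler_pXn2r (n := 2)) ?nnegrE ?invr_ge0 ?sqrtr_ge0 //; last first.
  by rewrite mulr_ge0 ?invr_ge0 ?sqrtr_ge0 ?subr_ge0.
rewrite exprMn !exprVn !sqr_sqrtr //; [|lra|lra].
rewrite -[leRHS]mul1r ler_pdivlMr; last lra.
have -> : y^-1 * (1 - a / (2 * y)) ^+ 2 * (y + a)
    = 1 - (a ^+ 2 / (y ^+ 2 * 4)) * (3 - a / y) by field; lra.
have h1 : 0 <= a ^+ 2 / (y ^+ 2 * 4) by rewrite divr_ge0 ?mulr_ge0 ?exprn_ge0 //; lra.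
have h2 : 0 <= 3 - a / y by rewrite subr_ge0 ler_pdivrMr //; lra.
by rewrite gerBl mulr_ge0.
Qed.

(** Convexity forbids the tangent coefficient 1/2 in this direction; 1/4 is small enough to work for
    every y >= 1. *)
Lemma sqrtV_succ y : 1 <= y ->
  (Num.sqrt (y + 1))^-1 <= (Num.sqrt y)^-1 * (1 - 1 / (4 * y)).
Proof.
move=> y1.
have y0 : 0 < y by lra.
have a2 : 1 / (4 * y) <= 1 by rewrite ler_pdivrMr ?mul1r; lra.
rewrite -(ler_pXn2r (n := 2)) ?nnegrE ?invr_ge0 ?sqrtr_ge0 //; last first.
  by rewrite mulr_ge0 ?invr_ge0 ?sqrtr_ge0 ?subr_ge0.
rewrite exprMn !exprVn !sqr_sqrtr //; [|lra|lra].
rewrite -[leLHS]mul1r ler_pdivrMr; last lra.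
have -> : y^-1 * (1 - 1 / (4 * y)) ^+ 2 * (y + 1)
    = 1 + (8 * y ^+ 2 - 7 * y + 1) / (16 * y ^+ 3) by field; lra.
rewrite lerDl divr_ge0 ?mulr_ge0 ?exprn_ge0 ?(ltW y0) //.
by nra.
Qed.

(* [K (al n + j + 1)^(-d/2)] with [al = c / (2 d)] is a supersolution of the
   recursion. *)
Lemma smoothing_recursion (b : nat -> nat -> R) c d C :
  0 < c <= 1 -> (0 < d)%N -> 0 <= C ->
  (forall j, b 0%N j <= C * rsq j ^+ d) ->
  (forall n j, b n.+1 j <= c * b n j.+1 + (1 - c) * b n j) ->
  forall n, b n 0%N <= C * Num.sqrt (2 * d%:R / c) ^+ d * rsq n ^+ d.
Proof.
move=> /andP[c0 c1] d0 C0 hb0 hbS.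
have d1 : 1 <= d%:R :> R by rewrite ler1n.
(* With this value d * al / (2 y) = c / (4 y): what the power [d] loses when [y] moves by [al] is
   what the weight [c] gains from one unit of smoothing. *)
pose al := c / (2 * d%:R).
have al0 : 0 < al by rewrite divr_gt0 // mulr_gt0 // ltr0n.
have al1 : al <= 1.
  rewrite ler_pdivrMr; last lra.
  by rewrite mul1r; lra.
have key : forall n j, b n j <= C * (Num.sqrt (al * n%:R + j.+1%:R))^-1 ^+ d.
  elim=> [|n IH] j; first by rewrite mulr0 add0r.
  apply: le_trans (hbS n j) _.
  set y := al * n%:R + j.+1%:R.
  have y1 : 1 <= y.
    rewrite /y -natr1 addrA; apply: ler_wpDl => //.
    by rewrite addr_ge0 // mulr_ge0 // ltW.
  have y0 : 0 < y by lra.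
  set s := (Num.sqrt y)^-1.
  have s0 : 0 <= s by rewrite invr_ge0 sqrtr_ge0.
  have -> : al * n.+1%:R + j.+1%:R = y + al by rewrite /y -natr1; ring.
  have e1 : b n j.+1 <= C * (s ^+ d * (1 - 1 / (4 * y))).
    apply: le_trans (IH _) _.
    have -> : al * n%:R + j.+2%:R = y + 1 by rewrite /y -(natr1 j.+1); ring.
    apply: ler_wpM2l => //.
    have a2 : 1 / (4 * y) <= 1 by rewrite ler_pdivrMr ?mul1r; lra.
    have a3 : 0 <= 1 / (4 * y) by rewrite divr_ge0 //; lra.
    apply: (@le_trans _ _ ((s * (1 - 1 / (4 * y))) ^+ d)).
      rewrite lerXn2r ?nnegrE ?invr_ge0 ?sqrtr_ge0 //.
        by rewrite mulr_ge0 // subr_ge0.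
      exact: sqrtV_succ.
    rewrite exprMn ler_wpM2l ?exprn_ge0 //.
    case: (d) d0 => // d' _; rewrite exprS ler_piMr ?exprn_ile1 ?subr_ge0 //.
      by rewrite gerBl.
  have e2 : b n j <= C * s ^+ d by apply: IH.
  have e3 : C * (s ^+ d * (1 - d%:R * (al / (2 * y)))) <=
     C * (Num.sqrt (y + al))^-1 ^+ d.
    apply: ler_wpM2l => //.
    have a2 : al / (2 * y) <= 1 by rewrite ler_pdivrMr ?mul1r; lra.
    have a3 : 0 <= al / (2 * y) by rewrite divr_ge0 //; lra.
    apply: (@le_trans _ _ ((s * (1 - al / (2 * y))) ^+ d)).
      rewrite exprMn ler_wpM2l ?exprn_ge0 // bernoulli_ge //.
      by rewrite a3 a2.
    rewrite lerXn2r ?nnegrE ?invr_ge0 ?sqrtr_ge0 //.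
      by rewrite mulr_ge0 // subr_ge0.
    by apply: sqrtV_step => //; rewrite al1 ltW.
  apply: le_trans e3.
  have -> : d%:R * (al / (2 * y)) = c / (4 * y) by rewrite /al; field; lra.
  have cc : 0 <= 1 - c by lra.
  have := ler_wpM2l (ltW c0) e1; have := ler_wpM2l cc e2.
  have -> : C * (s ^+ d * (1 - c / (4 * y))) =
     c * (C * (s ^+ d * (1 - 1 / (4 * y)))) + (1 - c) * (C * s ^+ d).
    by field; lra.
  lra.
move=> n; apply: le_trans (key n 0%N) _; rewrite -mulrA; apply: ler_wpM2l => //.
rewrite -exprMn lerXn2r ?nnegrE ?invr_ge0 ?sqrtr_ge0 ?mulr_ge0 ?sqrtr_ge0 //.
  by rewrite invr_ge0 sqrtr_ge0.
rewrite -sqrtrV; last by rewrite addr_ge0 // mulr_ge0 // ltW.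
rewrite /rsq -(@sqrtrV _ n.+1%:R) // -sqrtrM; last first.
  by rewrite divr_ge0 ?mulr_ge0 // ltW.
rewrite ler_wsqrtr //.
have -> : 2 * d%:R / c * n.+1%:R^-1 = (al * n.+1%:R)^-1.
  rewrite /al; field.
  have nn : 0 <= n%:R :> R by [].
  by apply/and3P; split; rewrite gt_eqF //; lra.
have n0 : 0 <= al * n%:R by rewrite mulr_ge0 // ltW.
rewrite lef_pV2 ?posrE; [|lra|by rewrite mulr_gt0].
by rewrite -natr1; lra.
Qed.

End RootEstimates.

Lemma bin_le_half n m : ('C(n, m) <= 'C(n, n./2))%N.
Proof.
have step i : (i.*2 < n)%N -> ('C(n, i) <= 'C(n, i.+1))%N.
  move=> hi; have := mul_bin_left n i.
  have : (i.+1 <= n - i)%N by lia.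
  move=> h e.
  rewrite -(leq_pmul2l (m := i.+1)) // e leq_pmul2r // bin_gt0; lia.
have incr k i : (k <= n./2)%N -> (i <= k)%N -> ('C(n, i) <= 'C(n, k))%N.
  elim: k => [|k IH] hk; first by rewrite leqn0 => /eqP ->.
  rewrite leq_eqVlt => /orP[/eqP -> //|]; rewrite ltnS => ik.
  by apply: leq_trans (IH _ ik) (step _ _); lia.
case: (leqP m n./2) => [h|h]; first exact: incr.
case: (leqP m n) => [h2|h2]; last by rewrite bin_small.
by rewrite -bin_sub //; apply: incr => //; lia.
Qed.

Lemma central_bin_rec m :
  (m.+1 * 'C(m.+1.*2, m.+1) = (2 * m.*2.+1) * 'C(m.*2, m))%N.
Proof.
have e1 : ('C(m.+1.*2, m.+1) = 'C(m.*2.+1, m) * 2)%N.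
  rewrite doubleS binS -(@bin_sub m.*2.+1 m) //; last by lia.
  by rewrite (_ : m.*2.+1 - m = m.+1)%N; lia.
have e2 := mul_bin_diag m.*2.+1 m.
have e3 := mul_bin_down m.*2.+1 m.
move: e2 e3; rewrite e1 /=.
have -> : (m.*2.+1 - m = m.+1)%N by lia.
by nia.
Qed.

(** The induction step is (2m+1)(2m+3) <= 4(m+1)^2; squaring keeps the square root out of the
    integers. *)
Lemma central_bin_le m : ('C(m.*2, m) ^ 2 * m.*2.+1 <= 16 ^ m)%N.
Proof.
elim: m => [|m IH]; first by [].
rewrite -(leq_pmul2l (m := (m.+1 ^ 2)%N)) ?expn_gt0 //.
have -> : (m.+1 ^ 2 * ('C(m.+1.*2, m.+1) ^ 2 * m.+1.*2.+1) =
  (m.+1 * 'C(m.+1.*2, m.+1)) ^ 2 * m.+1.*2.+1)%N by nia.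
rewrite central_bin_rec (expnS 16).
have -> : ((2 * m.*2.+1 * 'C(m.*2, m)) ^ 2 * m.+1.*2.+1 =
  4 * m.*2.+1 * m.+1.*2.+1 * ('C(m.*2, m) ^ 2 * m.*2.+1))%N by nia.
rewrite (mulnA (m.+1 ^ 2)%N); apply: leq_mul => //; nia.
Qed.

Lemma central_bin_ge m : (16 ^ m <= 'C(m.*2, m) ^ 2 * (4 * m).+1)%N.
Proof.
elim: m => [|m IH]; first by [].
rewrite -(leq_pmul2l (m := (m.+1 ^ 2 * (4 * m).+1)%N)); last by rewrite muln_gt0 expn_gt0.
have -> : (m.+1 ^ 2 * (4 * m).+1 * ('C(m.+1.*2, m.+1) ^ 2 * (4 * m.+1).+1) =
  (m.+1 * 'C(m.+1.*2, m.+1)) ^ 2 * (4 * m.+1).+1 * (4 * m).+1)%N by nia.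
rewrite central_bin_rec (expnS 16).
have -> : ((2 * m.*2.+1 * 'C(m.*2, m)) ^ 2 * (4 * m.+1).+1 * (4 * m).+1 =
  4 * m.*2.+1 ^ 2 * (4 * m.+1).+1 * ('C(m.*2, m) ^ 2 * (4 * m).+1))%N by nia.
rewrite (_ : (m.+1 ^ 2 * (4 * m).+1 * (16 * 16 ^ m) = (m.+1 ^ 2 * (4 * m).+1 * 16) * 16 ^ m)%N); last by nia.
apply: leq_mul => //; nia.
Qed.

Section BinomialEstimates.
Context {R : realType}.
Implicit Types (j l m n D : nat).

Lemma bin_le_rsq j l : ('C(j, l))%:R <= 2 ^+ j * 2 * rsq j :> R.
Proof.
have h2 : ('C(j, l) <= 'C(j, j./2))%N by exact: bin_le_half.
pose m := j./2.
have hj : (j = m.*2 \/ j = m.*2.+1) by rewrite /m; lia.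
have h3 : ('C(j, m) <= 2 ^ (j - m.*2) * 'C(m.*2, m))%N.
  case: hj => ->; first by rewrite subnn mul1n.
  rewrite subSnn expn1.
  case: (posnP m) => [->//|m0].
  rewrite -{2}(prednK m0) binS prednK //.
  have := bin_le_half m.*2 m.-1; rewrite doubleK; lia.
have h4 : ('C(m.*2, m))%:R <= 4 ^+ m * rsq m.*2 :> R.
  rewrite -(ler_pXn2r (n := 2)) ?nnegrE ?mulr_ge0 ?exprn_ge0 ?rsq_ge0 //.
  rewrite exprMn rsq_sqr ler_pdivlMr //.
  have := central_bin_le m; rewrite -(ler_nat R) natrM !natrX.
  suff -> : 4 ^+ m ^+ 2 = 16 ^+ m :> R by [].
  by rewrite -exprM mulnC exprM; congr (_ ^+ _); ring.
have h5 : rsq m.*2 <= 2 * rsq j :> R.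
  rewrite -(ler_pXn2r (n := 2)) ?nnegrE ?mulr_ge0 ?exprn_ge0 ?rsq_ge0 //.
  rewrite exprMn !rsq_sqr.
  rewrite ler_pdivlMr // ler_pdivrMl // -natrX -natrM ler_nat; lia.
have h6 : ('C(j, l))%:R <= (2 ^ (j - m.*2))%:R * ('C(m.*2, m))%:R :> R.
  by rewrite -natrM ler_nat (leq_trans h2).
apply: le_trans h6 _; rewrite natrX.
have -> : 2 ^+ j * 2 * rsq j = 2 ^+ (j - m.*2) * (4 ^+ m * (2 * rsq j)) :> R.
  have -> : 4 ^+ m = 2 ^+ m.*2 :> R by rewrite -mul2n exprM; congr (_ ^+ _); ring.
  by rewrite !mulrA -exprD subnK //; case: hj => ->; lia.
rewrite ler_wpM2l ?exprn_ge0 //; apply: le_trans h4 _.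
by rewrite ler_wpM2l ?exprn_ge0.
Qed.

Lemma central_bin_ge_rsq j : 4^-1 * (2 ^+ j * rsq j) <= ('C(j, j./2))%:R :> R.
Proof.
pose m := j./2.
have hj : (j = m.*2 \/ j = m.*2.+1) by rewrite /m; lia.
have h3 : ('C(m.*2, m) <= 'C(j, m))%N.
  case: hj => -> //; case: (posnP m) => [->//|m0].
  by rewrite -(prednK m0) [leqRHS]binS leq_addr.
have h4 : 4 ^+ m * rsq m.*2 <= 2 * ('C(m.*2, m))%:R :> R.
  rewrite -(ler_pXn2r (n := 2)) ?nnegrE ?mulr_ge0 ?exprn_ge0 ?rsq_ge0 //.
  rewrite exprMn rsq_sqr ler_pdivrMr //.
  have -> : 4 ^+ m ^+ 2 = (16 ^ m)%:R :> R.
    by rewrite natrX -exprM mulnC exprM; congr (_ ^+ _); ring.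
  rewrite -natrM -natrX -natrM ler_nat; apply: leq_trans (central_bin_ge m) _.
  by rewrite expnMn -mulnA (mulnC (2 ^ 2)%N) -mulnA leq_mul2l; lia.
have h5 : rsq j <= rsq m.*2 :> R by apply: ler_rsq; lia.
have h6 : 2 ^+ j <= 2 * 4 ^+ m :> R.
  have -> : 4 ^+ m = 2 ^+ m.*2 :> R by rewrite -mul2n exprM; congr (_ ^+ _); ring.
  by case: hj => {1}->; rewrite ?exprS // ler_peMl ?exprn_ge0 // ler1n.
have h7 : 2 ^+ j * rsq j <= 2 * 4 ^+ m * rsq m.*2 :> R.
  by rewrite ler_pM ?exprn_ge0 ?rsq_ge0.
have h8 : ('C(m.*2, m))%:R <= ('C(j, m))%:R :> R by rewrite ler_nat.
rewrite -/m ler_pdivrMl //; lra.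
Qed.

Lemma expR_le_1B (x : R) : 0 <= x <= 1 / 2 -> expR (- (2 * x)) <= 1 - x.
Proof.
move=> /andP[x0 x1]; rewrite expRN -[leRHS]invrK lef_pV2 ?posrE ?expR_gt0 //.
  apply: le_trans (expR_ge1Dx _).
  rewrite -[leLHS]mul1r ler_pdivrMr; last lra.
  nra.
by rewrite invr_gt0; lra.
Qed.

(** Moving one place away from the centre keeps at least a fraction 1 - x of the coefficient, with x
    of order D / j. So D moves keep a fraction exp(-O(D^2 / j)), which is bounded below when D^2 <=
    A (j+1). *)
Lemma bin_ge_rsq (A : R) : exists2 kappa : R, 0 < kappa &
  forall j l D, (j./2 <= l + D)%N -> (l <= j./2 + D)%N -> (l <= j)%N ->
   (D ^ 2)%:R <= A * j.+1%:R -> (16 * D.+1 <= j)%N ->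
   kappa * (2 ^+ j * rsq j) <= ('C(j, l))%:R.
Proof.
exists (expR (- (32 * (`|A| + 1))) / 4); first by rewrite divr_gt0 // expR_gt0.
move=> j l D hl1 hl2 hlj hD hj.
(* The extra 1 in [E] serves the reflection l -> j - l, which for odd [j] can land D + 1 above
   [j./2]. *)
pose h := j./2; pose E := D.+1.
have hE : (8 * E <= h)%N by rewrite /h /E; lia.
have h0 : 0 < h%:R :> R by rewrite ltr0n; lia.
pose x : R := (2 * E%:R) / h%:R.
have x01 : 0 <= x <= 1 / 2.
  rewrite divr_ge0 ?mulr_ge0 //= ler_pdivrMr //.
  suff : (8 * E)%:R <= h%:R :> R by rewrite natrM; lra.
  by rewrite ler_nat.
have chain i : (i <= E)%N -> (1 - x) ^+ i * ('C(j, h))%:R <= ('C(j, h + i))%:R :> R.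
  elim: i => [|i IH] hi; first by rewrite expr0 mul1r addn0.
  have := IH (ltnW hi); rewrite exprS -mulrA => IH'.
  have hx : 0 <= 1 - x by lra.
  apply: le_trans (ler_wpM2l hx IH') _.
  have e := mul_bin_left j (h + i).
  have ee : (h + i).+1%:R * ('C(j, h + i.+1))%:R = (j - (h + i))%:R * ('C(j, h + i))%:R :> R.
    by rewrite -!natrM addnS e.
  have hp : 0 < (h + i).+1%:R :> R by [].
  rewrite -(ler_pM2l hp) ee mulrA ler_wpM2r //.
  have e1 : h%:R * (1 - x) = h%:R - 2 * E%:R by rewrite /x; field; lra.
  have e2 : (h + i).+1%:R * (1 - x) <= (h + E)%:R * (1 - x) :> R.
    by rewrite ler_wpM2r // ler_nat; lia.
  have e3 : (h - E)%:R <= (j - (h + i))%:R :> R by rewrite ler_nat; lia.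
  have e4 : E%:R * (1 - x) <= E%:R by rewrite ler_piMr //; lra.
  apply: le_trans e3; apply: le_trans e2 _; rewrite natrD mulrDl e1 natrB; last lia.
  by lra.
have qE : expR (- (32 * (`|A| + 1))) <= (1 - x) ^+ E.
  have := expR_le_1B x01 => hx.
  apply: (@le_trans _ _ (expR (- (2 * x)) ^+ E)); last first.
    by rewrite lerXn2r ?nnegrE ?expR_ge0 //; lra.
  rewrite -expRM_natl ler_expR mulrN lerN2.
  have e1 : E%:R * (2 * x) = 4 * E%:R ^+ 2 / h%:R by rewrite /x; field; lra.
  rewrite e1 ler_pdivrMr //.
  have e2 : E%:R ^+ 2 <= 2 * (D ^ 2)%:R + 2 :> R.
    by rewrite -natrX -[2]/(2%:R) -natrM -natrD ler_nat /E; nia.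
  have e3 : j.+1%:R <= 4 * h%:R :> R.
    by rewrite -natrM ler_nat /h; lia.
  have e4 : (D ^ 2)%:R <= `|A| * j.+1%:R.
    by apply: le_trans hD _; rewrite ler_wpM2r // ler_norm.
  have e5 : `|A| * j.+1%:R <= `|A| * (4 * h%:R) by rewrite ler_wpM2l.
  have e6 : 1 <= h%:R :> R by rewrite ler1n; lia.
  lra.
have pow i : (i <= E)%N -> (1 - x) ^+ E <= (1 - x) ^+ i.
  by move=> iE; rewrite ler_wiXn2l //; lra.
have main i : (i <= E)%N ->
    expR (- (32 * (`|A| + 1))) / 4 * (2 ^+ j * rsq j) <= ('C(j, h + i))%:R.
  move=> iE; apply: le_trans (chain i iE).
  rewrite -mulrA; apply: ler_pM; rewrite ?expR_ge0 //.
  - by rewrite mulr_ge0 ?invr_ge0 // mulr_ge0 ?rsq_ge0 ?exprn_ge0.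
  - by apply: le_trans qE (pow i iE).
  - exact: central_bin_ge_rsq.
case: (leqP h l) => hl.
  by rewrite -(subnKC hl); apply: main; rewrite /E /h; lia.
rewrite -bin_sub // -(@subnKC h (j - l)%N); last by rewrite /h; lia.
by apply: main; rewrite /E /h; lia.
Qed.

End BinomialEstimates.

(** * Powers of polynomials and Kemperman's formula *)

Section CoefficientOrder.
Context {R : realType}.
Implicit Types (p q r F G P : {poly R}).

(** On polynomials with nonnegative coefficients this order survives products, powers and
    composition, so generating functions can be compared without any convergence. *)
Definition lepoly p q := forall i, p`_i <= q`_i.

Lemma lepoly_refl p : lepoly p p. Proof. by []. Qed.

Lemma lepoly_trans p q r : lepoly p q -> lepoly q r -> lepoly p r.
Proof. by move=> a b i; apply: le_trans (a i) (b i). Qed.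

Lemma lepolyD p q p' q' :
  lepoly p q -> lepoly p' q' -> lepoly (p + p') (q + q').
Proof. by move=> a b i; rewrite !coefD lerD. Qed.

Lemma lepolyM p q p' q' : lepoly 0 p -> lepoly 0 p' ->
  lepoly p q -> lepoly p' q' -> lepoly (p * p') (q * q').
Proof.
move=> p0 p0' a b i; rewrite !coefM; apply: ler_sum => j _.
by apply: ler_pM => //; [have := p0 j|have := p0' (i - j)%N]; rewrite coef0.
Qed.

Lemma lepoly0M p q : lepoly 0 p -> lepoly 0 q -> lepoly 0 (p * q).
Proof.
by move=> a b; rewrite -[X in lepoly X](mulr0 (0 : {poly R})); apply: lepolyM.
Qed.

Lemma lepoly01 : lepoly 0 1.
Proof. by move=> i; rewrite coef0 coef1. Qed.

Lemma lepoly0Xe p n : lepoly 0 p -> lepoly 0 (p ^+ n).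
Proof.
move=> p0; elim: n => [|n IH]; first exact: lepoly01.
by rewrite exprS; apply: lepoly0M.
Qed.

Lemma lepolyXe p q n : lepoly 0 p -> lepoly p q -> lepoly (p ^+ n) (q ^+ n).
Proof.
move=> p0 pq; elim: n => [|n IH]; first exact: lepoly_refl.
by rewrite !exprS; apply: lepolyM => //; apply: lepoly0Xe.
Qed.

Lemma lepoly0Xn n : lepoly 0 ('X^n : {poly R}).
Proof. by move=> i; rewrite coef0 coefXn. Qed.

Lemma lepoly0D p q : lepoly 0 p -> lepoly 0 q -> lepoly 0 (p + q).
Proof. by rewrite -[X in _ -> _ -> lepoly X _](addr0 0); apply: lepolyD. Qed.

Lemma lepoly0_deriv p : lepoly 0 p -> lepoly 0 p^`().
Proof. move=> p0 i; have := p0 i.+1; rewrite !coef0 coef_deriv => h.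
exact: mulrn_wge0. Qed.

Lemma coef_comp P F n : (P \Po F)`_n = \sum_(i < size P) P`_i * (F ^+ i)`_n.
Proof. by rewrite comp_polyE coef_sum; apply: eq_bigr => i _; rewrite coefZ. Qed.

Lemma lepoly_comp P F G : lepoly 0 P -> lepoly 0 F -> lepoly F G ->
  lepoly (P \Po F) (P \Po G).
Proof.
move=> P0 F0 FG n; rewrite !coef_comp; apply: ler_sum => i _.
have := P0 i; rewrite coef0 => Pi; apply: ler_wpM2l => //.
exact: lepolyXe.
Qed.

Lemma lepoly0_comp P F : lepoly 0 P -> lepoly 0 F -> lepoly 0 (P \Po F).
Proof.
move=> P0 F0 n; rewrite coef0 coef_comp; apply: sumr_ge0 => i _.
have := P0 i; have := lepoly0Xe i F0 n; rewrite !coef0 => a b.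
exact: mulr_ge0.
Qed.

Lemma horner1_sum p n : (size p <= n)%N -> p.[1] = \sum_(i < n) p`_i.
Proof.
move=> h; rewrite (horner_coef_wide _ h); apply: eq_bigr => i _.
by rewrite expr1n mulr1.
Qed.

Lemma lepoly_horner p x : lepoly 0 p -> 0 <= x -> 0 <= p.[x].
Proof.
move=> p0 x0; rewrite horner_coef; apply: sumr_ge0 => i _.
by have := p0 i; rewrite coef0 => a; rewrite mulr_ge0 // exprn_ge0.
Qed.

Lemma coef_le_horner p x n : lepoly 0 p -> 0 <= x -> p`_n * x ^+ n <= p.[x].
Proof.
move=> p0 x0; rewrite (@horner_coef_wide _ (maxn (size p) n.+1)) ?leq_maxl //.
have hn : (n < maxn (size p) n.+1)%N by rewrite leq_max ltnSn orbT.
rewrite (bigD1 (Ordinal hn)) //= lerDl; apply: sumr_ge0 => i _.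
by have := p0 i; rewrite coef0 => a; rewrite mulr_ge0 // exprn_ge0.
Qed.

Lemma coefM_le p q (M : R) s : lepoly 0 p -> 0 <= M ->
  (forall i, q`_i <= M) -> (p * q)`_s <= p.[1] * M.
Proof.
move=> p0 M0 hq; rewrite coefM (@horner1_sum _ (maxn (size p) s.+1)) ?leq_maxl //.
apply: (@le_trans _ _ ((\sum_(i < s.+1) p`_i) * M)).
  rewrite big_distrl /=; apply: ler_sum => i _; apply: ler_wpM2l => //.
  by have := p0 i; rewrite coef0.
apply: ler_wpM2r => //.
rewrite (big_ord_widen (maxn (size p) s.+1) (fun i => p`_i)) ?leq_maxr //.
rewrite big_mkcond /=; apply: ler_sum => i _; case: ifP => // _.
by have := p0 i; rewrite coef0.
Qed.

Lemma deriv1_sum p : p^`().[1] = \sum_(i < size p) p`_i * i%:R.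
Proof.
have h : (size p^`() <= (size p).-1)%N.
  case: (posnP (size p)) => [/eqP|h]; first by rewrite size_poly_eq0 => /eqP ->; rewrite linear0 size_poly0.
  rewrite -ltnS prednK //; apply: lt_size_deriv.
  by rewrite -size_poly_gt0.
rewrite (horner1_sum h); case: (size p) => [|m]; first by rewrite !big_ord0.
rewrite [RHS]big_ord_recl mulr0 add0r /=; apply: eq_bigr => i _.
by rewrite coef_deriv mulr_natr.
Qed.

Lemma deriv2_sum p :
  p^`()^`().[1] = \sum_(i < size p) p`_i * (i%:R * (i%:R - 1)).
Proof.
have -> : p^`()^`().[1] = ('X * p^`())^`().[1] - p^`().[1].
  by rewrite derivM derivX hornerD !hornerM hornerX !hornerC; ring.
have wide (q : {poly R}) n : (size q <= n)%N ->
    q^`().[1] = \sum_(i < n) q`_i * i%:R.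
  move=> h; rewrite deriv1_sum (big_ord_widen n (fun i => q`_i * i%:R)) //.
  rewrite big_mkcond; apply: eq_bigr => i _; case: ltnP => // h2.
  by rewrite nth_default // mul0r.
case: (eqVneq p 0) => [->|p0].
  by rewrite !(linear0, mulr0) !horner0 subr0 size_poly0 big_ord0.
rewrite (wide ('X * p^`()) (size p)).
  rewrite deriv1_sum -sumrB; apply: eq_bigr => i _; rewrite coefXM coef_deriv.
  case: (i : nat) => [|j]; first by rewrite !mul0r !mulr0 subrr.
  by rewrite -[p`_j.+1 *+ _]mulr_natr /=; ring.
case: (eqVneq p^`() 0) => [->|q0]; first by rewrite mulr0 size_poly0.
by rewrite mulrC size_mulX // lt_size_deriv.
Qed.

Lemma horner1_size p : p.[1] = \sum_(i < size p) p`_i.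
Proof. exact: horner1_sum. Qed.

End CoefficientOrder.

(** * Flatness of powers of a polynomial, Kemperman weights, trees of bounded height *)

Section PowerCoefficients.
Context {R : realType}.
Implicit Types (c C : R) (n j k s K : nat).

(** Extremal solution of the recursion in [smoothing_recursion]: [n] counts the steps still to be
    analysed, [j] the uniform smoothings already collected. It serves with d = 1 for powers of
    polynomials and with the dimension for the heat kernel. *)
Fixpoint smooth c C (d : nat) n j : R :=
  if n is m.+1 then c * smooth c C d m j.+1 + (1 - c) * smooth c C d m j
  else C * rsq j ^+ d.

Lemma smooth_ge0 c C d n j : 0 < c <= 1 -> 0 <= C -> 0 <= smooth c C d n j.
Proof.
move=> /andP[c0 c1] C0; elim: n j => [|n IH] j /=.
  by rewrite mulr_ge0 // exprn_ge0 // rsq_ge0.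
by rewrite addr_ge0 // mulr_ge0 // ?subr_ge0 // ltW.
Qed.

Lemma smooth_le c C d n : 0 < c <= 1 -> (0 < d)%N -> 0 <= C ->
  smooth c C d n 0 <= C * Num.sqrt (2 * d%:R / c) ^+ d * rsq n ^+ d.
Proof. by move=> hc hd hC; apply: (smoothing_recursion hc hd hC). Qed.

Lemma coef_half_le k j i : (0 < k)%N ->
  ((2^-1 *: (1 + 'X^k) : {poly R}) ^+ j)`_i <= 2 * rsq j.
Proof.
move=> k0.
rewrite exprZn coefZ addrC exprDn coef_sum.
have tw : (0 < 2 ^+ j :> R) by rewrite exprn_gt0.
rewrite exprVn ler_pdivrMl //.
have bnd l : (('X^k ^+ (j - l) * 1 ^+ l) *+ 'C(j, l) : {poly R})`_i =
    ((i == k * (j - l))%N%:R *+ 'C(j, l)).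
  by rewrite expr1n mulr1 coefMn -exprM coefXn.
under eq_bigr do rewrite bnd.
case: (boolP [exists l : 'I_j.+1, i == (k * (j - l))%N]) => [/existsP[l /eqP il]|].
  rewrite (bigD1 l) //= il eqxx big1 ?addr0; last first.
    move=> l' ll'; rewrite eqn_pmul2l // (_ : (_ == _) = false) ?mul0rn //.
    apply/negbTE; apply: contra ll' => /eqP h; apply/eqP/val_inj => /=.
    by have := ltn_ord l; have := ltn_ord l'; lia.
  by rewrite mulrA -mulr_natr mul1r bin_le_rsq.
rewrite negb_exists => /forallP h; rewrite big1.
  by rewrite mulr_ge0 ?mulr_ge0 ?rsq_ge0 // ltW.
by move=> l _; rewrite (negbTE (h l)) mul0rn.
Qed.

Variable f : {poly R}.
Hypotheses (f_ge0 : lepoly 0 f) (f1 : f.[1] <= 1).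

(** Write f = c g + r with g the fair law on 0 and k, and r nonnegative of mass at most 1 - c. Each
    factor of [f ^+ n] either contributes one more fair coin or only averages; the coefficients of
    [g ^+ j] are binomial, so the smoothing recursion in dimension one applies. *)
Lemma coefX_le_rsq c k n s : 0 < c <= 1 -> (0 < k)%N ->
  c / 2 <= f`_0 -> c / 2 <= f`_k ->
  (f ^+ n)`_s <= 2 * Num.sqrt (2 / c) * rsq n.
Proof.
move=> hc k0 f0c fkc; have /andP[c0 c1] := hc.
pose g : {poly R} := 2^-1 *: (1 + 'X^k).
pose r := f - c *: g.
have gE i : g`_i = 2^-1 * ((i == 0%N)%:R + (i == k)%:R).
  by rewrite coefZ coefD coef1 coefXn.
have r0 : lepoly 0 r.
  move=> i; rewrite coef0 coefB coefZ gE subr_ge0.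
  case: (altP (i =P 0%N)) => [->|i0].
    by rewrite (ltn_eqF k0) addr0 mulr1.
  rewrite add0r; case: (altP (i =P k)) => [->|ik]; first by rewrite mulr1.
  by rewrite mulr0 mulr0; have := f_ge0 i; rewrite coef0.
have r1 : r.[1] <= 1 - c.
  rewrite hornerD hornerN !hornerZ hornerD hornerXn hornerC expr1n.
  have -> : c * (2^-1 * (1 + 1)) = c by field.
  by rewrite lerD2r.
have gj j i : (g ^+ j)`_i <= 2 * rsq j by apply: coef_half_le.
have main m : forall j i, (f ^+ m * g ^+ j)`_i <= smooth c 2 1 m j.
  elim: m => [|m IH] j i /=; first by rewrite mul1r expr1.
  have -> : f ^+ m.+1 * g ^+ j = c *: (f ^+ m * g ^+ j.+1) + r * (f ^+ m * g ^+ j).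
    rewrite /r mulrBl -scalerAl !exprS; have -> : g * (f ^+ m * g ^+ j) = f ^+ m * (g * g ^+ j) by ring.
    by rewrite addrC subrK mulrA.
  rewrite coefD coefZ; apply: lerD; first by rewrite ler_wpM2l // ltW.
  have sm0 : 0 <= smooth c 2 1 m j by apply: smooth_ge0.
  apply: le_trans (coefM_le i r0 sm0 (IH j)) _.
  by rewrite ler_wpM2r.
have := main n 0%N s; rewrite mulr1 => h; apply: le_trans h _.
have := smooth_le n hc (ltn0Sn 0) (ler0n R 2).
by rewrite mulr1 !expr1.
Qed.

(* Kemperman's formula: the weight of the forests of [K] trees with [n] vertices
   in total. *)
Definition kemp n K : R :=
  if n is 0%N then (K == 0%N)%:R
  else if (K <= n)%N then K%:R / n%:R * (f ^+ n)`_(n - K) else 0.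

Lemma kemp_ge0 n K : 0 <= kemp n K.
Proof.
rewrite /kemp; case: n => [|n]; first by case: eqP.
case: ifP => // _; rewrite mulr_ge0 ?divr_ge0 //.
by have := lepoly0Xe n.+1 f_ge0 (n.+1 - K)%N; rewrite coef0.
Qed.

(* The exchangeability argument of the hitting time theorem, via the
   coefficients of the derivative of [f ^+ n]. *)
Lemma kempS n K : (0 < K)%N ->
  kemp n.+1 K = \sum_(k < size f) f`_k * kemp n (K.-1 + k).
Proof.
move=> K0.
have wide m (F : nat -> R) : (forall k, (m < k)%N -> F k = 0) ->
    \sum_(k < size f) f`_k * F k = \sum_(k < m.+1) f`_k * F k.
  move=> Fm; pose M := maxn (size f) m.+1.
  transitivity (\sum_(k < M) f`_k * F k).
    rewrite (big_ord_widen M (fun k => f`_k * F k)) ?leq_maxl //.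
    rewrite [RHS](bigID (fun k : 'I_M => (k < size f)%N)) /= addrC.
    rewrite [X in _ = X + _]big1 ?add0r //.
    by move=> k; rewrite -leqNgt => hk; rewrite nth_default // mul0r.
  rewrite [RHS](big_ord_widen M (fun k => f`_k * F k)) ?leq_maxr //.
  rewrite [LHS](bigID (fun k : 'I_M => (k < m.+1)%N)) /= addrC.
  rewrite [X in X + _ = _]big1 ?add0r //.
  by move=> k; rewrite -leqNgt => hk; rewrite Fm // mulr0.
case: n => [|n].
  rewrite /= (wide 0%N (fun k => (K.-1 + k == 0)%N%:R)); last first.
    by move=> k k0; rewrite addn_eq0 (gtn_eqF k0) andbF.
  rewrite big_ord1 addn0 divr1.
  case: K K0 => // -[_|K _] /=; first by rewrite mul1r mulr1 expr1.
  by rewrite mulr0.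
case: (leqP K n.+2) => hK; last first.
  rewrite /= leqNgt hK /= big1 // => k _.
  by rewrite (_ : (_ <= _)%N = false) ?mulr0 //; lia.
pose m := (n.+2 - K)%N.
rewrite (wide m (fun k => kemp n.+1 (K.-1 + k))); last first.
  by move=> k; rewrite /m /= => hk; rewrite (_ : (_ <= _)%N = false) //; lia.
have term (k : 'I_m.+1) : f`_k * kemp n.+1 (K.-1 + k) =
    n.+1%:R^-1 * (K.-1%:R * (f`_k * (f ^+ n.+1)`_(m - k)) +
        (('X * f^`())`_k * (f ^+ n.+1)`_(m - k))).
  have hk := ltn_ord k; rewrite /kemp (_ : (_ <= _)%N); last by rewrite /m in hk *; lia.
  have -> : (n.+1 - (K.-1 + k) = m - k)%N by rewrite /m in hk *; lia.
  have -> : ('X * f^`())`_k = k%:R * f`_k.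
    rewrite coefXM coef_deriv; case: (k : nat) => [|k'] /=; first by rewrite mul0r.
    by rewrite mulr_natl.
  by rewrite natrD; field; rewrite nat1r pnatr_eq0.
under [RHS]eq_bigr do rewrite term.
rewrite -big_distrr /= big_split /= -big_distrr /= -!coefM -exprS.
have e : ('X * f^`() * f ^+ n.+1)`_m = m%:R / n.+2%:R * (f ^+ n.+2)`_m.
  have -> : 'X * f^`() * f ^+ n.+1 = n.+2%:R^-1 *: ('X * (f ^+ n.+2)^`()).
    by rewrite deriv_exp -scaler_nat -scalerAr scalerA mulVf ?pnatr_eq0 // scale1r mulrA.
  rewrite coefZ coefXM coef_deriv; case: (m) => [|m'] /=; first by rewrite mulr0 !mul0r.
  by rewrite -mulr_natl; ring.
rewrite e /kemp hK -/m.
have -> : m%:R = n.+2%:R - K%:R :> R by rewrite /m natrB.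
have -> : K.-1%:R = K%:R - 1 :> R by rewrite -[in RHS](prednK K0) -natr1; ring.
have x0 : 0 < n.+1%:R :> R by [].
rewrite -(natr1 n.+1); move: (n.+1%:R : R) x0 => x x0.
by field; apply/andP; split; rewrite gt_eqF //; lra.
Qed.

(* Generating function, by size, of the trees with at most [H] generations. *)
Fixpoint treegf (H : nat) : {poly R} :=
  if H is G.+1 then 'X * (f \Po treegf G) else 0.

Lemma treegf_ge0 H : lepoly 0 (treegf H).
Proof.
elim: H => [|H IH] /=; first exact: lepoly_refl.
by apply: lepoly0M; [apply: (lepoly0Xn 1)|apply: lepoly0_comp].
Qed.

Lemma treegfS H : lepoly (treegf H) (treegf H.+1).
Proof.
elim: H => [|H IH]; first exact: treegf_ge0.
rewrite /=; apply: lepolyM => //; last by apply: lepoly_comp => //; apply: treegf_ge0.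
- exact: (lepoly0Xn 1).
- exact: lepoly0_comp (treegf_ge0 _).
Qed.

Lemma treegfX0 H K : ((treegf H) ^+ K)`_0 = (K == 0%N)%:R.
Proof.
case: K => [|K]; first by rewrite expr0 coef1.
rewrite exprS coefM big_ord1 /=.
have -> : (treegf H)`_0 = 0 by case: H => [|H] /=; rewrite ?coef0 // coefXM.
by rewrite mul0r.
Qed.

Lemma treegfX_coefS H K n : ((treegf H.+1) ^+ K.+1)`_n.+1 =
  \sum_(k < size f) f`_k * (treegf H ^+ k * treegf H.+1 ^+ K)`_n.
Proof.
rewrite exprS [in LHS]/= -mulrA coefXM /= comp_polyE mulr_suml coef_sum.
by apply: eq_bigr => k _; rewrite -scalerAl coefZ.
Qed.

(** [kempS] and [treegfX_coefS] both replace the first tree of a forest by the subtrees below its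
    root. The height restriction only discards trees, and discards none when n <= H, which gives the
    converse bound in the next lemma. *)
Lemma treegfX_le n : forall H K, ((treegf H) ^+ K)`_n <= kemp n K.
Proof.
elim: n => [|n IH] H K; first by rewrite treegfX0.
case: K => [|K]; first by rewrite expr0 coef1 kemp_ge0.
case: H => [|H]; first by rewrite exprS mul0r coef0 kemp_ge0.
rewrite treegfX_coefS kempS //=; apply: ler_sum => k _.
have := f_ge0 k; rewrite coef0 => fk; apply: ler_wpM2l => //.
apply: le_trans (IH H.+1 (K + k)%N); rewrite exprD mulrC.
apply: lepolyM.
- exact: (lepoly0Xe K (treegf_ge0 H.+1)).
- exact: (lepoly0Xe k (treegf_ge0 H)).
- exact: lepoly_refl.
- by apply: lepolyXe; [exact: treegf_ge0|exact: treegfS].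
Qed.

Lemma treegfX_ge n : forall H K, (n <= H)%N -> kemp n K <= ((treegf H) ^+ K)`_n.
Proof.
elim: n => [|n IH] H K hn; first by rewrite treegfX0.
case: K => [|K]; first by rewrite expr0 coef1 /= mul0r mul0r.
case: H hn => // H hn.
rewrite treegfX_coefS kempS //=; apply: ler_sum => k _.
have := f_ge0 k; rewrite coef0 => fk; apply: ler_wpM2l => //.
apply: le_trans (IH H (K + k)%N hn) _; rewrite exprD mulrC.
apply: lepolyM.
- exact: (lepoly0Xe k (treegf_ge0 H)).
- exact: (lepoly0Xe K (treegf_ge0 H)).
- exact: lepoly_refl.
- by apply: lepolyXe; [exact: treegf_ge0|exact: treegfS].
Qed.

(** The factor K / n in Kemperman's formula turns the sum of the coefficients P_K into the sum of K
    P_K, that is P'(1). Each tree count below acquires one derivative and one power of 1/n in this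
    way. *)
Lemma treegf_comp_le (P : {poly R}) H n (M : R) : lepoly 0 P -> (0 < n)%N ->
  0 <= M -> (forall s, (f ^+ n)`_s <= M) ->
  (P \Po treegf H)`_n <= P^`().[1] * (M / n%:R).
Proof.
move=> P0 n0 M0 hM; rewrite coef_comp.
rewrite deriv1_sum mulr_suml; apply: ler_sum => i _.
have := P0 i; rewrite coef0 => Pi; rewrite -mulrA; apply: ler_wpM2l => //.
apply: le_trans (treegfX_le n H i) _; case: n n0 hM => // n _ hM.
rewrite /kemp; case: ifP => _; last by rewrite !mulr_ge0 ?invr_ge0.
rewrite mulrA mulrAC; apply: ler_wpM2r; first by rewrite invr_ge0.
by apply: ler_wpM2l.
Qed.

End PowerCoefficients.

(** * Moments of a law read off from its generating function *)

Section PolynomialMoments.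
Context {R : realType}.
Implicit Types (p q : {poly R}) (a b : R).

Definition pmom1 p a : R := \sum_(i < size p) p`_i * (i%:R - a).
Definition pmom2 p a : R := \sum_(i < size p) p`_i * (i%:R - a) ^+ 2.

Lemma pmom1E p a : pmom1 p a = p^`().[1] - a * p.[1].
Proof.
rewrite deriv1_sum horner1_size mulr_sumr -sumrB; apply: eq_bigr => i _; ring.
Qed.

Lemma pmom2E p a :
  pmom2 p a = p^`()^`().[1] + (1 - 2 * a) * p^`().[1] + a ^+ 2 * p.[1].
Proof.
rewrite deriv2_sum deriv1_sum horner1_size !mulr_sumr -!big_split /=.
by apply: eq_bigr => i _; ring.
Qed.

Lemma pmom1M p q a b :
  pmom1 (p * q) (a + b) = pmom1 p a * q.[1] + p.[1] * pmom1 q b.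
Proof. by rewrite !pmom1E derivM hornerD !hornerM; ring. Qed.

Lemma pmom2M p q a b :
  pmom2 (p * q) (a + b) = pmom2 p a * q.[1] + p.[1] * pmom2 q b
    + 2 * pmom1 p a * pmom1 q b.
Proof.
by rewrite !pmom2E !pmom1E derivM derivD !derivM !hornerD !hornerM; ring.
Qed.

Lemma pmom2_ge0 p a : lepoly 0 p -> 0 <= pmom2 p a.
Proof.
move=> p0; apply: sumr_ge0 => i _; have := p0 i; rewrite coef0 => h.
by rewrite mulr_ge0 ?sqr_ge0.
Qed.

Lemma pmom1X p a (e : R) n : lepoly 0 p -> p.[1] <= 1 -> `|pmom1 p a| <= e ->
  `|pmom1 (p ^+ n) (n%:R * a)| <= n%:R * e.
Proof.
move=> p0 p1 he; have pp : 0 <= p.[1] by apply: lepoly_horner.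
have e0 : 0 <= e by apply: le_trans he.
elim: n => [|n IH].
  by rewrite expr0 !mul0r pmom1E derivC horner0 mul0r subr0 normr0.
have -> : n.+1%:R * a = a + n%:R * a by rewrite -natr1; ring.
rewrite exprS pmom1M; apply: le_trans (ler_normD _ _) _; rewrite !normrM.
have -> : n.+1%:R * e = e * 1 + 1 * (n%:R * e) by rewrite -natr1; ring.
apply: lerD; apply: ler_pM => //.
  rewrite ger0_norm ?lepoly_horner //; last exact: lepoly0Xe.
  by rewrite horner_exp exprn_ile1.
by rewrite ger0_norm.
Qed.

(** Variances add, and each of the n (n - 1) cross terms is at most e^2. Here [e] is the drift left
    by cutting the law, so the second term stays bounded as long as n e does. *)
Lemma pmom2X p a (e v : R) n : lepoly 0 p -> p.[1] <= 1 -> `|pmom1 p a| <= e ->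
  pmom2 p a <= v -> pmom2 (p ^+ n) (n%:R * a) <= n%:R * v + (n%:R * e) ^+ 2.
Proof.
move=> p0 p1 he hv; have pp : 0 <= p.[1] by apply: lepoly_horner.
have e0 : 0 <= e by apply: le_trans he.
elim: n => [|n IH].
  by rewrite expr0 !mul0r pmom2E derivC !(linear0, horner0) !mulr0 expr0n !mul0r !addr0.
have -> : n.+1%:R * a = a + n%:R * a by rewrite -natr1; ring.
have pn1 : 0 <= (p ^+ n).[1] <= 1.
  rewrite lepoly_horner //; last exact: lepoly0Xe.
  by rewrite horner_exp exprn_ile1.
have v0 : 0 <= pmom2 p a by apply: pmom2_ge0.
have w0 : 0 <= pmom2 (p ^+ n) (n%:R * a) by apply/pmom2_ge0/lepoly0Xe.
have h1 : pmom2 p a * (p ^+ n).[1] <= v * 1 by apply: ler_pM => //; lra.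
have h2 : p.[1] * pmom2 (p ^+ n) (n%:R * a) <= 1 * (n%:R * v + (n%:R * e) ^+ 2).
  exact: ler_pM.
have h3 : pmom1 p a * pmom1 (p ^+ n) (n%:R * a) <= e * (n%:R * e).
  apply: le_trans (ler_norm _) _; rewrite normrM; apply: ler_pM => //.
  exact: pmom1X.
rewrite exprS pmom2M -mulrA.
have -> : n.+1%:R * v + (n.+1%:R * e) ^+ 2 =
   v * 1 + 1 * (n%:R * v + (n%:R * e) ^+ 2) + 2 * (e * (n%:R * e)) + e ^+ 2.
  by rewrite -natr1; ring.
have := sqr_ge0 e; lra.
Qed.

End PolynomialMoments.

(** * Local lower bound for a law convolved with a lattice binomial law *)

Section LocalLowerBound.
Context {R : realType}.
Implicit Types (W : {poly R}) (a g j s t n D : nat).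

Definition twopt a g : {poly R} := 2^-1 *: ('X^a * (1 + 'X^g)).

Lemma twopt_ge0 a g : lepoly 0 (twopt a g).
Proof.
move=> i; rewrite coef0 coefZ mulr_ge0 ?invr_ge0 //.
have /(_ i) := lepoly0M (@lepoly0Xn R a) (lepoly0D (@lepoly01 R) (@lepoly0Xn R g)).
by rewrite coef0.
Qed.

Lemma twopt1 a g : (twopt a g).[1] = 1.
Proof. by rewrite /twopt hornerZ hornerM hornerD !hornerXn hornerC !expr1n; field. Qed.

Lemma pmom1_twopt a g : pmom1 (twopt a g) (a%:R + g%:R / 2) = 0.
Proof.
rewrite pmom1E twopt1 /twopt derivZ derivM derivD !derivXn derivC.
rewrite !(hornerZ, hornerM, hornerD, hornerMn, hornerXn, hornerC) !expr1n.
by field.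
Qed.

Lemma coef_twoptX a g j l : (0 < g)%N ->
  (twopt a g ^+ j)`_(a * j + g * l) = 2 ^- j * ('C(j, l))%:R.
Proof.
move=> g0; rewrite exprZn coefZ exprVn; congr (_ * _).
rewrite exprMn -exprM coefXnM (_ : (_ < _)%N = false); last by lia.
rewrite addKn addrC exprDn coef_sum.
have bnd i : ('X^g ^+ (j - i) * 1 ^+ i *+ 'C(j, i))`_(g * l) =
    ((l == (j - i))%N%:R *+ 'C(j, i)) :> R.
  by rewrite expr1n mulr1 coefMn -exprM coefXn eqn_pmul2l.
under eq_bigr do rewrite bnd.
case: (leqP l j) => lj; last first.
  by rewrite bin_small // big1 // => i _; rewrite gtn_eqF ?mul0rn //; lia.
have hi : (j - l < j.+1)%N by lia.
rewrite (bigD1 (Ordinal hi)) //= subKn // eqxx bin_sub // big1 ?addr0 //.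
move=> i; rewrite -(inj_eq val_inj) /= => ne.
by rewrite (_ : (_ == _) = false) ?mul0rn //; have := ltn_ord i; lia.
Qed.

(** A shift [t] drawn from [W] leaves s - t as target for the binomial factor, and t = b, the point
    at which [pmom2] is taken, puts that target at its centre. Shifts within [L] of it contribute
    [kappa * rsq j] by the binomial estimate; the others are charged to Chebyshev's inequality.
    Divisibility by [g] makes s - t - a j a multiple of the gap. *)
Lemma mul_twoptX_ge (A kappa : R) a g j s D (L : R) W :
  (forall l D, (j./2 <= l + D)%N -> (l <= j./2 + D)%N -> (l <= j)%N ->
   (D ^ 2)%:R <= A * j.+1%:R -> (16 * D.+1 <= j)%N ->
   kappa * (2 ^+ j * rsq j) <= ('C(j, l))%:R) ->
  0 < kappa -> lepoly 0 W -> (0 < g)%N -> (forall t, 0 < W`_t -> (g %| t)%N) ->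
  (g %| a)%N -> (g %| s)%N -> 0 < L -> 2 * L <= g%:R * j%:R -> L + g%:R <= g%:R * D%:R ->
  (D ^ 2)%:R <= A * j.+1%:R -> (16 * D.+1 <= j)%N ->
  kappa * rsq j * (W.[1] - pmom2 W (s%:R - j%:R * (a%:R + g%:R / 2)) / L ^+ 2)
    <= (W * twopt a g ^+ j)`_s.
Proof.
move=> hbin k0 W0 g0 gW ga gs L0 hL hD1 hD2 hD3.
have g0' : 0 < g%:R :> R by rewrite ltr0n.
pose b := s%:R - j%:R * (a%:R + g%:R / 2) : R.
have B0 := lepoly0Xe j (twopt_ge0 a g).
have term t : kappa * rsq j * (W`_t - W`_t * (t%:R - b) ^+ 2 / L ^+ 2) <=
    (if (t < s.+1)%N then W`_t * (twopt a g ^+ j)`_(s - t) else 0).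
  have Wt : 0 <= W`_t by have := W0 t; rewrite coef0.
  have L2 : 0 < L ^+ 2 by rewrite exprn_gt0.
  have kr : 0 < kappa * rsq j by rewrite mulr_gt0 // rsq_gt0.
  have rhs0 : 0 <= (if (t < s.+1)%N then W`_t * (twopt a g ^+ j)`_(s - t) else 0).
    case: ifP => // _; apply: mulr_ge0 => //.
    by have := B0 (s - t)%N; rewrite coef0.
  case: (eqVneq W`_t 0) => [Wt0|Wtn].
    by move: rhs0; rewrite Wt0 !mul0r subrr mulr0.
  have Wtp : 0 < W`_t by rewrite lt_neqAle eq_sym Wtn.
  have -> : W`_t - W`_t * (t%:R - b) ^+ 2 / L ^+ 2 =
     W`_t * (1 - (t%:R - b) ^+ 2 / L ^+ 2) by ring.
  (* Outside the window the left side is nonpositive: Chebyshev's inequality is built into the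
     termwise factor 1 - (t - b)^2 / L^2. *)
  case: (leP (L ^+ 2) ((t%:R - b) ^+ 2)) => hbad.
    apply: le_trans rhs0; apply: mulr_ge0_le0; first exact: ltW.
    by apply: mulr_ge0_le0 => //; rewrite subr_le0 ler_pdivlMr // mul1r.
  have /ltr_normlP[h1 h2] : `|t%:R - b| < L.
    rewrite -(ltr_pXn2r (n := 2)) ?nnegrE // ?(ltW L0) //.
    by rewrite -normrX ger0_norm ?sqr_ge0.
  have bE : b = s%:R - (a * j)%:R - g%:R * j%:R / 2 by rewrite /b natrM; field.
  have ts : (t + a * j < s)%N.
    by rewrite -(ltr_nat R) natrD; lra.
  have sts : (s < t + a * j + g * j)%N.
    by rewrite -(ltr_nat R) !natrD (natrM _ g); lra.
  have /dvdnP[l hl] : (g %| s - t - a * j)%N.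
    apply: dvdn_sub; last exact: dvdn_mulr.
    by apply: dvdn_sub => //; apply: gW.
  have [hs hs2] : (s - t = a * j + g * l)%N /\ (s = t + a * j + g * l)%N.
    move: hl ts; rewrite (mulnC l); clear; move: (a * j)%N (g * l)%N => u v; lia.
  rewrite ltnS (_ : (t <= s)%N) ?hs; last by rewrite hs2 -addnA leq_addr.
  rewrite coef_twoptX //.
  have hsR : s%:R = t%:R + (a * j)%:R + g%:R * l%:R :> R by rewrite hs2 !natrD (natrM _ g).
  have hg (x y : nat) : g%:R * x%:R < g%:R * y%:R :> R -> (x < y)%N.
    by rewrite ltr_pM2l // ltr_nat.
  have j2 : j%:R = j./2.*2%:R + (odd j)%:R :> R by rewrite -natrD -[in LHS](odd_double_half j) addnC.
  have j3 : 0 <= (odd j)%:R :> R by [].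
  have j3' : (odd j)%:R <= 1 :> R by rewrite -[leRHS]/(1%:R) ler_nat leq_b1.
  have j4 : j./2.*2%:R = 2 * j./2%:R :> R by rewrite -mul2n natrM.
  have j5 : 0 <= g%:R * (odd j)%:R :> R by rewrite mulr_ge0.
  have j5' : g%:R * (odd j)%:R <= g%:R :> R by rewrite ler_piMr // ltW.
  have gj : g%:R * j%:R = 2 * (g%:R * j./2%:R) + g%:R * (odd j)%:R :> R by rewrite j2 j4; ring.
  have hC : kappa * (2 ^+ j * rsq j) <= ('C(j, l))%:R.
    apply: (hbin l D) => //.
    - rewrite -ltnS; apply: hg; rewrite -addnS natrD mulrDr -natr1 mulrDr; lra.
    - rewrite -ltnS; apply: hg; rewrite -addnS natrD mulrDr -natr1 mulrDr; lra.
    - have : (g * l <= g * j)%N by move: sts; rewrite hs2 ltn_add2l => /ltnW.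
      by rewrite leq_pmul2l.
  have q1 : (1 - (t%:R - b) ^+ 2 / L ^+ 2) <= 1.
    by rewrite gerBl divr_ge0 ?sqr_ge0.
  apply: (@le_trans _ _ (kappa * rsq j * W`_t)).
    by rewrite ler_pM2l // ler_piMr.
  rewrite mulrC; apply: ler_wpM2l => //.
  rewrite ler_pdivlMl ?exprn_gt0 //; by move: hC; rewrite mulrCA.
have -> : (W * twopt a g ^+ j)`_s =
    \sum_(t < maxn (size W) s.+1) (if (t < s.+1)%N then W`_t * (twopt a g ^+ j)`_(s - t) else 0).
  rewrite coefM (big_ord_widen _ (fun t => W`_t * (twopt a g ^+ j)`_(s - t)) (leq_maxr (size W) s.+1)).
  by rewrite big_mkcond.
have hw : (size W <= maxn (size W) s.+1)%N by rewrite leq_maxl.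
rewrite /pmom2 (horner1_sum hw) (big_ord_widen _ (fun t => W`_t * (t%:R - b) ^+ 2) hw).
rewrite [X in _ - X / _]big_mkcond /= mulr_suml -sumrB mulr_sumr; apply: ler_sum => t _.
apply: le_trans (term t); case: ifP => // /negbT; rewrite -leqNgt => ht.
by rewrite nth_default // !mul0r !subrr.
Qed.

End LocalLowerBound.

(** * Local lower bound for sums of offspring numbers *)

Section PolynomialMomentBounds.
Context {R : realType}.

Lemma pmom2_sum (I : Type) (r : seq I) (F : I -> {poly R}) (a0 : R) :
  pmom2 (\sum_(i <- r) F i) a0 = \sum_(i <- r) pmom2 (F i) a0.
Proof.
under [RHS]eq_bigr do rewrite pmom2E.
by rewrite pmom2E !big_split /= -!mulr_sumr !raddf_sum /= !horner_sum.
Qed.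

Lemma sum_coef_sqr_le (p : {poly R}) (a0 e : R) : lepoly 0 p -> 0 < e ->
  \sum_(j < size p) p`_j * (e <= a0 - j%:R)%R%:R <= pmom2 p a0 / e ^+ 2.
Proof.
move=> p0 e0; rewrite /pmom2 mulr_suml; apply: ler_sum => j _; rewrite -mulrA.
have := p0 j; rewrite coef0 => pj; apply: ler_wpM2l => //.
case: (leP e (a0 - j%:R)) => h; last by rewrite divr_ge0 ?sqr_ge0.
rewrite ler_pdivlMr ?exprn_gt0 // mul1r -(sqrrN (j%:R - a0)) opprB.
by rewrite lerXn2r ?nnegrE //; lra.
Qed.

Lemma natr_large (x : R) : exists n0, forall n, (n0 <= n)%N -> x <= n%:R.
Proof.
exists (Num.truncn x).+1 => n hn.
apply: ltW; apply: lt_le_trans (truncnS_gt x) _.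
by rewrite ler_nat.
Qed.

(** Chebyshev's inequality for the polynomial c X + r, a law of mass slightly below 1. Since M e <=
    1, the missing mass adds at most 1 to the second moment, which is then at most 2 M, and 64 <= M
    c^2 leaves ample room. *)
Lemma binomial_lower_tail (c r e : R) M : 0 < c -> c <= 1 -> 0 <= r ->
  1 - e <= c + r -> c + r <= 1 -> M%:R * e <= 1 -> 64 <= M%:R * c ^+ 2 ->
  \sum_(j < M.+1) c ^+ j * ('C(M, j))%:R * r ^+ (M - j)
     * (c * M%:R / 2 <= M%:R * c - j%:R)%R%:R <= 1 / 4.
Proof.
move=> c0 c1 r0 cr0 cr1 Me hM.
pose Q : {poly R} := c *: 'X + r%:P.
have Q0 : lepoly 0 Q.
  move=> i; rewrite coef0 coefD coefZ coefX coefC addr_ge0 //.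
    by rewrite mulr_ge0 // ltW.
  by case: ifP.
have Q1E : Q.[1] = c + r by rewrite hornerD hornerZ hornerX hornerC mulr1.
have QdE : Q^`().[1] = c.
  by rewrite derivD derivZ derivX derivC !hornerE.
have Qd2E : Q^`()^`().[1] = 0.
  by rewrite derivD derivZ derivX derivC addr0 derivZ derivC scaler0 horner0.
have QM j : (Q ^+ M)`_j = c ^+ j * ('C(M, j))%:R * r ^+ (M - j).
  rewrite /Q addrC exprDn coef_sum.
  have term (i : 'I_M.+1) : (r%:P ^+ (M - i) * (c *: 'X) ^+ i *+ 'C(M, i))`_j =
      (j == i)%:R * (c ^+ i * ('C(M, i))%:R * r ^+ (M - i)).
    rewrite coefMn -polyC_exp coefCM exprZn coefZ coefXn -mulr_natr; ring.
  under eq_bigr do rewrite term.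
  case: (ltnP j M.+1) => hj.
    rewrite (bigD1 (Ordinal hj)) //= eqxx mul1r big1 ?addr0 // => i.
    rewrite -(inj_eq val_inj) /= => ne.
    by rewrite eq_sym (negbTE ne) mul0r.
  rewrite bin_small // mulr0 mul0r big1 // => i _.
  by rewrite gtn_eqF ?mul0r //; exact: leq_trans (ltn_ord i) hj.
clearbody Q.
have Q1 : Q.[1] <= 1 by rewrite Q1E.
have e0 : 0 <= e by lra.
have e1 : `|pmom1 Q c| <= e.
  rewrite pmom1E QdE Q1E -[X in X - _]mulr1 -mulrBr normrM gtr0_norm //.
  rewrite ger0_norm; last by rewrite subr_ge0.
  apply: (@le_trans _ _ (1 * (1 - (c + r)))); last by lra.
  by rewrite ler_wpM2r // subr_ge0.
have e2 : pmom2 Q c <= 1.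
  rewrite pmom2E QdE Qd2E Q1E.
  have : c ^+ 2 * (c + r) <= c ^+ 2 * 1 by apply: ler_wpM2l; rewrite ?sqr_ge0.
  rewrite expr2; nra.
have e3 := pmom2X M Q0 Q1 e1 e2.
have e5 : (M%:R * e) ^+ 2 <= 1 by rewrite exprn_ile1 // mulr_ge0.
have M0 : 0 < M%:R :> R.
  by rewrite ltr0n lt0n; apply: contraTneq hM => ->; rewrite mul0r -ltNge.
have M1 : 1 <= M%:R :> R by move: M0; rewrite ltr0n ler1n.
have cM0 : 0 < c * M%:R / 2 by rewrite divr_gt0 // mulr_gt0.
have QM0 := lepoly0Xe M Q0.
have e6 := sum_coef_sqr_le (M%:R * c) QM0 cM0.
apply: (@le_trans _ _ (pmom2 (Q ^+ M) (M%:R * c) / (c * M%:R / 2) ^+ 2)).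
  apply: le_trans e6.
  have szQ : (size (Q ^+ M) <= M.+1)%N.
    by apply/leq_sizeP => j hj; rewrite QM bin_small // mulr0 mul0r.
  rewrite [leRHS](big_ord_widen M.+1 (fun j => (Q ^+ M)`_j * (c * M%:R / 2 <= M%:R * c - j%:R)%R%:R)) //.
  rewrite [leRHS]big_mkcond; apply: ler_sum => j _.
  have -> : (if (j < size (Q ^+ M))%N then (Q ^+ M)`_j * (c * M%:R / 2 <= M%:R * c - j%:R)%R%:R else 0) =
     (Q ^+ M)`_j * (c * M%:R / 2 <= M%:R * c - j%:R)%R%:R.
    by case: ltnP => // h; rewrite nth_default // mul0r.
  by rewrite QM.
rewrite ler_pdivrMr ?exprn_gt0 //; apply: le_trans e3 _.
have -> : 1 / 4 * (c * M%:R / 2) ^+ 2 = M%:R * (M%:R * c ^+ 2) / 16 by field.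
have : M%:R * 64 <= M%:R * (M%:R * c ^+ 2) by rewrite ler_pM2l.
lra.
Qed.

(** In use, [x] is the number of vertices, [be * x] a lower bound for the number of two-point steps,
    [L] the Chebyshev window and [D] its width in units of the gap. The threshold 1024 makes 32 L <=
    be x, and 96 absorbs the rounding of [D]. *)
Lemma window_params (Lam be x : R) : 0 < Lam -> 0 < be -> 1 <= x ->
  1024 * Lam / be ^+ 2 <= x -> 96 / be <= x ->
  exists L D, [/\ 0 < L, L ^+ 2 = Lam * x, L + 1 <= D%:R :> R,
    forall y, be * x <= y -> 2 * L <= y /\ 16 * (D%:R + 1) <= y &
    D%:R ^+ 2 <= (2 * Lam + 8) * x].
Proof.
move=> Lam0 be0 x1 b3 b4.
have Lx0 : 0 < Lam * x by rewrite mulr_gt0 //; lra.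
exists (Num.sqrt (Lam * x)), (Num.truncn (Num.sqrt (Lam * x))).+2.
have L0 : 0 < Num.sqrt (Lam * x) by rewrite sqrtr_gt0.
have L2 : Num.sqrt (Lam * x) ^+ 2 = Lam * x by rewrite sqr_sqrtr // ltW.
move: L0 L2; move: (Num.sqrt (Lam * x)) => L L0 L2.
have h2 := truncn_le L; rewrite (ltW L0) in h2.
have h1 := truncnS_gt L.
set D := Num.truncn L in h1 h2 *; clearbody D.
move: h1; rewrite -(natr1 D.+1) -(natr1 D) => h1.
have L32 : 32 * L <= be * x.
  rewrite -(ler_pXn2r (n := 2)) ?nnegrE ?mulr_ge0 ?(ltW L0) ?(ltW be0) //; last lra.
  rewrite !exprMn L2.
  have h : 1024 * Lam <= x * be ^+ 2 by rewrite -ler_pdivrMr ?exprn_gt0.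
  have x0 : 0 <= x by lra.
  have := ler_wpM2r x0 h.
  have -> : be ^+ 2 * x ^+ 2 = x * be ^+ 2 * x by ring.
  lra.
have bx : 96 <= be * x by rewrite mulrC -ler_pdivrMr.
split => //; first lra.
- by move=> y hy; split; lra.
- have D0 : 0 <= D%:R :> R by [].
  have : (D%:R + 1 + 1) ^+ 2 <= (L + 2) ^+ 2 :> R by rewrite lerXn2r ?nnegrE //; lra.
  have : 0 <= (L - 2) ^+ 2 by rewrite sqr_ge0.
  rewrite !expr2 in L2 *; nra.
Qed.

End PolynomialMomentBounds.

(** * The truncated offspring law, its span and its local lower bound *)

Section OffspringPolynomial.
Context {R : realType} (m : nat -> R) (M3 : R) (k0 : nat).
Hypotheses (m_ge0 : forall k, 0 <= m k)
  (m_sum : forall D, \sum_(k < D) m k <= 1)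
  (m_mean : forall D, \sum_(k < D) m k * k%:R <= 1)
  (m_third : forall D, \sum_(k < D) m k * k%:R ^+ 3 <= M3)
  (m_sum_ge : forall D, (0 < D)%N -> 1 - M3 / D%:R ^+ 2 <= \sum_(k < D.+1) m k)
  (m_mean_ge : forall D, (0 < D)%N ->
     1 - M3 / D%:R ^+ 2 <= \sum_(k < D.+1) m k * k%:R)
  (m0_gt0 : 0 < m 0%N) (k0_gt1 : (1 < k0)%N) (mk0_gt0 : 0 < m k0).
Implicit Types (D n k t s a g : nat).

(** A tree with n vertices has all degrees below n, so cutting at D = n loses no such tree, while
    the total mass and the mean drop to no less than 1 - M3 / D^2. *)
Definition offpoly D : {poly R} := \poly_(k < D.+1) m k.
Local Notation f := offpoly.

Lemma coef_offpoly D i : (f D)`_i = if (i <= D)%N then m i else 0.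
Proof. by rewrite coef_poly ltnS. Qed.

Lemma offpoly_ge0 D : lepoly 0 (f D).
Proof. by move=> i; rewrite coef0 coef_offpoly; case: ifP. Qed.

Lemma le_offpoly D D' : (D <= D')%N -> lepoly (f D) (f D').
Proof.
move=> DD i; rewrite !coef_offpoly; case: ifP => h; last by case: ifP.
by rewrite (leq_trans h DD).
Qed.

Lemma offpoly1E D : (f D).[1] = \sum_(k < D.+1) m k.
Proof.
rewrite (@horner1_sum _ _ D.+1) ?size_poly //; apply: eq_bigr => i _.
by rewrite coef_offpoly -ltnS ltn_ord.
Qed.

Lemma offpoly1_le D : (f D).[1] <= 1.
Proof. by rewrite offpoly1E. Qed.

Lemma offpoly1_ge0 D : 0 <= (f D).[1].
Proof. by apply: lepoly_horner => //; exact: offpoly_ge0. Qed.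

Lemma sum_offpoly D (F : nat -> R) :
  \sum_(i < size (f D)) (f D)`_i * F i = \sum_(k < D.+1) m k * F k.
Proof.
rewrite (big_ord_widen D.+1 (fun i => (f D)`_i * F i)) ?size_poly //.
rewrite big_mkcond; apply: eq_bigr => i _; case: ifP => h.
  by rewrite coef_offpoly -ltnS ltn_ord.
have : (f D)`_i = 0 by rewrite nth_default // leqNgt h.
by rewrite coef_offpoly -ltnS ltn_ord => ->; rewrite mul0r.
Qed.

Lemma offpoly_deriv1 D : (f D)^`().[1] = \sum_(k < D.+1) m k * k%:R.
Proof. by rewrite deriv1_sum (sum_offpoly D (fun i => i%:R)). Qed.

Lemma offpoly_deriv1_le D : (f D)^`().[1] <= 1.
Proof. by rewrite offpoly_deriv1. Qed.

Lemma natr_cube_ge k : k%:R * (k%:R - 1) <= k%:R ^+ 3 :> R.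
Proof.
case: k => [|k]; first by rewrite mul0r expr0n.
rewrite exprS ler_wpM2l // expr2 -natr1.
have : 0 <= k%:R :> R by [].
nra.
Qed.

Lemma offpoly_deriv2_le D : (f D)^`()^`().[1] <= M3.
Proof.
rewrite deriv2_sum (sum_offpoly D (fun i => i%:R * (i%:R - 1))).
apply: le_trans (m_third D.+1); apply: ler_sum => i _.
by rewrite ler_wpM2l // natr_cube_ge.
Qed.

Lemma M3_ge0 : 0 <= M3.
Proof.
apply: le_trans (m_third 0%N); by rewrite big_ord0.
Qed.

Lemma offpoly_deriv3_le D : (f D)^`()^`()^`().[1] <= M3.
Proof.
have -> : (f D)^`()^`()^`().[1] =
   ('X * (f D)^`())^`()^`().[1] - 2 * (f D)^`()^`().[1].
  rewrite derivM derivX derivD !derivM derivX derivC.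
  by rewrite !(hornerD, hornerM, hornerX, hornerC); ring.
have sz : (size ('X * (f D)^`())%R <= D.+1)%N.
  apply/leq_sizeP => j hj; rewrite coefXM coef_deriv; case: j hj => // j hj /=.
  by rewrite coef_offpoly leqNgt hj mul0rn.
have -> : ('X * (f D)^`())^`()^`().[1] =
    \sum_(k < D.+1) m k * (k%:R * (k%:R * (k%:R - 1))).
  rewrite deriv2_sum (big_ord_widen D.+1
    (fun i => ('X * (f D)^`())`_i * (i%:R * (i%:R - 1))) sz) big_mkcond.
  apply: eq_bigr => i _.
  have -> : (if (i < size ('X * (f D)^`())%R)%N then ('X * (f D)^`())`_i * (i%:R * (i%:R - 1)) else 0)
     = ('X * (f D)^`())`_i * (i%:R * (i%:R - 1)).
    by case: ltnP => // h; rewrite nth_default // mul0r.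
  rewrite coefXM coef_deriv; have := ltn_ord i; case: (i : nat) => [|j] hj /=; first by rewrite !mul0r mulr0.
  by rewrite coef_offpoly -ltnS hj -mulr_natr; ring.
rewrite (_ : (f D)^`()^`().[1] = \sum_(k < D.+1) m k * (k%:R * (k%:R - 1))); last first.
  by rewrite deriv2_sum (sum_offpoly D (fun i => i%:R * (i%:R - 1))).
rewrite mulr_sumr -sumrB; apply: le_trans (m_third D.+1); apply: ler_sum => i _.
rewrite (mulrCA 2) -mulrBr ler_wpM2l //.
case: (i : nat) => [|j]; first by rewrite !mul0r mulr0 subr0 expr0n.
rewrite -natr1; have : 0 <= j%:R :> R by [].
move: (j%:R : R) => x x0.
have : 0 <= x * x by rewrite mulr_ge0.
nra.
Qed.

Lemma pmom1_offpoly D : (0 < D)%N -> `|pmom1 (f D) 1| <= M3 / D%:R ^+ 2.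
Proof.
move=> D0; rewrite pmom1E mul1r ler_distl offpoly_deriv1 offpoly1E.
have := m_sum D.+1; have := m_mean D.+1; have := m_sum_ge D0; have := m_mean_ge D0.
by move=> *; apply/andP; split; lra.
Qed.

Lemma pmom2_offpoly D : pmom2 (f D) 1 <= M3 + 1.
Proof.
have -> : pmom2 (f D) 1 = (f D)^`()^`().[1] - (f D)^`().[1] + (f D).[1].
  by rewrite pmom2E; ring.
have := offpoly_deriv2_le D; have := offpoly1_le D.
have : 0 <= (f D)^`().[1] by apply: lepoly_horner => //; apply/lepoly0_deriv/offpoly_ge0.
lra.
Qed.

Lemma coef_offpolyX_gt0M D k k' t t' :
  0 < (f D ^+ k)`_t -> 0 < (f D ^+ k')`_t' -> 0 < (f D ^+ (k + k'))`_(t + t').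
Proof.
move=> h h'; apply: (@lt_le_trans _ _ ((f D ^+ k)`_t * (f D ^+ k')`_t')).
  exact: mulr_gt0.
have ht : (t < (t + t').+1)%N by rewrite ltnS leq_addr.
rewrite exprD coefM (bigD1 (Ordinal ht)) //= addKn lerDl.
apply: sumr_ge0 => i _.
have := lepoly0Xe k (offpoly_ge0 D) i.
have := lepoly0Xe k' (offpoly_ge0 D) (t + t' - i)%N.
by rewrite !coef0 => a b; apply: mulr_ge0.
Qed.

(** The semigroup of possible totals of finitely many offspring numbers. As m 0 > 0, a total reached
    with k summands is also reached with more, so two reachable totals share a common k. *)
Definition reachable t := exists k D, 0 < (f D ^+ k)`_t.

Lemma reachable_common t t' : reachable t -> reachable t' ->
  exists k D, 0 < (f D ^+ k)`_t /\ 0 < (f D ^+ k)`_t'.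
Proof.
have f00 D k : 0 < (f D ^+ k)`_0.
  elim: k => [|k IH]; first by rewrite expr0 coef1.
  rewrite -add1n -(addn0 0%N); apply: coef_offpolyX_gt0M => //.
  by rewrite expr1 coef_offpoly.
have mono D D' k u : (D <= D')%N -> 0 < (f D ^+ k)`_u -> 0 < (f D' ^+ k)`_u.
  move=> DD h; apply: lt_le_trans h _.
  exact: lepolyXe (offpoly_ge0 D) (le_offpoly DD) _.
move=> [k [D h]] [k' [D' h']]; exists (k + k')%N, (maxn D D'); split.
- have := coef_offpolyX_gt0M (mono _ (maxn D D') _ _ (leq_maxl _ _) h) (f00 _ k').
  by rewrite addn0.
- have := coef_offpolyX_gt0M (f00 _ k) (mono _ (maxn D D') _ _ (leq_maxr _ _) h').
  by rewrite add0n.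
Qed.

Lemma reachableD t t' : reachable t -> reachable t' -> reachable (t + t').
Proof.
move=> h h'; have [k [D [a b]]] := reachable_common h h'.
by exists (k + k)%N, D; apply: coef_offpolyX_gt0M.
Qed.

Lemma reachable0 : reachable 0.
Proof. by exists 0%N, 0%N; rewrite expr0 coef1. Qed.

Lemma reachableM q t : reachable t -> reachable (q * t).
Proof.
move=> h; elim: q => [|q IH]; first exact: reachable0.
by rewrite mulSn; apply: reachableD.
Qed.

(* The least positive difference of two reachable points generates the span
   of the offspring walk. *)
Lemma offspring_span : exists g a k D,
  [/\ (0 < g)%N, 0 < (f D ^+ k)`_a, 0 < (f D ^+ k)`_(a + g) &
      forall t, reachable t -> (g %| t)%N].
Proof.
pose Q g := `[< (0 < g)%N /\ exists a, reachable a /\ reachable (a + g) >].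
have exQ : exists g, Q g.
  exists k0; apply/asboolP; split; first by lia.
  exists 0%N; split; first exact: reachable0.
  by exists 1%N, k0; rewrite expr1 add0n coef_offpoly leqnn.
case: (ex_minnP exQ) => g /asboolP[g0 [a [ra rag]]] gmin.
have [k [D [ha hag]]] := reachable_common ra rag.
exists g, a, k, D; split => // t rt.
have ht := divn_eq t g; set q := (t %/ g)%N in ht; set rho := (t %% g)%N in ht.
case: (posnP rho) => [r0|r0]; first by rewrite /dvdn -/rho r0.
have : (g <= rho)%N.
  (* With t = q g + rho, the reachable totals q (a + g) and t + q a differ by [rho], which
     contradicts the minimality of [g] because 0 < rho < g. *)
  apply: gmin; apply/asboolP; split => //; exists (q * (a + g))%N; split.
    exact: reachableM.
  have -> : (q * (a + g) + rho = t + q * a)%N by rewrite ht; lia.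
  by apply: reachableD => //; apply: reachableM.
by rewrite leqNgt ltn_pmod.
Qed.

Lemma offpolyX_bounds n : (0 < n)%N -> 4 * M3 + 1 <= n%:R ->
  [/\ forall i, (i <= n)%N -> 1 - i%:R * (M3 / n%:R ^+ 2) <= (f n).[1] ^+ i,
      n%:R * (M3 / n%:R ^+ 2) <= 1 / 4 &
      pmom2 (f n ^+ n) n.-1%:R <= (M3 + 5) * n%:R].
Proof.
move=> n0 b1; have M30 := M3_ge0.
have fn1 := offpoly1_le n; have fn1' := offpoly1_ge0 n.
have p1 := pmom1_offpoly n0; have p2 := pmom2_offpoly n.
have fnge : 1 - M3 / n%:R ^+ 2 <= (f n).[1] by rewrite offpoly1E; apply: m_sum_ge.
have x1 : 1 <= n%:R :> R by rewrite ler1n.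
have sE : n.-1%:R = n%:R - 1 :> R by rewrite -[in RHS](prednK n0) -natr1 addrK.
have fn0 := offpoly_ge0 n.
have u2 := pmom2X n fn0 fn1 p1 p2; have := pmom1X n fn0 fn1 p1.
rewrite mulr1 in u2 *; rewrite sE.
have u3 : (f n ^+ n).[1] <= 1 by rewrite horner_exp exprn_ile1.
move: (n%:R : R) b1 fnge x1 p1 u2 u3 => x b1 fnge x1 p1 u2 u3; clear sE.
have x0 : 0 < x by lra.
have M3x : 0 <= M3 / x ^+ 2 by rewrite divr_ge0 ?exprn_ge0 // ltW.
have M3x1 : M3 / x <= 1 / 4 by rewrite ler_pdivrMr //; lra.
have M3x2 : x * (M3 / x ^+ 2) = M3 / x by field; lra.
have M3x3 : M3 / x ^+ 2 <= M3 / x.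
  by rewrite ler_wpM2l // lef_pV2 ?posrE ?exprn_gt0 // expr2 ler_peMl // ltW.
rewrite ler_norml M3x2 => /andP[_ u1]; rewrite M3x2 in u2.
split => //.
  move=> i hi; apply: le_trans (bernoulli_ge i _) _; first by rewrite M3x; lra.
  by rewrite lerXn2r ?nnegrE //; lra.
have -> : pmom2 (f n ^+ n) (x - 1) = pmom2 (f n ^+ n) x + 2 * pmom1 (f n ^+ n) x + (f n ^+ n).[1].
  by rewrite !pmom2E pmom1E; ring.
have u4 : (M3 / x) ^+ 2 <= 1.
  by rewrite exprn_ile1 // ?divr_ge0 // ?(ltW x0) //; lra.
lra.
Qed.

(* [f ^+ k] is [c] times a two-point law of gap [g] plus a nonnegative rest, so
   [f ^+ n] is a mixture of shifted binomial laws; by Chebyshev's inequality most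
   of the shifts put the target [n.-1] in the bulk of the binomial law. *)
Lemma local_lower_bound : exists2 kappa : R, 0 < kappa &
  exists n0, forall n, (n0 <= n)%N -> 0 < (f n ^+ n)`_n.-1 ->
    kappa * rsq n <= (f n ^+ n)`_n.-1.
Proof.
have num1 (y : R) : y <= 1 / 4 -> 3 / 4 <= 1 - y by lra.
have num2 (y u : R) : y * 128 <= 2 * u -> y * 64 <= u by lra.
have num3 (y : R) : y <= 1 / 4 -> y <= 1 by lra.
have num4 (c' y u : R) : y * c' - u < c' * y / 2 -> c' * y / 2 <= u by lra.
have num5 (y u v : R) : 3 / 4 <= y -> u <= 1 / 4 -> v <= 1 / 4 ->
  4^-1 <= y - u - v by lra.
have [g [a [k [D0 [g0 ha hag hg]]]]] := offspring_span.
have k_gt0 : (0 < k)%N.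
  by case: k ha hag => // _; rewrite expr0 !coef1 (gtn_eqF (ltn_addl a g0)) ltxx.
(* The largest c <= 1 for which c times the fair law on a and a + g lies below [f D0 ^+ k]. *)
pose c : R := Num.min 1 (Num.min (2 * (f D0 ^+ k)`_a) (2 * (f D0 ^+ k)`_(a + g))).
have c0 : 0 < c by rewrite /c !lt_min ltr01 !mulr_gt0.
have c1 : c <= 1 by rewrite /c ge_min lexx.
have ca : c / 2 <= (f D0 ^+ k)`_a.
  by rewrite ler_pdivrMr // mulrC /c !ge_min lexx !orbT.
have cag : c / 2 <= (f D0 ^+ k)`_(a + g).
  by rewrite ler_pdivrMr // mulrC /c !ge_min lexx !orbT.
have ga : (g %| a)%N by apply: hg; exists k, D0.
have M30 := M3_ge0.
pose Lam : R := 4 * (M3 + 5).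
have k0' : 0 < k%:R :> R by rewrite ltr0n.
have k1' : 1 <= k%:R :> R by rewrite ler1n.
have [be [beE be0]] : exists b : R, b = c / (4 * k%:R) /\ 0 < b.
  by exists (c / (4 * k%:R)); split=> //; rewrite divr_gt0 // mulr_gt0.
have [kap kap0 hbin] := bin_ge_rsq ((2 * Lam + 8) / be).
exists (kap / 4); first by rewrite divr_gt0.
have [n1 hn1] := natr_large (Num.max (4 * M3 + 1) (Num.max (k%:R * (128 / c ^+ 2)) (Num.max (1024 * Lam / be ^+ 2) (96 / be)))).
exists (maxn n1 (maxn D0 (2 * k).+1)) => n; rewrite !geq_max => /and3P[/hn1 hn nD0 n2k] pos.
move: hn; rewrite !ge_max => /and4P[b1 b2 b3 b4].
set x : R := n%:R in b1 b2 b3 b4 *.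
have x1 : 1 <= x by lra.
have x0 : 0 < x by lra.
pose M := (n %/ k)%N; pose rho := (n %% k)%N.
have nE : n = (M * k + rho)%N by exact: divn_eq.
have rhok : (rho < k)%N by rewrite ltn_pmod.
have M2 : (n <= 2 * k * M)%N.
  have M1 : (0 < M)%N by rewrite divn_gt0 // (leq_trans _ (ltnW n2k)) // leq_pmull.
  rewrite {1}nE -mulnA mul2n -addnn (mulnC k) leq_add2l.
  by apply: leq_trans (ltnW rhok) _; rewrite leq_pmull.
have M2' : x <= 2 * k%:R * M%:R by rewrite -!natrM ler_nat.
have Mk : M%:R * k%:R <= x by rewrite -natrM ler_nat [leqRHS]nE leq_addr.
have M0 : 0 < M%:R :> R.
  rewrite ltr0n lt0n; apply: contraTneq M2' => ->; rewrite mulr0 -ltNge; lra.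
pose fn := f n.
have fn0 : lepoly 0 fn := offpoly_ge0 n.
have fle : lepoly (f D0 ^+ k) (fn ^+ k) by apply: lepolyXe (offpoly_ge0 _) (le_offpoly nD0).
pose r := fn ^+ k - c *: twopt a g.
have r0 : lepoly 0 r.
  move=> i; rewrite coef0 coefB coefZ subr_ge0 /twopt coefZ coefXnM.
  have fi : 0 <= (fn ^+ k)`_i by have := lepoly0Xe k fn0 i; rewrite coef0.
  case: ltnP => hi; first by rewrite !mulr0.
  rewrite coefD coef1 coefXn subn_eq0.
  case: (eqVneq i a) => [->|ia].
    rewrite leqnn subnn (ltn_eqF g0) addr0 mulr1.
    exact: le_trans ca (fle _).
  have -> : (i <= a)%N = false by apply/negbTE; rewrite -ltnNge ltn_neqAle eq_sym ia.
  rewrite add0r; case: (eqVneq (i - a)%N g) => [hig|_]; last by rewrite !mulr0.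
  rewrite mulr1; have -> : i = (a + g)%N by rewrite -hig subnKC.
  exact: le_trans cag (fle _).
have r1E : r.[1] = fn.[1] ^+ k - c.
  by rewrite hornerD hornerN hornerZ twopt1 mulr1 horner_exp.
(* Binomial expansion of (c twopt + r)^M: [j] of the [M] blocks of length [k] take the two-point
   law, and [W j] is the weighted law of all the rest, including the [rho] leftover factors. *)
pose W j := (c ^+ j * ('C(M, j))%:R) *: (r ^+ (M - j) * fn ^+ rho).
have W0 j : lepoly 0 (W j).
  move=> i; rewrite coef0 coefZ !mulr_ge0 ?exprn_ge0 ?(ltW c0) //.
  have := lepoly0M (lepoly0Xe (M - j)%N r0) (lepoly0Xe rho fn0) i.
  by rewrite coef0.
have fE : fn ^+ n = \sum_(j < M.+1) W j * twopt a g ^+ j.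
  transitivity (fn ^+ (M * k + rho)); first by rewrite -nE.
  rewrite exprD (mulnC M) exprM -[fn ^+ k](subrK (c *: twopt a g)) -/r.
  rewrite exprDn mulr_suml; apply: eq_bigr => j _.
  rewrite /W exprZn -scaler_nat -scalerAr -!scalerAl scalerA (mulrC (c ^+ j)).
  by congr (_ *: _); rewrite mulrAC.
pose s := n.-1.
have gs : (g %| s)%N by apply: hg; exists n, n.
have B0 j := lepoly0Xe j (@twopt_ge0 R a g).
have WB0 j := lepoly0M (W0 j) (B0 j).
have gW (j : 'I_M.+1) t : 0 < (W j)`_t -> (g %| t)%N.
  move=> wt.
  have h : 0 < (fn ^+ n)`_(t + (a * j + g * 0)).
    apply: (@lt_le_trans _ _ (W j * twopt a g ^+ j)`_(t + (a * j + g * 0))).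
      have ht : (t < (t + (a * j + g * 0)).+1)%N by rewrite ltnS leq_addr.
      rewrite coefM (bigD1 (Ordinal ht)) //= addKn coef_twoptX // bin0 mulr1.
      apply: ltr_wpDr; last by rewrite mulr_gt0 // invr_gt0 exprn_gt0.
      apply: sumr_ge0 => i _; apply: mulr_ge0.
        by have := W0 j i; rewrite coef0.
      by have := B0 j (t + (a * j + g * 0) - i)%N; rewrite coef0.
    rewrite fE coef_sum (bigD1 j) //= lerDl; apply: sumr_ge0 => i _.
    by have := WB0 i (t + (a * j + g * 0))%N; rewrite coef0.
  have : (g %| t + (a * j + g * 0))%N by apply: hg; exists n, n.
  by rewrite dvdn_addl // muln0 addn0 dvdn_mulr.
have Lam0 : 0 < Lam by rewrite /Lam mulr_gt0 // ltr_wpDl.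
have [L [D [L0 L2 D2 hy hD]]] := window_params Lam0 be0 x1 b3 b4.
have cM : be * x <= c * M%:R / 2.
  rewrite beE; have -> : c / (4 * k%:R) * x = c * (x / (4 * k%:R)) by rewrite mulrAC mulrA.
  rewrite -mulrA; apply: ler_wpM2l; first exact: ltW.
  rewrite ler_pdivrMr ?mulr_gt0 //; apply: le_trans M2' _.
  by rewrite le_eqVlt; apply/orP; left; apply/eqP; field.
have g1 : 1 <= g%:R :> R by rewrite ler1n.
have good (j : 'I_M.+1) : c * M%:R / 2 <= j%:R ->
   kap * rsq n * ((W j).[1] - pmom2 (W j) (s%:R - j%:R * (a%:R + g%:R / 2)) / L ^+ 2)
      <= (W j * twopt a g ^+ j)`_s.
  move=> hj.
  have [hy1 hy2] := hy _ (le_trans cM hj).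
  have h := @mul_twoptX_ge R _ kap a g j s D L (W j) (hbin j) kap0 (W0 j) g0 (gW j) ga gs L0.
  case: (leP 0 ((W j).[1] - pmom2 (W j) (s%:R - j%:R * (a%:R + g%:R / 2)) / L ^+ 2)) => sg; last first.
    apply: (@le_trans _ _ 0); last by have := WB0 j s; rewrite coef0.
    by apply: mulr_ge0_le0; [rewrite mulr_ge0 ?rsq_ge0 ?ltW|exact: ltW].
  apply: (@le_trans _ _ (kap * rsq j * ((W j).[1] - pmom2 (W j) (s%:R - j%:R * (a%:R + g%:R / 2)) / L ^+ 2))).
    apply: ler_wpM2r => //; apply: ler_wpM2l; first exact: ltW.
    apply: ler_rsq; rewrite [leqRHS]nE.
    apply: (@leq_trans M); first by rewrite -ltnS ltn_ord.
    by apply: leq_trans (leq_addr _ _); rewrite leq_pmulr.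
  apply: h.
  - by apply: le_trans hy1 _; rewrite ler_peMl.
  - apply: (@le_trans _ _ (g%:R * (L + 1))); last by rewrite ler_wpM2l.
    by rewrite mulrDr mulr1 lerD2r ler_peMl // ltW.
  - rewrite natrX; apply: le_trans hD _.
    rewrite -mulrA; apply: ler_wpM2l; first by rewrite addr_ge0 // mulr_ge0 // ltW.
    rewrite ler_pdivlMl //; apply: le_trans cM _; apply: le_trans hj _.
    by rewrite ler_nat.
  - by rewrite -(ler_nat R) natrM -(natr1 D).
(* Mass budget: the total is at least 3/4 ([T1']), the terms with too few two-point blocks are at
   most 1/4 ([T2]), and so is the Chebyshev error ([T3]). The remaining 1/4 is the factor in kap /
   4. *)
have T1 : \sum_(j < M.+1) (W j).[1] = fn.[1] ^+ n.
  rewrite -horner_exp fE horner_sum; apply: eq_bigr => j _.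
  by rewrite hornerM horner_exp twopt1 expr1n mulr1.
have n0 : (0 < n)%N by exact: leq_ltn_trans n2k.
have fn1 := offpoly1_le n; have fn1' := offpoly1_ge0 n; rewrite -/fn in fn1 fn1'.
have [bern eb hp2] := offpolyX_bounds n0 b1; rewrite -/x -/fn in bern eb hp2.
have T1' : 3 / 4 <= fn.[1] ^+ n.
  by apply: le_trans (bern n (leqnn n)); exact: num1.
have T2 : \sum_(j < M.+1) (W j).[1] * (c * M%:R / 2 <= M%:R * c - j%:R)%R%:R <= 1 / 4.
  have r10 : 0 <= r.[1] by apply: lepoly_horner.
  have kn : (k <= n)%N by rewrite (leq_trans _ (ltnW n2k)) // leq_pmull.
  have crE : c + r.[1] = fn.[1] ^+ k by rewrite r1E addrC subrK.
  have := @binomial_lower_tail R c r.[1] (k%:R * (M3 / x ^+ 2)) M c0 c1 r10.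
  rewrite crE => /(_ (bern k kn)) tail.
  apply: le_trans (tail _ _ _); first last.
  - move: b2; rewrite mulrA ler_pdivrMr ?exprn_gt0 // => b2.
    have h : x * c ^+ 2 <= 2 * k%:R * M%:R * c ^+ 2 by rewrite ler_wpM2r ?sqr_ge0.
    rewrite -(ler_pM2l k0'); apply: num2; apply: le_trans b2 _; by rewrite -!mulrA in h *.
  - rewrite mulrA; apply: (@le_trans _ _ (x * (M3 / x ^+ 2))).
      by rewrite ler_wpM2r // divr_ge0 ?exprn_ge0 // ltW.
    exact: num3.
  - by rewrite exprn_ile1.
  - apply: ler_sum => j _; apply: ler_wpM2r => //.
    rewrite /W hornerZ hornerM !horner_exp ler_wpM2l ?mulr_ge0 ?exprn_ge0 ?(ltW c0) //.
    by rewrite ler_piMr ?exprn_ge0 // exprn_ile1.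
have pB (j : nat) : pmom1 (twopt a g ^+ j) (j%:R * (a%:R + g%:R / 2)) = 0 :> R.
  apply/eqP; rewrite -normr_le0.
  have h : `|pmom1 (twopt a g) (a%:R + g%:R / 2)| <= (0 : R) by rewrite pmom1_twopt normr0.
  have tw1 : (twopt a g).[1] <= 1 :> R by rewrite twopt1.
  by have := pmom1X j (@twopt_ge0 R a g) tw1 h; rewrite mulr0.
(* Convolving with a law of known mean can only raise the second moment about the shifted point, so
   the moments of the [W j] add up to at most that of [fn ^+ n]. *)
have T3 : \sum_(j < M.+1) pmom2 (W j) (s%:R - j%:R * (a%:R + g%:R / 2)) / L ^+ 2 <= 1 / 4.
  rewrite -mulr_suml ler_pdivrMr ?exprn_gt0 //.
  apply: (@le_trans _ _ (pmom2 (fn ^+ n) s%:R)).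
    rewrite fE pmom2_sum; apply: ler_sum => j _.
    rewrite -[s%:R in leRHS](subrK (j%:R * (a%:R + g%:R / 2))) pmom2M pB mulr0 addr0.
    rewrite horner_exp twopt1 expr1n mulr1 lerDl mulr_ge0 //.
      exact: lepoly_horner.
    exact: pmom2_ge0.
  apply: le_trans hp2 _; rewrite L2 /Lam le_eqVlt; apply/orP; left.
  by apply/eqP; field.
rewrite fE coef_sum -/s.
apply: (@le_trans _ _ (\sum_(j < M.+1) (kap * rsq n * ((W j).[1]
   - (W j).[1] * (c * M%:R / 2 <= M%:R * c - j%:R)%R%:R
   - pmom2 (W j) (s%:R - j%:R * (a%:R + g%:R / 2)) / L ^+ 2)))); last first.
  apply: ler_sum => j _.
  case: (leP (c * M%:R / 2) (M%:R * c - j%:R)) => hj; last first.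
    by rewrite mulr0 subr0; apply: good; apply: num4 hj.
  rewrite mulr1 subrr sub0r; apply: (@le_trans _ _ 0); last by have := WB0 j s; rewrite coef0.
  apply: mulr_ge0_le0; first by rewrite mulr_ge0 ?rsq_ge0 ?ltW.
  by rewrite oppr_le0 divr_ge0 ?sqr_ge0 // pmom2_ge0.
rewrite -mulr_sumr !sumrB T1 mulrAC.
rewrite ler_wpM2l ?mulr_ge0 ?rsq_ge0 ?(ltW kap0) //.
exact: num5.
Qed.

End OffspringPolynomial.

(** * Weighted counts of plane trees *)

Inductive ptree := PNode of seq ptree.

Definition pchildren t := let: PNode ts := t in ts.

Fixpoint psize t : nat := let: PNode ts := t in (sumn [seq psize s | s <- ts]).+1.

Lemma leq_nth_sumn (l : seq nat) i : (i < size l)%N -> (nth 0 l i <= sumn l)%N.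
Proof.
elim: l i => [//|x l IH] [|i] /=; first by rewrite leq_addr.
by rewrite ltnS => /IH h; apply: leq_trans h (leq_addl _ _).
Qed.

Lemma leq_psize_nth ts i : (i < size ts)%N ->
  (psize (nth (PNode [::]) ts i) <= sumn [seq psize s | s <- ts])%N.
Proof.
move=> hi; rewrite -(nth_map _ 0%N) //; apply: leq_nth_sumn.
by rewrite size_map.
Qed.

(** Induction on [psize]: for the nested type this is what provides the hypothesis on every
    child. *)
Lemma ptree_ind_nth (Q : ptree -> Prop) :
  (forall ts, (forall i, (i < size ts)%N -> Q (nth (PNode [::]) ts i)) ->
     Q (PNode ts)) ->
  forall t, Q t.
Proof.
move=> IH t; move: {2}(psize t) (leqnn (psize t)) => n.
elim: n t => [|n IHn] [ts] //; rewrite [psize _]/= ltnS => hn.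
by apply: IH => i /leq_psize_nth h; apply: IHn; apply: leq_trans h hn.
Qed.

Fixpoint ptree_encode t : GenTree.tree unit :=
  let: PNode ts := t in GenTree.Node 0 [seq ptree_encode s | s <- ts].

Fixpoint ptree_decode (g : GenTree.tree unit) : ptree :=
  if g is GenTree.Node _ gs then PNode [seq ptree_decode h | h <- gs]
  else PNode [::].

Lemma ptree_encodeK : cancel ptree_encode ptree_decode.
Proof.
elim/ptree_ind_nth => ts IH /=; congr PNode; rewrite -map_comp.
apply: (@eq_from_nth _ (PNode [::])); first by rewrite size_map.
move=> i; rewrite size_map => hi.
by rewrite (nth_map (PNode [::])) //= IH.
Qed.

HB.instance Definition _ := Countable.copy ptree (can_type ptree_encodeK).

Fixpoint generation h t : nat :=
  if h is h'.+1 then sumn [seq generation h' s | s <- pchildren t] else 1.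

Fixpoint offdiag (p q : ptree -> nat) (ts : seq ptree) : nat :=
  if ts is s :: r then
    (p s * sumn [seq q x | x <- r] + q s * sumn [seq p x | x <- r]
     + offdiag p q r)%N
  else 0.

(* [npairs h a b t] counts the pairs of vertices whose last common ancestor
   has depth [h] and which lie [a], respectively [b], generations below it. *)
Fixpoint npairs h a b t : nat :=
  if h is h'.+1 then sumn [seq npairs h' a b s | s <- pchildren t]
  else match a, b with
       | 0, _ => generation b t
       | _, 0 => generation a t
       | a'.+1, b'.+1 => offdiag (generation a') (generation b') (pchildren t)
       end.

Fixpoint tuplesof (T : Type) (k : nat) (s : seq T) : seq (seq T) :=
  if k is k'.+1 then [seq x :: y | x <- s, y <- tuplesof k' s] else [:: [::]].

(** A duplicate-free list with degrees bounded by [D] and at most [H] generations, so that sums over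
    trees are finite sums; [trees n n] contains every tree with n vertices. *)
Fixpoint trees (D H : nat) : seq ptree :=
  if H is G.+1 then
    flatten [seq [seq PNode ts | ts <- tuplesof k (trees D G)] | k <- iota 0 D.+1]
  else [::].

Lemma mem_tuplesof (T : eqType) k (s : seq T) x :
  (x \in tuplesof k s) = (size x == k) && all (mem s) x.
Proof.
elim: k x => [|k IH] x /=; first by rewrite inE; case: x.
apply/allpairsP/idP => [[[a b] /= [ha hb ->]]|].
  by rewrite /= eqSS ha -IH.
case: x => // a b /=; rewrite eqSS => /andP[hs /andP[ha hb]].
by exists (a, b); split; rewrite ?IH ?hs.
Qed.

Lemma uniq_tuplesof (T : eqType) k (s : seq T) : uniq s -> uniq (tuplesof k s).
Proof.
move=> us; elim: k => [|k IH] //=.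
by apply: allpairs_uniq => // -[a b] [c d] _ _ /= [-> ->].
Qed.

Lemma treesS D H : trees D H.+1 =
  flatten [seq [seq PNode ts | ts <- tuplesof k (trees D H)] | k <- iota 0 D.+1].
Proof. by []. Qed.

Lemma uniq_trees D H : uniq (trees D H).
Proof.
elim: H => [//|H IH]; rewrite treesS.
have inj : injective PNode by move=> ? ? [].
elim: (D.+1) {1}0%N => [//|n IHn] i.
rewrite /= cat_uniq IHn andbT.
rewrite (map_inj_uniq inj) uniq_tuplesof //=.
apply/hasPn => t /flattenP[_ /mapP[j hj ->] /mapP[ts hts ->]].
apply/negP => /mapP[ts' hts' [e]].
move: hts hts'; rewrite e !mem_tuplesof => /andP[/eqP -> _] /andP[/eqP ij _].
by move: hj; rewrite mem_iota ij ltnn.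
Qed.

Lemma mem_trees D H t : (psize t <= H)%N -> (psize t <= D)%N -> t \in trees D H.
Proof.
elim: H t => [|H IH] [ts] //; rewrite treesS [psize _]/= ltnS => hH hD.
have le_sumn (s : ptree) : s \in ts -> (psize s <= sumn [seq psize x | x <- ts])%N.
  elim: (ts) => [//|a l IHl] /=; rewrite inE => /orP[/eqP ->|/IHl h].
    exact: leq_addr.
  by apply: leq_trans h _; rewrite leq_addl.
have size_sumn : (size ts <= sumn [seq psize x | x <- ts])%N.
  by elim: (ts) => [//|[a] l IHl] /=; rewrite addSn ltnS (leq_trans IHl) ?leq_addl.
apply/flattenP; exists [seq PNode ts | ts <- tuplesof (size ts) (trees D H)].
  by apply/mapP; exists (size ts) => //; rewrite mem_iota /=; lia.
apply: map_f; rewrite mem_tuplesof eqxx; apply/allP => s hs /=.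
by apply: IH; have := le_sumn s hs; lia.
Qed.

Section TreeGeneratingFunctions.
Context {R : realType} (m : nat -> R).
Hypothesis m_ge0 : forall k, 0 <= m k.
Implicit Types (D H h a b n k : nat) (t : ptree).
Local Notation f := (offpoly m).

Fixpoint tweight t : R :=
  let: PNode ts := t in m (size ts) * \prod_(x <- [seq tweight s | s <- ts]) x.

Lemma tweightE ts : tweight (PNode ts) = m (size ts) * \prod_(s <- ts) tweight s.
Proof. by rewrite /= big_map. Qed.

Lemma tweight_ge0 t : 0 <= tweight t.
Proof.
elim/ptree_ind_nth: t => ts IH; rewrite tweightE mulr_ge0 //.
rewrite big_seq; apply: prodr_ge0 => s /(nthP (PNode [::]))[i hi <-].
exact: IH.
Qed.

Definition tmono t : {poly R} := (tweight t)%:P * 'X^(psize t).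

Lemma tmonoE ts :
  tmono (PNode ts) = (m (size ts))%:P * 'X * \prod_(s <- ts) tmono s.
Proof.
rewrite /tmono tweightE polyCM -!mulrA; congr (_ * _) => /=.
rewrite exprS mulrCA; congr (_ * _).
elim: ts => [|s ts IH] /=; first by rewrite !big_nil mulr1.
by rewrite !big_cons -IH exprD polyCM; ring.
Qed.

Definition tgf (L : seq ptree) (q : ptree -> nat) : {poly R} :=
  \sum_(t <- L) (q t)%:R * tmono t.

Lemma coef_tgf L q n :
  (tgf L q)`_n = \sum_(t <- L | psize t == n) tweight t * (q t)%:R.
Proof.
rewrite coef_sum [RHS]big_mkcond; apply: eq_bigr => t _.
rewrite mulr_natl coefMn coefCM coefXn eq_sym; case: eqP => _; last by rewrite mulr0 mul0rn.
by rewrite mulr1 mulr_natr.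
Qed.

Lemma tgf_ge0 L q : lepoly 0 (tgf L q).
Proof.
move=> i; rewrite coef0 coef_tgf; apply: sumr_ge0 => t _.
by rewrite mulr_ge0 // tweight_ge0.
Qed.

Local Notation one := (fun=> 1%N).

Lemma tgf_one L : tgf L one = \sum_(t <- L) tmono t.
Proof. by apply: eq_bigr => t _; rewrite mul1r. Qed.

Lemma sum_tuplesof0 (L : seq ptree) k :
  \sum_(ts <- tuplesof k L) \prod_(s <- ts) tmono s = tgf L one ^+ k.
Proof.
elim: k => [|k IH] /=; first by rewrite big_seq1 big_nil.
rewrite big_allpairs_dep /= exprS -IH tgf_one mulr_suml; apply: eq_bigr => s _.
by rewrite mulr_sumr; apply: eq_bigr => ts _; rewrite big_cons.
Qed.

(** Marking one of k children leaves k - 1 unmarked ones: summed against [m k] this produces f' at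
    the generating function of trees. Marking an ordered pair of distinct children produces f'' in
    the same way. *)
Lemma sum_tuplesof1 (L : seq ptree) (p : ptree -> nat) k :
  \sum_(ts <- tuplesof k L) (sumn [seq p s | s <- ts])%:R * \prod_(s <- ts) tmono s
  = k%:R * (tgf L p * tgf L one ^+ k.-1).
Proof.
elim: k => [|k IH] /=; first by rewrite big_seq1 /= !mul0r.
rewrite big_allpairs_dep /=.
transitivity (\sum_(s <- L) ((p s)%:R * tmono s * tgf L one ^+ k +
   tmono s * (k%:R * (tgf L p * tgf L one ^+ k.-1)))).
  apply: eq_bigr => s _; rewrite -IH -sum_tuplesof0 !mulr_sumr -big_split /=.
  by apply: eq_bigr => ts _; rewrite big_cons natrD; ring.
rewrite big_split /= -!mulr_suml -/(tgf L p) -tgf_one.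
by case: k {IH} => [|k] /=; rewrite ?exprS -?(natr1 k.+1); ring.
Qed.

Lemma sum_tuplesof2 (L : seq ptree) (p q : ptree -> nat) k :
  \sum_(ts <- tuplesof k L) (offdiag p q ts)%:R * \prod_(s <- ts) tmono s
  = (k * k.-1)%:R * (tgf L p * tgf L q * tgf L one ^+ k.-2).
Proof.
elim: k => [|k IH] /=; first by rewrite big_seq1 /= !mul0r.
rewrite big_allpairs_dep /=.
transitivity (\sum_(s <- L) ((p s)%:R * tmono s * (k%:R * (tgf L q * tgf L one ^+ k.-1)) +
   ((q s)%:R * tmono s * (k%:R * (tgf L p * tgf L one ^+ k.-1))) +
   tmono s * ((k * k.-1)%:R * (tgf L p * tgf L q * tgf L one ^+ k.-2)))).
  apply: eq_bigr => s _; rewrite -IH -!sum_tuplesof1 !mulr_sumr -!big_split /=.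
  by apply: eq_bigr => ts _; rewrite big_cons !(natrD, natrM); ring.
rewrite !big_split /= -!mulr_suml -/(tgf L p) -/(tgf L q) -tgf_one.
case: k {IH} => [|[|k]] /=; rewrite ?exprS ?natrM -?(natr1 k.+2) -?(natr1 k.+1); ring.
Qed.

Lemma comp_polyXe (p q : {poly R}) k : (p ^+ k) \Po q = (p \Po q) ^+ k.
Proof.
elim: k => [|k IH]; first by rewrite !expr0 -[1]/(1%:P) comp_polyC.
by rewrite !exprS comp_polyM IH.
Qed.

Lemma offpoly_comp D (F : {poly R}) :
  (f D) \Po F = \sum_(k < D.+1) (m k)%:P * F ^+ k.
Proof.
rewrite /offpoly poly_def raddf_sum /=; apply: eq_bigr => k _.
by rewrite comp_polyZ comp_Xn_poly mul_polyC.
Qed.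

Lemma offpoly_deriv_comp D (F : {poly R}) :
  (f D)^`() \Po F = \sum_(k < D.+1) (m k)%:P * (k%:R * F ^+ k.-1).
Proof.
rewrite /offpoly poly_def raddf_sum /= raddf_sum /=; apply: eq_bigr => k _.
by rewrite derivZ derivXn comp_polyZ raddfMn /= comp_Xn_poly mul_polyC mulr_natl.
Qed.

Lemma offpoly_deriv2_comp D (F : {poly R}) :
  (f D)^`()^`() \Po F = \sum_(k < D.+1) (m k)%:P * ((k * k.-1)%:R * F ^+ k.-2).
Proof.
rewrite /offpoly poly_def raddf_sum /= raddf_sum /= raddf_sum /=; apply: eq_bigr => k _.
rewrite !derivZ derivXn derivMn derivXn comp_polyZ !raddfMn /= comp_Xn_poly.
by rewrite -mul_polyC -mulrnA -mulr_natr (mulnC k.-1); ring.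
Qed.

Lemma big_trees D H (F : ptree -> {poly R}) :
  \sum_(t <- trees D H.+1) F t =
  \sum_(k < D.+1) \sum_(ts <- tuplesof k (trees D H)) F (PNode ts).
Proof.
rewrite treesS big_flatten big_map -[iota 0 D.+1]/(index_iota 0 D.+1) big_mkord.
by apply: eq_bigr => k _; rewrite big_map.
Qed.

Lemma big_trees_tmono D H (q : ptree -> nat) :
  tgf (trees D H.+1) q = 'X * \sum_(k < D.+1) (m k)%:P *
   (\sum_(ts <- tuplesof k (trees D H)) (q (PNode ts))%:R * \prod_(s <- ts) tmono s).
Proof.
rewrite /tgf big_trees mulr_sumr; apply: eq_bigr => k _.
rewrite !mulr_sumr big_seq [RHS]big_seq; apply: eq_bigr => ts.
by rewrite mem_tuplesof => /andP[/eqP sk _]; rewrite tmonoE sk; ring.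
Qed.

Lemma tgf_trees D H : tgf (trees D H) one = treegf (f D) H.
Proof.
elim: H => [|H IH]; first by rewrite /tgf big_nil.
rewrite big_trees_tmono /= -IH offpoly_comp; congr (_ * _); apply: eq_bigr => k _.
by congr (_ * _); rewrite -sum_tuplesof0; apply: eq_bigr => ts _; rewrite mul1r.
Qed.

Lemma tgf_generation0 D H : tgf (trees D H) (generation 0) = treegf (f D) H.
Proof. exact: tgf_trees. Qed.

Lemma tgf_generationS D H h : tgf (trees D H.+1) (generation h.+1) =
  'X * ((f D)^`() \Po treegf (f D) H) * tgf (trees D H) (generation h).
Proof.
rewrite big_trees_tmono offpoly_deriv_comp -mulrA mulr_suml; congr (_ * _).
apply: eq_bigr => k _; rewrite /= sum_tuplesof1 tgf_trees; ring.
Qed.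

Lemma tgf_npairsS D H h a b : tgf (trees D H.+1) (npairs h.+1 a b) =
  'X * ((f D)^`() \Po treegf (f D) H) * tgf (trees D H) (npairs h a b).
Proof.
rewrite big_trees_tmono offpoly_deriv_comp -mulrA mulr_suml; congr (_ * _).
apply: eq_bigr => k _; rewrite /= sum_tuplesof1 tgf_trees; ring.
Qed.

(** The last common ancestor is the root, so the two vertices lie under distinct children: hence
    f''. *)
Lemma tgf_npairs0SS D H a b : tgf (trees D H.+1) (npairs 0 a.+1 b.+1) =
  'X * ((f D)^`()^`() \Po treegf (f D) H) *
   (tgf (trees D H) (generation a) * tgf (trees D H) (generation b)).
Proof.
rewrite big_trees_tmono offpoly_deriv2_comp -mulrA mulr_suml; congr (_ * _).
apply: eq_bigr => k _; rewrite /= sum_tuplesof2 tgf_trees; ring.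
Qed.

End TreeGeneratingFunctions.

(** * Spine decompositions: pairs of vertices, total weight and height *)

Section TreeCounts.
Context {R : realType} (m : nat -> R) (M3 : R) (k0 : nat).
Hypotheses (m_ge0 : forall k, 0 <= m k)
  (m_sum : forall D, \sum_(k < D) m k <= 1)
  (m_mean : forall D, \sum_(k < D) m k * k%:R <= 1)
  (m_third : forall D, \sum_(k < D) m k * k%:R ^+ 3 <= M3)
  (m_sum_ge : forall D, (0 < D)%N -> 1 - M3 / D%:R ^+ 2 <= \sum_(k < D.+1) m k)
  (m_mean_ge : forall D, (0 < D)%N ->
     1 - M3 / D%:R ^+ 2 <= \sum_(k < D.+1) m k * k%:R)
  (m0_gt0 : 0 < m 0%N) (k0_gt1 : (1 < k0)%N) (mk0_gt0 : 0 < m k0).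
Implicit Types (D H h a b n k l : nat).
Local Notation f := (offpoly m).

Let f_ge0 D : lepoly 0 (f D) := offpoly_ge0 m_ge0 D.
Let fd_ge0 D : lepoly 0 (f D)^`() := lepoly0_deriv (f_ge0 D).
Let fdd_ge0 D : lepoly 0 (f D)^`()^`() := lepoly0_deriv (fd_ge0 D).
Let F_ge0 D H : lepoly 0 (treegf (f D) H) := treegf_ge0 (f_ge0 D) H.
Let X_ge0 : lepoly 0 ('X : {poly R}) := @lepoly0Xn R 1.

Lemma lepoly_treegfS D H (Q : {poly R}) : lepoly 0 Q ->
  lepoly (Q \Po treegf (f D) H) (Q \Po treegf (f D) H.+1).
Proof. by move=> Q0; apply: lepoly_comp => //; apply: treegfS. Qed.

(** Each of the h ancestors of the chosen vertex contributes X f'(F), and its own subtree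
    contributes F. The side trees have different height bounds; monotonicity in [H] replaces all of
    them by the largest one, which is why only an inequality results. *)
Lemma tgf_generation_le D H h :
  lepoly (tgf m (trees D H) (generation h))
    ('X^h * (((f D)^`() ^+ h * 'X) \Po treegf (f D) H)).
Proof.
elim: h H => [|h IH] H.
  by rewrite tgf_generation0 // !expr0 !mul1r comp_polyX; apply: lepoly_refl.
have Q0 l : lepoly 0 ((f D)^`() ^+ l * 'X) by apply: lepoly0M => //; apply: lepoly0Xe.
case: H => [|H].
  rewrite /tgf big_nil; apply: lepoly0M; first exact: lepoly0Xn.
  exact: lepoly0_comp.
rewrite tgf_generationS //.
apply: (@lepoly_trans _ _ ('X * ((f D)^`() \Po treegf (f D) H) *
    ('X^h * (((f D)^`() ^+ h * 'X) \Po treegf (f D) H)))).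
  apply: lepolyM; [|exact: tgf_ge0|exact: lepoly_refl|exact: IH].
  by apply: lepoly0M => //; apply: lepoly0_comp.
have -> : 'X * ((f D)^`() \Po treegf (f D) H) *
    ('X^h * (((f D)^`() ^+ h * 'X) \Po treegf (f D) H)) =
   'X^(h.+1) * (((f D)^`() ^+ h.+1 * 'X) \Po treegf (f D) H) :> {poly R}.
  by rewrite !exprS -!mulrA !comp_polyM; ring.
apply: lepolyM; [exact: lepoly0Xn|exact: lepoly0_comp|exact: lepoly_refl|].
exact: lepoly_treegfS.
Qed.

(** Number of vertices at depth h or more on the paths leading to the two vertices, lower ends
    excluded: a branching vertex with a' + b' further ones, or a single line when one vertex is an
    ancestor of the other. *)
Definition pairexp a b : nat :=
  match a, b with 0, _ => b | _, 0 => a | a'.+1, b'.+1 => (a' + b').+1 end.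

(** One f' for each spine vertex, f'' for the branching one, and one X for each subtree hanging from
    a lower end. *)
Definition pairpoly D a b : {poly R} :=
  match a, b with
  | 0, _ => (f D)^`() ^+ b * 'X
  | _, 0 => (f D)^`() ^+ a * 'X
  | a'.+1, b'.+1 => (f D)^`()^`() * (f D)^`() ^+ (a' + b') * 'X^2
  end.

Lemma pairpoly_ge0 D a b : lepoly 0 (pairpoly D a b).
Proof.
case: a b => [|a] [|b]; do ?[apply: lepoly0M]; do ?[apply: lepoly0Xe] => //.
Qed.

Lemma tgf_npairs_le D H h a b :
  lepoly (tgf m (trees D H) (npairs h a b))
    ('X^(h + pairexp a b) * (((f D)^`() ^+ h * pairpoly D a b) \Po treegf (f D) H)).
Proof.
elim: h H => [|h IH] H.
  rewrite add0n expr0 mul1r.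
  case: a b => [|a] [|b]; try exact: tgf_generation_le.
  case: H => [|H].
    rewrite /tgf big_nil; apply: lepoly0M; first exact: lepoly0Xn.
    exact: lepoly0_comp (pairpoly_ge0 _ _ _) _.
  rewrite tgf_npairs0SS //.
  apply: (@lepoly_trans _ _ ('X * ((f D)^`()^`() \Po treegf (f D) H) *
    (('X^a * (((f D)^`() ^+ a * 'X) \Po treegf (f D) H)) *
     ('X^b * (((f D)^`() ^+ b * 'X) \Po treegf (f D) H))))).
    apply: lepolyM; [|by apply: lepoly0M; apply: tgf_ge0|exact: lepoly_refl|].
      by apply: lepoly0M => //; apply: lepoly0_comp.
    by apply: lepolyM; try exact: tgf_ge0; apply: tgf_generation_le.
  have -> : 'X * ((f D)^`()^`() \Po treegf (f D) H) *
    (('X^a * (((f D)^`() ^+ a * 'X) \Po treegf (f D) H)) *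
     ('X^b * (((f D)^`() ^+ b * 'X) \Po treegf (f D) H))) =
    'X^(pairexp a.+1 b.+1) * (pairpoly D a.+1 b.+1 \Po treegf (f D) H).
    by rewrite /= !exprD !exprS expr0 mulr1 !comp_polyM !comp_polyXe !comp_polyX !exprD; ring.
  apply: lepolyM; [exact: lepoly0Xn| |exact: lepoly_refl|].
    exact: lepoly0_comp (pairpoly_ge0 _ _ _) _.
  exact: lepoly_treegfS (pairpoly_ge0 _ _ _).
have Q0 l : lepoly 0 ((f D)^`() ^+ l * pairpoly D a b).
  by apply: lepoly0M; [apply: lepoly0Xe|apply: pairpoly_ge0].
case: H => [|H].
  rewrite /tgf big_nil; apply: lepoly0M; first exact: lepoly0Xn.
  exact: lepoly0_comp.
rewrite tgf_npairsS //.
apply: (@lepoly_trans _ _ ('X * ((f D)^`() \Po treegf (f D) H) *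
    ('X^(h + pairexp a b) * (((f D)^`() ^+ h * pairpoly D a b) \Po treegf (f D) H)))).
  apply: lepolyM; [|exact: tgf_ge0|exact: lepoly_refl|exact: IH].
  by apply: lepoly0M => //; apply: lepoly0_comp.
have -> : 'X * ((f D)^`() \Po treegf (f D) H) *
    ('X^(h + pairexp a b) * (((f D)^`() ^+ h * pairpoly D a b) \Po treegf (f D) H)) =
   'X^(h.+1 + pairexp a b) * (((f D)^`() ^+ h.+1 * pairpoly D a b) \Po treegf (f D) H).
  by rewrite addSn !exprS -!mulrA !comp_polyM; ring.
apply: lepolyM; [exact: lepoly0Xn|exact: lepoly0_comp|exact: lepoly_refl|].
exact: lepoly_treegfS.
Qed.

Lemma deriv1X_le D l : 0 <= ((f D)^`() ^+ l).[1] <= 1 /\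
  0 <= ((f D)^`() ^+ l)^`().[1] <= l%:R * M3.
Proof.
have d1 := offpoly_deriv1_le m_mean D; have d2 := offpoly_deriv2_le m_ge0 m_third D.
have e1 : 0 <= (f D)^`().[1] by apply: lepoly_horner.
have e2 : 0 <= (f D)^`()^`().[1] by apply: lepoly_horner.
elim: l => [|l [/andP[a1 a2] /andP[b1 b2]]].
  by rewrite expr0 derivC horner0 hornerC mul0r lexx ler01 lexx.
rewrite exprS derivM hornerD !hornerM.
split; first by rewrite mulr_ge0 //= mulr_ile1.
rewrite addr_ge0 ?mulr_ge0 //= -natr1 mulrDl mul1r addrC; apply: lerD.
  by rewrite -[leRHS]mul1r; apply: ler_pM.
by rewrite -[leRHS]mulr1; apply: ler_pM.
Qed.

(** Product rule: the factors are at most 1 or M3 at the point 1, and the derivative falls on one of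
    about h + a + b of them. Differentiating the branching factor produces f''', whose value at 1 is
    bounded by the third moment. *)
Lemma pairpoly_deriv_le D h a b :
  ((f D)^`() ^+ h * pairpoly D a b)^`().[1] <=
    3 * (M3 + 1) ^+ 2 * (h + a + b).+1%:R.
Proof.
have M30 : 0 <= M3 := M3_ge0 m_third.
have spine l : ((f D)^`() ^+ l * 'X)^`().[1] <= 3 * (M3 + 1) ^+ 2 * l.+1%:R.
  have [/andP[a1 a2] /andP[b1 b2]] := deriv1X_le D l.
  rewrite derivM derivX hornerD !hornerM hornerX hornerC !mulr1.
  have l0 : 0 <= l%:R :> R by [].
  have h1 : 0 <= M3 * l%:R by rewrite mulr_ge0.
  have h2 : 0 <= M3 ^+ 2 * l%:R by rewrite mulr_ge0 ?sqr_ge0.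
  have h3 : 0 <= M3 ^+ 2 by rewrite sqr_ge0.
  rewrite -natr1 !expr2 in h2 h3 *; nra.
have mono i j : (i <= j)%N -> 3 * (M3 + 1) ^+ 2 * i.+1%:R <= 3 * (M3 + 1) ^+ 2 * j.+1%:R.
  by move=> ij; rewrite ler_wpM2l ?ler_nat // mulr_ge0 ?sqr_ge0.
case: a b => [|a] [|b]; rewrite /pairpoly; try (rewrite mulrA -exprD; apply: le_trans (spine _) _; apply: mono; lia).
have -> : (f D)^`() ^+ h * ((f D)^`()^`() * (f D)^`() ^+ (a + b) * 'X^2) =
   (f D)^`()^`() * ((f D)^`() ^+ (h + (a + b)) * 'X^2) by rewrite !exprD; ring.
apply: (@le_trans _ _ (3 * (M3 + 1) ^+ 2 * (h + (a + b)).+1%:R)); last by apply: mono; lia.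
move: (h + (a + b))%N => l.
have [/andP[a1 a2] /andP[b1 b2]] := deriv1X_le D l.
have d2 := offpoly_deriv2_le m_ge0 m_third D.
have d3 := offpoly_deriv3_le m_ge0 m_third D.
have e2 : 0 <= (f D)^`()^`().[1] by apply: lepoly_horner.
have e3 : 0 <= (f D)^`()^`()^`().[1] by apply/lepoly_horner => //; apply: lepoly0_deriv.
rewrite derivM derivM derivXn hornerD !hornerM hornerD !hornerM hornerMn !hornerXn !expr1n !mulr1.
have l0 : 0 <= l%:R :> R by [].
have h1 : 0 <= M3 * l%:R by rewrite mulr_ge0.
have h2 : 0 <= M3 ^+ 2 * l%:R by rewrite mulr_ge0 ?sqr_ge0.
have h3 : 0 <= M3 ^+ 2 by rewrite sqr_ge0.
have u1 : (f D)^`()^`()^`().[1] * ((f D)^`() ^+ l).[1] <= M3 * 1 by apply: ler_pM.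
have u2 : (f D)^`()^`().[1] * (((f D)^`() ^+ l)^`().[1] + ((f D)^`() ^+ l).[1] * 2)
   <= M3 * (l%:R * M3 + 1 * 2).
  by apply: ler_pM => //; rewrite ?addr_ge0 ?mulr_ge0 //; lra.
apply: le_trans (lerD u1 u2) _.
rewrite -natr1 !expr2 in h2 h3 *; nra.
Qed.

Lemma offpolyX_le_rsq : exists2 C : R, 0 < C &
  forall D n s, (k0 <= D)%N -> (f D ^+ n)`_s <= C * rsq n.
Proof.
pose c : R := Num.min 1 (Num.min (2 * m 0%N) (2 * m k0)).
have c01 : 0 < c <= 1 by rewrite /c !lt_min ltr01 !mulr_gt0 // ge_min lexx.
exists (2 * Num.sqrt (2 / c)).
  by case/andP: c01 => c0 _; rewrite mulr_gt0 // sqrtr_gt0 divr_gt0.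
move=> D n s hD.
have := @coefX_le_rsq R (f D) (f_ge0 D) (offpoly1_le m_sum D) c k0 n s c01 (ltnW k0_gt1).
apply.
  by rewrite coef_offpoly /= ler_pdivrMr // mulrC /c !ge_min lexx !orbT.
by rewrite coef_offpoly hD ler_pdivrMr // mulrC /c !ge_min lexx !orbT.
Qed.

Lemma pair_count : exists2 C : R, 0 < C &
  forall n D H h a b, (k0 <= D)%N -> (0 < n)%N -> (2 * (h + a + b) <= n)%N ->
  \sum_(t <- trees D H | psize t == n) tweight m t * (npairs h a b t)%:R
    <= C * (h + a + b).+1%:R * (rsq n / n%:R).
Proof.
have [C C0 hC] := offpolyX_le_rsq.
have M30 : 0 <= M3 := M3_ge0 m_third.
exists (3 * (M3 + 1) ^+ 2 * (C * 4)).
  have h : 0 < (M3 + 1) ^+ 2 by rewrite exprn_gt0 // ltr_wpDl.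
  by move: h; move: (_ ^+ 2) => y h; rewrite !mulr_gt0.
move=> n D H h a b hD n0 hn.
have eab : (pairexp a b <= a + b)%N by case: a b {hn} => [|a] [|b] //=; lia.
rewrite -coef_tgf; apply: le_trans (tgf_npairs_le D H h a b n) _.
rewrite coefXnM ltnNge (_ : (_ <= _)%N) /=; last by lia.
(* The degree left once each spine vertex has taken its factor X. It is at least n / 2, so passing
   from n'^(-3/2) to n^(-3/2) costs at most the factor 4 of the constant. *)
set n' := (n - _)%N.
have hn' : (n <= 2 * n')%N by rewrite /n'; lia.
have n'0 : (0 < n')%N by lia.
have Q0 : lepoly 0 ((f D)^`() ^+ h * pairpoly D a b).
  by apply: lepoly0M; [apply: lepoly0Xe|apply: pairpoly_ge0].
have M0 : 0 <= C * rsq n' by rewrite mulr_ge0 ?rsq_ge0 ?ltW.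
have tc := treegf_comp_le (f_ge0 D) (offpoly1_le m_sum D) H Q0 n'0 M0 (fun s => hC D n' s hD).
apply: le_trans tc _.
have dd := pairpoly_deriv_le D h a b.
have r1 : rsq n' <= 2 * rsq n :> R.
  rewrite -(ler_pXn2r (n := 2)) ?nnegrE ?mulr_ge0 ?rsq_ge0 //.
  rewrite exprMn !rsq_sqr ler_pdivlMr // ler_pdivrMl // -natrX -natrM ler_nat; lia.
have r2 : n'%:R^-1 <= 2 / n%:R :> R.
  rewrite ler_pdivlMr ?ltr0n // ler_pdivrMl ?ltr0n // -natrM ler_nat; lia.
have -> : 3 * (M3 + 1) ^+ 2 * (C * 4) * (h + a + b).+1%:R * (rsq n / n%:R) =
   3 * (M3 + 1) ^+ 2 * (h + a + b).+1%:R * (C * (2 * rsq n) * (2 / n%:R)) by ring.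
apply: ler_pM => //.
- by apply: lepoly_horner => //; apply: lepoly0_deriv.
- by rewrite mulr_ge0 ?invr_ge0.
apply: ler_pM; rewrite ?invr_ge0 //.
by apply: ler_wpM2l => //; apply: ltW.
Qed.

Lemma sum_tweight n H : (n <= H)%N -> (0 < n)%N ->
  \sum_(t <- trees n H | psize t == n) tweight m t = (f n ^+ n)`_n.-1 / n%:R.
Proof.
move=> nH n0.
transitivity ((tgf m (trees n H) (fun=> 1%N))`_n).
  by rewrite coef_tgf; apply: eq_bigr => t _; rewrite mulr1.
rewrite tgf_trees // -[treegf _ _]expr1.
have -> : (treegf (f n) H ^+ 1)`_n = kemp (f n) n 1.
  apply/eqP; rewrite eq_le; apply/andP.
  by split; [exact: treegfX_le (offpoly1_le m_sum n) _ _ _|exact: treegfX_ge (offpoly1_le m_sum n) _ _ _ nH].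
by case: n n0 nH => // n _ _; rewrite /kemp /= subSS subn0 mul1r mulrC.
Qed.

Lemma tree_size_lower : exists2 kappa : R, 0 < kappa & exists n0, forall n, (n0 <= n)%N ->
  0 < \sum_(t <- trees n n | psize t == n) tweight m t ->
  kappa * (rsq n / n%:R) <= \sum_(t <- trees n n | psize t == n) tweight m t.
Proof.
have [kap kap0 [n0 hn0]] := local_lower_bound m_ge0 m_sum m_mean m_third m_sum_ge m_mean_ge m0_gt0 k0_gt1 mk0_gt0.
exists kap => //; exists n0.+1 => n hn.
have n1 : (0 < n)%N by lia.
have nR : 0 < n%:R :> R by rewrite ltr0n.
rewrite sum_tweight // => h; rewrite mulrA ler_pM2r ?invr_gt0 //.
apply: hn0; first by lia.
by move: h; rewrite pmulr_lgt0 ?invr_gt0.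
Qed.

Lemma offpoly_horner D (y : R) : (f D).[y] = \sum_(k < D.+1) m k * y ^+ k.
Proof. by rewrite /offpoly horner_poly. Qed.

Lemma offpoly_deriv_horner D (y : R) :
  (f D)^`().[y] = \sum_(k < D.+1) m k * (k%:R * y ^+ k.-1).
Proof.
rewrite /offpoly poly_def raddf_sum horner_sum; apply: eq_bigr => k _.
by rewrite /= derivZ derivXn hornerZ hornerMn hornerXn mulr_natl.
Qed.

(** A Bonferroni inequality: the induction step discards exactly the nonnegative cubic term. *)
Lemma onem_expr_le (q : R) k : 0 <= q <= 1 ->
  (1 - q) ^+ k <= 1 - k%:R * q + k%:R * (k%:R - 1) / 2 * q ^+ 2.
Proof.
move=> /andP[q0 q1]; elim: k => [|k IH]; first by rewrite expr0; lra.
rewrite exprS; apply: le_trans (ler_wpM2l _ IH) _; first by lra.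
have k0' : 0 <= k%:R * (k%:R - 1) / 2 * q ^+ 3 :> R.
  rewrite mulr_ge0 ?exprn_ge0 // divr_ge0 //.
  by case: k {IH} => [|k]; [rewrite mul0r|rewrite -(natr1 k) addrK mulr_ge0 // addr_ge0].
rewrite -natr1 -subr_ge0; set u := (X in 0 <= X).
have -> : u = k%:R * (k%:R - 1) / 2 * q ^+ 3 by rewrite /u; field.
exact: k0'.
Qed.

(* Evaluating at [1 - 1/n] instead of [1] costs a bounded factor on the
   coefficients of degree at most [n]. *)
Lemma offpoly_contract : exists2 kap : R, 0 < kap <= 1 & forall n H, (1 < n)%N ->
  0 <= (treegf (f n) H).[1 - n%:R^-1] <= 1 - kap * rsq n.
Proof.
have M30 : 0 <= M3 := M3_ge0 m_third.
pose kap : R := (4 * (M3 + 1))^-1.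
have kapM : kap * (4 * (M3 + 1)) = 1 by rewrite /kap mulVf //; lra.
have kap0 : 0 < kap by rewrite invr_gt0; lra.
have kapM3 : kap * M3 + kap = 1 / 4 by lra.
have kM0 : 0 <= kap * M3 by rewrite mulr_ge0 // ltW.
exists kap; first by rewrite kap0; lra.
clearbody kap => n H n1.
set de := n%:R^-1; set q := kap * rsq n.
have n2 : 2 <= n%:R :> R by rewrite -[2]/(2%:R) ler_nat.
have de0 : 0 < de by rewrite invr_gt0; lra.
have de1 : de <= 1 / 2 by rewrite /de mul1r lef_pV2 ?posrE //; lra.
have nde : n%:R * de = 1 by rewrite mulfV //; lra.
have q0 : 0 < q by rewrite mulr_gt0 // rsq_gt0.
have qk : q <= kap by rewrite ler_piMr ?rsq_le1 // ltW.
have q2 : q ^+ 2 <= kap ^+ 2 * de.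
  rewrite exprMn rsq_sqr; apply: ler_wpM2l; first exact: sqr_ge0.
  by rewrite lef_pV2 ?posrE ?ltr0n ?ler_nat ?leqnSn // ltnW.
have fq : (f n).[1 - q] <= 1 - q + de / 2.
  have e : (f n).[1 - q] <= (f n).[1] - q * (f n)^`().[1] + q ^+ 2 / 2 * (f n)^`()^`().[1].
    rewrite offpoly_horner offpoly1E offpoly_deriv1 deriv2_sum.
    rewrite (sum_offpoly m n (fun i => i%:R * (i%:R - 1))) !mulr_sumr -sumrB -big_split /=.
    apply: ler_sum => k _.
    have -> : m k - q * (m k * k%:R) + q ^+ 2 / 2 * (m k * (k%:R * (k%:R - 1))) =
      m k * (1 - k%:R * q + k%:R * (k%:R - 1) / 2 * q ^+ 2) by ring.
    by apply: ler_wpM2l => //; apply: onem_expr_le; lra.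
  apply: le_trans e _.
  have d0 := offpoly1_le m_sum n.
  have d1 : 1 - M3 * de ^+ 2 <= (f n)^`().[1].
    by rewrite offpoly_deriv1 /de exprVn; exact: m_mean_ge (ltnW n1).
  have d2 := offpoly_deriv2_le m_ge0 m_third n.
  have u1 : q * (1 - M3 * de ^+ 2) <= q * (f n)^`().[1] by rewrite ler_wpM2l // ltW.
  have u2 : q ^+ 2 / 2 * (f n)^`()^`().[1] <= kap ^+ 2 * de / 2 * M3.
    apply: ler_pM => //; first by rewrite divr_ge0 ?sqr_ge0.
      by apply: lepoly_horner.
    by rewrite ler_wpM2r ?invr_ge0.
  have u3 : q * (M3 * de ^+ 2) <= (kap * M3) * (de / 2).
    have h : q * M3 <= kap * M3 by rewrite ler_wpM2r.
    have h' : de ^+ 2 <= de / 2 by rewrite expr2 -[1/2]mul1r in de1 *; nra.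
    rewrite mulrA; apply: ler_pM => //; last exact: sqr_ge0.
    by rewrite mulr_ge0 // ltW.
  have u4 : kap ^+ 2 * de / 2 * M3 <= kap * M3 * (de / 2).
    have h : kap * (kap * M3 * (de / 2)) <= 1 * (kap * M3 * (de / 2)).
      by rewrite ler_wpM2r ?mulr_ge0 ?divr_ge0 //; lra.
    by move: h; rewrite !expr2; lra.
  have u5 : kap * M3 * (de / 2) <= (1 / 4) * (de / 2) by rewrite ler_wpM2r ?divr_ge0 //; lra.
  lra.
(* The level 1 - q is a barrier for the iteration: f is increasing and (1 - de) f(1 - q) <= (1 -
   de)(1 - q + de / 2) <= 1 - q. The gain [de] beats the second-order term because q^2 <= kap^2
   de. *)
elim: H => [|H /andP[IH0 IH1]]; first by rewrite horner0 lexx; lra.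
rewrite [treegf _ _]/= hornerM hornerX horner_comp.
set y := (treegf (f n) H).[1 - de] in IH0 IH1 *.
have fy0 : 0 <= (f n).[y] by apply: lepoly_horner.
have fy1 : (f n).[y] <= (f n).[1 - q].
  rewrite !offpoly_horner; apply: ler_sum => k _; apply: ler_wpM2l => //.
  by rewrite lerXn2r ?nnegrE //; lra.
apply/andP; split; first by rewrite mulr_ge0 //; lra.
have fy2 := le_trans fy1 fq.
have : (1 - de) * (f n).[y] <= (1 - de) * (1 - q + de / 2) by rewrite ler_wpM2l //; lra.
move=> h; apply: le_trans h _.
have : de * q <= de * (1 / 4) by rewrite ler_wpM2l ?(ltW de0) //; lra.
have : 0 <= de * de by rewrite mulr_ge0 // ltW.
lra.
Qed.

(** Evaluate the spine bound at 1 - 1/n. There the tree generating function is at most 1 -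
    [kap * rsq n], so f' is at most 1 - m k0 times [kap * rsq n], and its h-th power decays
    exponentially in h / sqrt n. Recovering the coefficient costs (1 - 1/n)^(-n) <= e^2, the 2 in
    the exponent. *)
Lemma height_tail : exists2 c : R, 0 < c & exists n0, forall n H h, (n0 <= n)%N ->
  \sum_(t <- trees n H | psize t == n) tweight m t * (generation h t)%:R
    <= expR (2 - c * rsq n * h%:R).
Proof.
have [kap /andP[kap0 kap1] hF] := offpoly_contract.
have mk1 : m k0 <= 1.
  apply: le_trans (m_sum k0.+1); rewrite big_ord_recr /= lerDr.
  by apply: sumr_ge0.
exists (m k0 * kap); first by rewrite mulr_gt0.
exists (maxn 2 k0) => n H h; rewrite geq_max => /andP[n1 nk].
have /andP[F0 F1] := hF n H n1.
set q := kap * rsq n in F1; set de := n%:R^-1 in F0 F1.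
have q0 : 0 < q by rewrite mulr_gt0 // rsq_gt0.
have q1 : q <= 1 by rewrite mulr_ile1 ?rsq_ge0 ?rsq_le1 // ltW.
have n2 : 2 <= n%:R :> R by rewrite -[2]/(2%:R) ler_nat.
have de0 : 0 < de by rewrite invr_gt0; lra.
have de1 : de <= 1 / 2 by rewrite /de mul1r lef_pV2 ?posrE //; lra.
have nde : n%:R * de = 1 by rewrite mulfV //; lra.
set y := (treegf (f n) H).[1 - de] in F0 F1 *.
have k01 : (1 <= k0.-1)%N by case: (k0) k0_gt1 => [|[|]].
have fd : (f n)^`().[y] <= 1 - m k0 * q.
  have hk : (k0 < n.+1)%N by rewrite ltnS.
  apply: (@le_trans _ _ (\sum_(k < n.+1) (m k * k%:R - (if k == Ordinal hk then m k0 * q else 0)))).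
    rewrite offpoly_deriv_horner; apply: ler_sum => k _.
    case: eqP => [->|_] /=.
      have e : y ^+ k0.-1 <= 1 - q.
        apply: (@le_trans _ _ (y ^+ 1)); last by rewrite expr1.
        by rewrite ler_wiXn2l // (le_trans F1) // gerBl ltW.
      have k1' : 1 <= k0%:R :> R by rewrite ler1n ltnW.
      have : m k0 * (k0%:R * y ^+ k0.-1) <= m k0 * (k0%:R * (1 - q)).
        by rewrite !ler_wpM2l.
      have : 1 * q <= k0%:R * q by rewrite ler_wpM2r // ltW.
      move=> h1 h2; apply: le_trans h2 _.
      have : m k0 * (1 * q) <= m k0 * (k0%:R * q) by rewrite ler_wpM2l.
      lra.
    rewrite subr0 ler_wpM2l // ler_piMr //; apply: exprn_ile1 => //; lra.
  rewrite sumrB -big_mkcond /= big_pred1_eq lerD2r; exact: m_mean.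
have fd0 : 0 <= (f n)^`().[y] by apply: lepoly_horner.
rewrite -coef_tgf; set z := _`_n.
have z1 : z * (1 - de) ^+ n <= (1 - m k0 * q) ^+ h.
  have hd : 0 <= 1 - de by lra.
  apply: le_trans (ler_wpM2r (exprn_ge0 _ hd) (tgf_generation_le n H h n)) _.
  have Q0 : lepoly 0 ('X^h * ((f n)^`() ^+ h * 'X \Po treegf (f n) H)).
    apply: lepoly0M; first exact: lepoly0Xn.
    by apply: lepoly0_comp => //; apply: lepoly0M => //; apply: lepoly0Xe.
  apply: le_trans (coef_le_horner n Q0 hd) _.
  rewrite hornerM hornerXn horner_comp hornerM horner_exp hornerX -/y.
  have a1 : (1 - de) ^+ h <= 1 by rewrite exprn_ile1 //; lra.
  have a2 : (f n)^`().[y] ^+ h <= (1 - m k0 * q) ^+ h by rewrite lerXn2r ?nnegrE //; lra.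
  have a3 : (f n)^`().[y] ^+ h * y <= (1 - m k0 * q) ^+ h * 1.
    by apply: ler_pM => //; [exact: exprn_ge0|lra].
  rewrite -[leRHS]mul1r -[X in _ <= 1 * X]mulr1; apply: ler_pM => //; first exact: exprn_ge0.
  by rewrite mulr_ge0 ?exprn_ge0.
have z2 : expR (- 2) <= (1 - de) ^+ n.
  have : expR (- (2 * de)) <= 1 - de by apply: expR_le_1B; lra.
  move=> e; apply: (@le_trans _ _ (expR (- (2 * de)) ^+ n)); last first.
    by rewrite lerXn2r ?nnegrE ?expR_ge0 //; lra.
  by rewrite -expRM_natl mulrN mulrCA nde mulr1.
have z3 : (1 - m k0 * q) ^+ h <= expR (- (m k0 * kap * rsq n * h%:R)).
  have -> : - (m k0 * kap * rsq n * h%:R) = h%:R * (- (m k0 * q)) by rewrite /q; ring.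
  rewrite expRM_natl lerXn2r ?nnegrE ?expR_ge0 ?expR_ge1Dx //.
  by apply: le_trans fd0 fd.
have z0 : 0 <= z by have := tgf_ge0 m_ge0 (trees n H) (generation h) n; rewrite coef0.
rewrite expRD mulrC -ler_pdivrMr ?expR_gt0 // -expRN.
apply: le_trans z3; apply: le_trans z1.
exact: ler_wpM2l.
Qed.

End TreeCounts.

(** * Vertices and distances *)

Section UlamHarrisLabels.
Implicit Types (t s : ptree) (ts : seq ptree) (u v : seq nat).
Local Notation leaf := (PNode [::]).

Fixpoint prefixed i (l : seq (seq (seq nat))) : seq (seq nat) :=
  if l is vs :: r then [seq i :: u | u <- vs] ++ prefixed i.+1 r else [::].

Fixpoint verts t : seq (seq nat) :=
  let: PNode ts := t in [::] :: prefixed 0 [seq verts s | s <- ts].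

Fixpoint deg u t : nat :=
  if u is i :: u' then deg u' (nth leaf (pchildren t) i) else size (pchildren t).

(** Stripping the common prefix removes the path to the last common ancestor; the lengths that
    remain add up to the graph distance. *)
Fixpoint dist u v : nat :=
  match u, v with
  | i :: u', j :: v' => if i == j then dist u' v' else (size u + size v)%N
  | _, _ => (size u + size v)%N
  end.

Lemma vertsE ts : verts (PNode ts) = [::] ::
  flatten [seq [seq j :: u | u <- verts (nth leaf ts j)] | j <- iota 0 (size ts)].
Proof.
rewrite /=; congr (_ :: _).
have h i : prefixed i [seq verts s | s <- ts] =
   flatten [seq [seq j :: u | u <- verts (nth leaf ts (j - i))] | j <- iota i (size ts)].
  elim: ts i => [//|s ts IH] i /=; rewrite subnn IH /=; congr (_ ++ flatten _).
  apply/eq_in_map => j; rewrite mem_iota => /andP[ij _].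
  by rewrite -[(j - i)%N](@subnSK i j).
by rewrite h; congr flatten; apply: eq_map => j; rewrite subn0.
Qed.

Lemma mem_verts i u ts :
  (i :: u \in verts (PNode ts)) = (i < size ts)%N && (u \in verts (nth leaf ts i)).
Proof.
rewrite vertsE inE /=; apply/flatten_mapP/andP => [[j]|[hi hu]].
  by rewrite mem_iota /= add0n => hj /mapP[v hv [-> ->]].
by exists i; rewrite ?mem_iota //; apply: map_f.
Qed.

Lemma root_verts t : [::] \in verts t.
Proof. by case: t => ts; rewrite /= inE eqxx. Qed.

Lemma uniq_verts t : uniq (verts t).
Proof.
elim/ptree_ind_nth: t => ts IH /=.
have h (l : seq (seq (seq nat))) i : all uniq l ->
    uniq (prefixed i l) && all (fun u => (u != [::]) && (i <= head 0 u)%N) (prefixed i l).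
  elim: l i => [//|x l IHl] i /= /andP[ux ul]; have /andP[h1 h2] := IHl i.+1 ul.
  rewrite cat_uniq all_cat h1 map_inj_uniq ?ux; last by move=> ? ? [].
  rewrite /= andbT; apply/and3P; split.
  - apply/hasPn => u /(allP h2) /andP[_ hu]; apply/negP => /mapP[v _ e].
    by move: hu; rewrite e ltnn.
  - by apply/allP => u /mapP[v _ ->] /=.
  by apply: sub_all h2 => u /andP[-> /ltnW].
have /h h0 : all uniq [seq verts s | s <- ts].
  by apply/allP => x /mapP[s /(nthP leaf)[i hi <-] ->]; apply: IH.
have /andP[-> /allP h2] := h0 0%N; rewrite andbT.
by apply/negP => /h2.
Qed.

Lemma size_verts t : size (verts t) = psize t.
Proof.
have h i l : size (prefixed i l) = sumn [seq size x | x <- l].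
  by elim: l i => [//|x l IH] i /=; rewrite size_cat size_map IH.
elim/ptree_ind_nth: t => ts IH /=; rewrite h -map_comp; congr (sumn _).+1.
apply: (@eq_from_nth _ 0%N); rewrite ?size_map // => i hi.
by rewrite !(nth_map leaf) //= IH.
Qed.

Lemma big_verts (T : Type) (idx : T) (op : Monoid.law idx) (F : seq nat -> T) ts :
  \big[op/idx]_(u <- verts (PNode ts)) F u =
  op (F [::]) (\big[op/idx]_(j < size ts)
     \big[op/idx]_(u <- verts (nth leaf ts j)) F (nat_of_ord j :: u)).
Proof.
rewrite vertsE big_cons big_flatten big_map (_ : iota 0 _ = index_iota 0 (size ts)) ?big_mkord; last by rewrite /index_iota subn0.
by congr (op _ _); apply: eq_bigr => j _; rewrite big_map.
Qed.

Lemma sum_verts_cons (V : nmodType) (F : seq nat -> V) ts :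
  \sum_(u <- verts (PNode ts)) F u =
  F [::] + \sum_(j < size ts) \sum_(u <- verts (nth leaf ts j)) F (nat_of_ord j :: u).
Proof. exact: big_verts. Qed.

Lemma sum_ord_S (V : nmodType) (F : nat -> V) n :
  \sum_(i < n.+1) F i = F 0%N + \sum_(i < n) F i.+1.
Proof. by rewrite big_ord_recl; congr (_ + _); apply: eq_bigr => i _; rewrite lift0. Qed.

Lemma sumn_ord_S (F : nat -> nat) n :
  (\sum_(i < n.+1) F i = F 0 + \sum_(i < n) F i.+1)%N.
Proof. exact: sum_ord_S. Qed.

Lemma sumn_nth (q : ptree -> nat) ts :
  sumn [seq q s | s <- ts] = (\sum_(j < size ts) q (nth leaf ts j))%N.
Proof. by rewrite sumnE big_map (big_nth leaf) big_mkord. Qed.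

Lemma generationS0 H ts (i : 'I_(size ts)) : generation H.+1 (PNode ts) = 0%N ->
  generation H (nth leaf ts i) = 0%N.
Proof.
by rewrite /= sumn_nth => /eqP; rewrite sum_nat_eq0 => /forallP /(_ i) /eqP.
Qed.

Lemma offdiagE (p q : ptree -> nat) ts : offdiag p q ts =
  (\sum_(i < size ts) \sum_(j < size ts)
     (i != j :> nat) * (p (nth leaf ts i) * q (nth leaf ts j)))%N.
Proof.
elim: ts => [|s ts IH]; first by rewrite big_ord0.
rewrite [size _]/= (sumn_ord_S (fun i => \sum_(j < (size ts).+1)
  (i != j) * (p (nth leaf (s :: ts) i) * q (nth leaf (s :: ts) j)))%N).
rewrite (sumn_ord_S (fun j =>
  (0%N != j) * (p (nth leaf (s :: ts) 0) * q (nth leaf (s :: ts) j)))%N).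
rewrite mul0n add0n [LHS]/= IH !sumn_nth.
have -> : (\sum_(i < size ts) \sum_(j < (size ts).+1)
      (i.+1 != j) * (p (nth leaf (s :: ts) i.+1) * q (nth leaf (s :: ts) j)) =
    \sum_(i < size ts) p (nth leaf ts i) * q s + \sum_(i < size ts) \sum_(j < size ts)
      (i != j) * (p (nth leaf ts i) * q (nth leaf ts j)))%N.
  rewrite -big_split; apply: eq_bigr => i _ /=.
  by rewrite (sumn_ord_S (fun j =>
    (i.+1 != j) * (p (nth leaf ts i) * q (nth leaf (s :: ts) j)))%N) mul1n.
rewrite addnA !big_distrr /=; congr (_ + _ + _)%N.
- by apply: eq_bigr => i _; rewrite mul1n.
- by apply: eq_bigr => i _; rewrite mulnC.
Qed.

End UlamHarrisLabels.

Section SumsOverVertices.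
Context {R : realType}.
Implicit Types (t : ptree) (phi : nat -> R).
Local Notation leaf := (PNode [::]).

Lemma prod_verts (m : nat -> R) t :
  \prod_(u <- verts t) m (deg u t) = tweight m t.
Proof.
elim/ptree_ind_nth: t => ts IH; rewrite big_verts tweightE; congr (_ * _).
rewrite [RHS](big_nth leaf) big_mkord; apply: eq_bigr => j _.
by rewrite -IH.
Qed.

Lemma sum_verts phi t H K : generation H t = 0%N -> (H <= K)%N ->
  \sum_(u <- verts t) phi (size u) = \sum_(h < K) (generation h t)%:R * phi h.
Proof.
elim: H K t phi => [//|H IH] [//|K] [ts] phi hts hK.
rewrite sum_verts_cons (sum_ord_S (fun h => (generation h (PNode ts))%:R * phi h)).
rewrite mul1r; congr (_ + _).
under eq_bigr => j _.
  rewrite (IH K _ (fun h => phi h.+1) (generationS0 j hts) hK).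
  over.
rewrite exchange_big /=; apply: eq_bigr => h _.
by rewrite sumn_nth natr_sum mulr_suml.
Qed.

(** Induction on the height: a pair contains the root, lies in one child, which shifts the depth of
    its ancestor, or lies in two distinct children, which is [offdiag]. The condition
    [generation H t = 0] says that the height is below H. *)
Lemma sum_verts_dist phi t H K : generation H t = 0%N -> (H <= K)%N ->
  \sum_(u <- verts t) \sum_(v <- verts t) phi (dist u v) =
  \sum_(h < H) \sum_(a < K) \sum_(b < K) (npairs h a b t)%:R * phi (a + b)%N.
Proof.
elim: H K t => [//|H IH] [//|K] [ts] hts hK.
have child (i : 'I_(size ts)) := generationS0 i hts.
pose N h a b : R := (npairs h a b (PNode ts))%:R * phi (a + b)%N.
rewrite sum_verts_cons (sum_ord_S
  (fun h => \sum_(a < K.+1) \sum_(b < K.+1) N h a b)).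
rewrite (sum_ord_S (fun a => \sum_(b < K.+1) N 0%N a b)).
rewrite -addrA; congr (_ + _).
  by rewrite (sum_verts phi hts hK); apply: eq_bigr.
under eq_bigr => i _.
  under eq_bigr => u _ do rewrite sum_verts_cons.
  rewrite big_split /=.
  over.
rewrite big_split /=.
under [X in _ = X + _]eq_bigr => a _ do rewrite (sum_ord_S (N 0%N a.+1)).
rewrite big_split /= -addrA; congr (_ + _).
  under eq_bigr => i _.
    under eq_bigr => u _ do rewrite addn0.
    rewrite (sum_verts (fun h => phi h.+1) (child i) hK).
    over.
  rewrite exchange_big /=; apply: eq_bigr => a _.
  by rewrite /N addn0 [npairs _ _ _ _]/= sumn_nth natr_sum mulr_suml.
have diag : \sum_(h < H) \sum_(a < K.+1) \sum_(b < K.+1) N h.+1 a b =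
   \sum_(i < size ts) \sum_(u <- verts (nth leaf ts i))
      \sum_(v <- verts (nth leaf ts i)) phi (dist u v).
  under [RHS]eq_bigr => i _ do rewrite (IH K.+1 _ (child i) (leqW hK)).
  rewrite [RHS]exchange_big; apply: eq_bigr => h _.
  rewrite [RHS]exchange_big; apply: eq_bigr => a _.
  rewrite [RHS]exchange_big; apply: eq_bigr => b _.
  by rewrite /N [npairs _ _ _ _]/= sumn_nth natr_sum mulr_suml.
pose off i j : R := \sum_(u <- verts (nth leaf ts i)) \sum_(v <- verts (nth leaf ts j))
  phi ((size u).+1 + (size v).+1)%N.
have offE (i j : 'I_(size ts)) : off i j = \sum_(a < K) \sum_(b < K)
    ((generation a (nth leaf ts i))%:R * (generation b (nth leaf ts j))%:R) *
      phi (a.+1 + b.+1)%N.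
  rewrite /off; under eq_bigr => u _.
    rewrite (sum_verts (fun h => phi ((size u).+1 + h.+1)%N) (child j) hK).
    over.
  rewrite (sum_verts (fun g => \sum_(h < K) (generation h (nth leaf ts j))%:R *
     phi (g.+1 + h.+1)%N) (child i) hK).
  by apply: eq_bigr => a _; rewrite mulr_sumr; apply: eq_bigr => b _; rewrite mulrA.
have offd : \sum_(a < K) \sum_(b < K) N 0%N a.+1 b.+1 =
   \sum_(i < size ts) \sum_(j < size ts) (i != j :> nat)%:R * off i j.
  under [RHS]eq_bigr => i _.
    under eq_bigr => j _.
      rewrite offE mulr_sumr; under eq_bigr => a _ do rewrite mulr_sumr.
      over.
    rewrite exchange_big; under eq_bigr => a _ do rewrite exchange_big.
    over.
  rewrite [RHS]exchange_big; apply: eq_bigr => a _.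
  rewrite [RHS]exchange_big; apply: eq_bigr => b _.
  rewrite /N [npairs _ _ _ _]/= offdiagE natr_sum mulr_suml; apply: eq_bigr => i _.
  rewrite natr_sum mulr_suml; apply: eq_bigr => j _.
  by rewrite !natrM !mulrA.
rewrite diag offd addrC -big_split; apply: eq_bigr => i _ /=.
rewrite exchange_big /= (bigD1 i) //=; congr (_ + _).
  by apply: eq_bigr => u _; apply: eq_bigr => v _; rewrite eqxx.
rewrite [RHS](bigD1 i) //= eqxx mul0r add0r; apply: eq_bigr => j ji.
have ij : (i == j :> nat) = false by rewrite eq_sym; apply: negbTE.
by rewrite ij mul1r.
Qed.

End SumsOverVertices.

From mathcomp Require Import all_analysis measurable_realfun.

Import numFieldNormedType.Exports.

Local Open Scope classical_set_scope.
Local Open Scope ring_scope.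

(** * Heat kernel bounds *)

Section BoundedFunctions.
Context {R : realType}.
Implicit Types (c C : R).

(** Boundedness gives integrability under every law and is preserved by averaging, so the operators
    below compose freely. *)
Definition bnd (T : Type) (h : T -> R) := exists C, forall x : T, `|h x| <= C.

Lemma bnd_cst T c : bnd (fun _ : T => c).
Proof. by exists `|c|. Qed.

Lemma bndD T (f g : T -> R) : bnd f -> bnd g -> bnd (fun x => f x + g x).
Proof.
move=> [C hC] [D hD]; exists (C + D) => x.
by apply: le_trans (ler_normD _ _) _; apply: lerD.
Qed.

Lemma bndM T (f g : T -> R) : bnd f -> bnd g -> bnd (fun x => f x * g x).
Proof.
move=> [C hC] [D hD]; exists (C * D) => x.
by rewrite normrM; apply: ler_pM.
Qed.

Lemma bndZ T c (f : T -> R) : bnd f -> bnd (fun x => c * f x).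
Proof. by move=> hf; apply: bndM => //; apply: bnd_cst. Qed.

Lemma bndN T (f : T -> R) : bnd f -> bnd (fun x => - f x).
Proof. by move=> [C hC]; exists C => x; rewrite normrN. Qed.

Lemma bndB T (f g : T -> R) : bnd f -> bnd g -> bnd (fun x => f x - g x).
Proof. by move=> hf hg; apply: bndD => //; apply: bndN. Qed.

Lemma bnd_sum T (I : Type) (r : seq I) (F : I -> T -> R) :
  (forall i, bnd (F i)) -> bnd (fun x => \sum_(i <- r) F i x).
Proof.
move=> hF; elim: r => [|i r IH].
  by exists 0 => x; rewrite big_nil normr0.
have [C hC] := bndD (hF i) IH.
by exists C => x; rewrite big_cons.
Qed.

Lemma bnd_comp T U (f : T -> R) (u : U -> T) : bnd f -> bnd (fun x => f (u x)).
Proof. by move=> [C hC]; exists C => x. Qed.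

Lemma bnd_bool T (b : T -> bool) : bnd (fun x => (b x)%:R).
Proof. by exists 1 => x; case: (b x); rewrite ?normr1 ?normr0. Qed.

Lemma bnd01 T (f : T -> R) : (forall x : T, 0 <= f x <= 1) -> bnd f.
Proof. by move=> hf; exists 1 => x; have /andP[a b] := hf x; rewrite ger0_norm. Qed.

End BoundedFunctions.

(** * Averaging operators, n-step laws and domination of a uniform law on corners *)

Section LatticeMeans.
Context {R : realType} {d : nat}.
Local Notation law := (probability (lattice d) R).
Implicit Types (p : law) (f g h : lattice d -> R) (x y z : lattice d) (c C : R).

Lemma bnd_integrable p f : bnd f -> p.-integrable setT (EFin \o f).
Proof.
move=> [C hC]; apply: measurable_bounded_integrable => //.
- exact: fin_num_fun_lty.
- exists C; split; first exact: num_real.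
  by move=> M CM x _ /=; apply: le_trans (hC x) (ltW CM).
Qed.

Definition mean p f : R := \int[p]_x f x.

Lemma mean_cst p c : mean p (fun=> c) = c.
Proof.
rewrite /mean Rintegral_cst // -[RHS]mulr1; congr (_ * _).
by rewrite -[RHS]/(fine 1%E); congr fine; exact: probability_setT.
Qed.

Lemma meanD p f g : bnd f -> bnd g ->
  mean p (fun x => f x + g x) = mean p f + mean p g.
Proof. by move=> hf hg; rewrite /mean RintegralD //; apply: bnd_integrable. Qed.

Lemma meanZ p c f : bnd f -> mean p (fun x => c * f x) = c * mean p f.
Proof. by move=> hf; rewrite /mean RintegralZl //; apply: bnd_integrable. Qed.

Lemma mean_le_integrable p f g : bnd f -> p.-integrable setT (EFin \o g) ->
  (forall x, f x <= g x) -> mean p f <= mean p g.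
Proof.
by move=> hf hg fg; apply: le_Rintegral => // ; apply: bnd_integrable.
Qed.

Lemma mean_le p f g : bnd f -> bnd g -> (forall x, f x <= g x) ->
  mean p f <= mean p g.
Proof. by move=> hf hg fg; apply: mean_le_integrable => //; apply: bnd_integrable. Qed.

Lemma mean_ge0 p f : (forall x, 0 <= f x) -> 0 <= mean p f.
Proof. by move=> f0; apply: Rintegral_ge0. Qed.

Lemma mean_le_cst p f c : bnd f -> (forall x, f x <= c) -> mean p f <= c.
Proof.
move=> hf fc; rewrite -[leRHS](mean_cst p); apply: mean_le => //.
exact: bnd_cst.
Qed.

Lemma mean_sum p (I : Type) (r : seq I) (F : I -> lattice d -> R) :
  (forall i, bnd (F i)) ->
  mean p (fun x => \sum_(i <- r) F i x) = \sum_(i <- r) mean p (F i).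
Proof.
move=> hF; elim: r => [|i r IH].
  rewrite big_nil -[RHS](mean_cst p); congr mean; apply/funext => x.
  by rewrite big_nil.
rewrite big_cons -IH -meanD //; last exact: bnd_sum.
by congr mean; apply/funext => x; rewrite big_cons.
Qed.

Lemma mean_ge_atom p f z : bnd f -> (forall x, 0 <= f x) ->
  fine (p [set z]) * f z <= mean p f.
Proof.
move=> hf f0.
have e : mean p (fun x => (x == z)%:R) = fine (p [set z]).
  rewrite /mean /Rintegral -(setIT [set z]) -integral_indic //.
  congr fine; apply: eq_integral => x _; rewrite indicE; congr ((nat_of_bool _)%:R%:E).
  apply/idP/idP => [/eqP ->|/set_mem ->]; last exact: eqxx.
  exact: mem_set.
rewrite -e mulrC -meanZ; last exact: bnd_bool.
apply: mean_le => //; first by apply/bndZ/bnd_bool.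
by move=> x; case: eqP => [->|_]; rewrite ?mulr1 ?mulr0.
Qed.

Definition step p f : lattice d -> R := fun y => mean p (fun x => f (y - x)).

Lemma bnd_step p f : bnd f -> bnd (step p f).
Proof.
move=> [C hC]; exists C => y.
have hb : bnd (fun x => f (y - x)) by exists C.
rewrite ler_norml; apply/andP; split; last first.
  by apply: mean_le_cst => // x; apply: le_trans (ler_norm _) (hC _).
rewrite -[leLHS](mean_cst p); apply: mean_le => //; first exact: bnd_cst.
by move=> x; rewrite lerNl; apply: le_trans (ler_norm _) _; rewrite normrN.
Qed.

Lemma bnd_iter p n f : bnd f -> bnd (iter n (step p) f).
Proof. by move=> hf; elim: n => [//|n IH]; apply: bnd_step. Qed.

Lemma step_shift p f z y : step p (fun x => f (x + z)) y = step p f (y + z).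
Proof. by rewrite /step; congr mean; apply/funext => x; rewrite addrAC. Qed.

Lemma iter_step_shift p n f z :
  iter n (step p) (fun x => f (x + z)) = fun y => iter n (step p) f (y + z).
Proof.
elim: n => [//|n IH] /=; rewrite IH; apply/funext => y.
exact: step_shift.
Qed.

Lemma iter_stepD p n f g : bnd f -> bnd g ->
  iter n (step p) (fun x => f x + g x) =
  fun y => iter n (step p) f y + iter n (step p) g y.
Proof.
move=> hf hg; elim: n => [//|n IH] /=; rewrite IH; apply/funext => y.
by rewrite /step meanD //; apply: bnd_comp; apply: bnd_iter.
Qed.

Lemma iter_stepZ p n c f : bnd f ->
  iter n (step p) (fun x => c * f x) = fun y => c * iter n (step p) f y.
Proof.
move=> hf; elim: n => [//|n IH] /=; rewrite IH; apply/funext => y.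
by rewrite /step meanZ //; apply: bnd_comp; apply: bnd_iter.
Qed.

Lemma iter_step_cst p n c : iter n (step p) (fun=> c) = fun=> c.
Proof.
elim: n => [//|n IH] /=; rewrite IH; apply/funext => y.
by rewrite /step mean_cst.
Qed.

Lemma iter_step_sum p n (I : Type) (r : seq I) (F : I -> lattice d -> R) :
  (forall i, bnd (F i)) ->
  iter n (step p) (fun x => \sum_(i <- r) F i x) =
  fun y => \sum_(i <- r) iter n (step p) (F i) y.
Proof.
move=> hF; elim: n => [//|n IH] /=; rewrite IH; apply/funext => y.
by rewrite /step mean_sum // => i; apply: bnd_comp; apply: bnd_iter.
Qed.

Lemma iter_step_le p n f g : bnd f -> bnd g -> (forall x, f x <= g x) ->
  forall y, iter n (step p) f y <= iter n (step p) g y.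
Proof.
move=> hf hg fg; elim: n => [//|n IH] y /=; rewrite /step.
by apply: mean_le => //; apply: bnd_comp; apply: bnd_iter.
Qed.

Lemma iter_step_ge0 p n f : (forall x, 0 <= f x) -> forall y, 0 <= iter n (step p) f y.
Proof. by move=> f0; elim: n => [//|n IH] y /=; apply: mean_ge0. Qed.

Lemma iter_step_le_cst p n f c : bnd f -> (forall x, f x <= c) ->
  forall y, iter n (step p) f y <= c.
Proof.
move=> hf fc y; have := iter_step_le p n hf (bnd_cst _ c) fc y.
by rewrite iter_step_cst.
Qed.

Definition pt0 : lattice d -> R := fun x => (x == 0)%:R.

(** Since [step] evaluates at y - x, the value at y is the probability of going from 0 to y in n
    steps. *)
Definition heat p n : lattice d -> R := iter n (step p) pt0.

Lemma heat0 p x : heat p 0 x = (x == 0)%:R.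
Proof. by []. Qed.

Lemma bnd_pt0 : bnd pt0. Proof. exact: bnd_bool. Qed.

Lemma heat_ge0 p n x : 0 <= heat p n x.
Proof. exact: iter_step_ge0. Qed.

Lemma bnd_heat p n : bnd (heat p n).
Proof. exact/bnd_iter/bnd_pt0. Qed.

Lemma heatS p n x : heat p n.+1 x = mean p (fun z => heat p n (x - z)).
Proof. by []. Qed.

(** Point masses at the y - z, weighted by h (y - z), add up to at most h; monotonicity and
    linearity of [step] do the rest. This stands in for an infinite convolution sum. *)
Lemma iter_ge_atoms p n h (r : seq (lattice d)) y : uniq r -> bnd h ->
  (forall x, 0 <= h x) ->
  \sum_(z <- r) heat p n z * h (y - z) <= iter n (step p) h y.
Proof.
move=> ur hh h0.
have hb z : bnd (fun x => h (y - z) * pt0 (x + (z - y))).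
  by apply: bndZ; apply: bnd_comp; apply: bnd_pt0.
have -> : \sum_(z <- r) heat p n z * h (y - z) =
    iter n (step p) (fun x => \sum_(z <- r) h (y - z) * pt0 (x + (z - y))) y.
  rewrite iter_step_sum //; apply: eq_bigr => z _.
  rewrite iter_stepZ; last by apply: bnd_comp; apply: bnd_pt0.
  by rewrite mulrC iter_step_shift addrCA subrr addr0.
apply: iter_step_le => //; first exact: bnd_sum.
move=> x; case: (boolP (y - x \in r)) => hx; last first.
  rewrite big_seq big1 // => z zr.
  rewrite /pt0 (_ : (_ == _) = false) ?mulr0 //.
  apply/negbTE; apply: contra hx; rewrite addrA subr_eq0 => /eqP <-.
  by rewrite addrAC subrr add0r.
rewrite (bigD1_seq (y - x)) //= big1 ?addr0; last first.
  move=> z zx; rewrite /pt0 (_ : (_ == _) = false) ?mulr0 //.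
  apply/negbTE; apply: contra zx; rewrite addrA subr_eq0 => /eqP <-.
  by rewrite addrAC subrr add0r.
by rewrite /pt0 subKr (addrAC y) subrr sub0r subrr eqxx mulr1.
Qed.

Lemma heat_mul p n k x y : heat p n x * heat p k y <= heat p (n + k) (x + y).
Proof.
rewrite /heat iterD -/(heat p k) -/(heat p n).
have := @iter_ge_atoms p n (heat p k) [:: x] (x + y) isT (bnd_heat p k) (heat_ge0 p k).
by rewrite big_seq1 addrAC subrr add0r.
Qed.

Lemma heat_gt0D p n k x y :
  0 < heat p n x -> 0 < heat p k y -> 0 < heat p (n + k) (x + y).
Proof. by move=> a b; apply: lt_le_trans (heat_mul p n k x y); apply: mulr_gt0. Qed.

Lemma heat00 p : 0 < heat p 0 0.
Proof. by rewrite /heat /= /pt0 eqxx. Qed.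

Lemma heat_gt0Mn p n x j : 0 < heat p n x -> 0 < heat p (n * j) (x *+ j).
Proof.
move=> h; elim: j => [|j IH]; first by rewrite muln0 mulr0n heat00.
by rewrite mulnS mulrS; apply: heat_gt0D.
Qed.

Lemma iter_kernel_ge0 p n x y : (0 <= iter_kernel (walk_kernel p) n x y)%E.
Proof.
elim: n x => [|n IH] x /=; first by rewrite lee_fin.
by apply: esum_ge0 => z _; apply: mule_ge0.
Qed.

Lemma heat_gt0_kernel p n x y :
  (0 < iter_kernel (walk_kernel p) n x y)%E -> 0 < heat p n (y - x).
Proof.
elim: n x => [|n IH] x /=.
  rewrite lte_fin /heat /= /pt0 subr_eq0 (eq_sym y).
  by case: (x == y).
have [[z hz]|hno] := pselect (exists z,
    (0 < walk_kernel p x z * iter_kernel (walk_kernel p) n z y)%E); last first.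
  rewrite esum1 ?ltxx // => z _; apply/eqP; rewrite eq_le; apply/andP; split.
    by rewrite leNgt; apply/negP => h; apply: hno; exists z.
  by apply: mule_ge0 => //; exact: iter_kernel_ge0.
move=> _.
have k0 : (0 <= walk_kernel p x z)%E by [].
have i0 := iter_kernel_ge0 p n z y.
have kz : (0 < walk_kernel p x z)%E.
  by rewrite lt_def k0 andbT; apply/eqP => e; move: hz; rewrite e mul0e ltxx.
have iz : (0 < iter_kernel (walk_kernel p) n z y)%E.
  by rewrite lt_def i0 andbT; apply/eqP => e; move: hz; rewrite e mule0 ltxx.
have hb : bnd (fun w => heat p n (y - x - w)) by apply: bnd_comp; apply: bnd_heat.
apply: lt_le_trans (mean_ge_atom p (z - x) hb (fun w => heat_ge0 p n _)).
apply: mulr_gt0; last first.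
  by rewrite opprB addrA subrK; exact: IH.
apply: fine_gt0; rewrite kz /=.
by apply: le_lt_trans (probability_le1 p _) _; rewrite ?ltry.
Qed.

Lemma heat_reach p v : irreducible_chain (walk_kernel p) -> exists n, 0 < heat p n v.
Proof. by move=> h; have [n /heat_gt0_kernel] := h 0 v; rewrite subr0; exists n. Qed.

Definition axis (i : 'I_d) : lattice d := delta_mx ord0 i.

Definition corner (a b : 'I_d -> nat) (e : {ffun 'I_d -> bool}) : lattice d :=
  \sum_(i < d) (if e i then axis i *+ a i else (- axis i) *+ b i).

Lemma corner_coord a b e (j : 'I_d) :
  (corner a b e : 'rV[int]_d) ord0 j = if e j then (a j)%:Z else - (b j)%:Z.
Proof.
rewrite /corner summxE (bigD1 j) //= big1 ?addr0; last first.
  move=> i ij; case: (e i); rewrite mulmxnE ?mxE ?eqxx /= eq_sym (negbTE ij).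
    by rewrite mul0rn.
  by rewrite oppr0 mul0rn.
rewrite /axis; case: (e j); first by rewrite mulmxnE mxE !eqxx mulr1n natz.
by rewrite mulmxnE mxE mxE !eqxx mulr1n mulNrn natz.
Qed.

Lemma corner_inj a b : (forall i, (0 < a i)%N) -> (forall i, (0 < b i)%N) ->
  injective (corner a b).
Proof.
move=> a0 b0 e e' h; apply/ffunP => j.
have := corner_coord a b e j; rewrite h corner_coord.
by have := a0 j; have := b0 j; case: (e j); case: (e' j) => //; lia.
Qed.

(* Both [axis i *+ a i] and [- axis i *+ b i] are reached after [a i * b i]-like
   numbers of steps, so no aperiodicity is needed. *)
Lemma corners_reached p : irreducible_chain (walk_kernel p) ->
  exists a b k, [/\ forall i, (0 < a i)%N, forall i, (0 < b i)%N,
    (0 < d)%N -> (0 < k)%N &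
    forall e, 0 < heat p k (corner a b e)].
Proof.
move=> irr.
have r1 i : exists n, 0 < heat p n (axis i) := heat_reach (axis i) irr.
have r2 i : exists n, 0 < heat p n (- axis i) := heat_reach (- axis i) irr.
have [N hN] := choice r1; have [M hM] := choice r2.
have axis0 i : axis i != 0.
  by apply/eqP => /matrixP /(_ ord0 i); rewrite !mxE !eqxx.
have N0 i : (0 < N i)%N.
  by have := hN i; case: (N i) => // ; rewrite /heat /= /pt0 (negbTE (axis0 i)) ltxx.
have M0 i : (0 < M i)%N.
  have := hM i; case: (M i) => //.
  by rewrite /heat /= /pt0 oppr_eq0 (negbTE (axis0 i)) ltxx.
exists M, N, (\sum_(i < d) N i * M i)%N; split => //.
  move=> d0; rewrite (bigD1 (Ordinal d0)) //= addn_gt0.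
  by rewrite muln_gt0 N0 M0.
move=> e.
rewrite /corner; apply: (big_ind2 (fun n v => 0 < heat p n v)).
- exact: heat00.
- by move=> n v n' v'; apply: heat_gt0D.
- move=> i _; case: (e i); first exact: heat_gt0Mn.
  by rewrite mulnC; apply: heat_gt0Mn.
Qed.

(* The uniform law on the corners of a box; it commutes with [step p] and its
   iterates are products of binomial laws. *)
Definition spread a b h : lattice d -> R := fun x =>
  2 ^- d * \sum_(e : {ffun 'I_d -> bool}) h (x - corner a b e).

Lemma bnd_spread a b h : bnd h -> bnd (spread a b h).
Proof. by move=> hh; apply: bndZ; apply: bnd_sum => e; apply: bnd_comp. Qed.

Lemma bnd_iter_spread a b j h : bnd h -> bnd (iter j (spread a b) h).
Proof. by move=> hh; elim: j => [//|j IH]; apply: bnd_spread. Qed.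

Lemma spread_iter_step p a b n h : bnd h ->
  spread a b (iter n (step p) h) = iter n (step p) (spread a b h).
Proof.
move=> hh; rewrite /spread iter_stepZ; last by apply: bnd_sum => e; apply: bnd_comp.
apply/funext => x; congr (_ * _).
rewrite iter_step_sum; last by move=> e; apply: bnd_comp.
by apply: eq_bigr => e _; rewrite iter_step_shift.
Qed.

Lemma iter_spread_iter_step p a b j n h : bnd h ->
  iter j (spread a b) (iter n (step p) h) = iter n (step p) (iter j (spread a b) h).
Proof.
move=> hh; elim: j => [//|j IH] /=; rewrite IH spread_iter_step //.
exact: bnd_iter_spread.
Qed.

Lemma iter_spread_pt0 a b j x : (forall i, (0 < a i)%N) -> (forall i, (0 < b i)%N) ->
  iter j (spread a b) pt0 x <= 2 ^+ d * rsq j ^+ d.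
Proof.
move=> a0 b0.
(* Probability that coordinate i of the j-step corner walk equals [u]. Adding j * b i turns the
   steps -b i and a i into 0 and a i + b i, hence into exponents of a polynomial. *)
pose cf i j (u : int) : R :=
  if u + (j * b i)%:Z is Posz k then ((2^-1 *: (1 + 'X^(a i + b i)) : {poly R}) ^+ j)`_k else 0.
have cfS i l u : cf i l.+1 u = 2^-1 * (cf i l (u - (a i)%:Z) + cf i l (u + (b i)%:Z)).
  rewrite /cf.
  have -> : u + (b i)%:Z + (l * b i)%:Z = u + (l.+1 * b i)%:Z by rewrite mulSn PoszD addrA.
  have -> : u - (a i)%:Z + (l * b i)%:Z = u + (l.+1 * b i)%:Z - (a i + b i)%:Z.
    by rewrite mulSn !PoszD; ring.
  case: (u + (l.+1 * b i)%:Z) => k; last by rewrite NegzE -opprD -PoszD addSn -NegzE addr0 mulr0.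
  rewrite exprS -scalerAl coefZ mulrDl mul1r coefD coefXnM; congr (_ * _).
  rewrite addrC; congr (_ + _); case: ltnP => hk; last by rewrite subzn.
  have [r ->] : exists r, k%:Z - (a i + b i)%:Z = Negz r.
    by exists (a i + b i - k).-1; rewrite NegzE; lia.
  by [].
have main : forall l y, iter l (spread a b) pt0 y = \prod_(i < d) cf i l ((y : 'rV[int]_d) ord0 i).
  elim=> [|l IH] y.
    rewrite /= /pt0.
    have c0 i u : cf i 0%N u = (u == 0)%:R.
      rewrite /cf mul0n addr0; case: u => // k.
      by rewrite expr0 coef1 eqz_nat.
    under eq_bigr do rewrite c0.
    case: eqP => [->|ne].
      by rewrite big1 // => i _; rewrite mxE eqxx.
    have [i hi] : exists i, (y : 'rV[int]_d) ord0 i != 0.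
      apply/existsP; rewrite -[X in is_true X]negbK negb_exists; apply/negP => /forallP h.
      apply: ne; apply/matrixP => r i; rewrite ord1 mxE.
      by have := h i; rewrite negbK => /eqP.
    by rewrite (bigD1 i) //= (negbTE hi) mul0r.
  rewrite iterS {1}/spread.
  under [RHS]eq_bigr => i _ do rewrite cfS.
  rewrite big_split /= prodr_const card_ord exprVn; congr (_ * _).
  transitivity (\sum_(e : {ffun 'I_d -> bool}) \prod_(i < d)
     (if e i then cf i l ((y : 'rV[int]_d) ord0 i - (a i)%:Z)
      else cf i l ((y : 'rV[int]_d) ord0 i + (b i)%:Z))).
    apply: eq_bigr => e _; rewrite IH; apply: eq_bigr => i _.
    rewrite [X in cf _ _ X](_ : _ = (y : 'rV[int]_d) ord0 i - (corner a b e : 'rV[int]_d) ord0 i); last by rewrite !mxE.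
    by rewrite corner_coord; case: (e i); rewrite ?opprK.
  rewrite -(bigA_distr_bigA (fun i (t : bool) => if t then cf i l ((y : 'rV[int]_d) ord0 i - (a i)%:Z)
      else cf i l ((y : 'rV[int]_d) ord0 i + (b i)%:Z))).
  by apply: eq_bigr => i _; rewrite big_bool.
rewrite main -exprMn.
have -> : (2 * rsq j) ^+ d = \prod_(i < d) (2 * rsq j) :> R by rewrite prodr_const card_ord.
apply: ler_prod => i _; rewrite /cf; case: (_ + _) => k.
  have ab : (0 < a i + b i)%N by rewrite addn_gt0 a0.
  rewrite coef_half_le // andbT.
  have g0 : lepoly 0 (2^-1 *: (1 + 'X^(a i + b i)) : {poly R}).
    move=> u; rewrite coef0 coefZ mulr_ge0 ?invr_ge0 //.
    have /(_ u) := lepoly0D (@lepoly01 R) (@lepoly0Xn R (a i + b i)).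
    by rewrite coef0.
  by have := lepoly0Xe j g0 k; rewrite coef0.
by rewrite lexx mulr_ge0 ?rsq_ge0.
Qed.

(** The constant depends only on [p], while the initial function may be [heat p' i] for any law
    [p'], because [spread] commutes with every [step]. This lets the jumps of the tree walk smooth
    the Green function of [eta]. *)
Lemma heat_kernel_bound p : (0 < d)%N -> irreducible_chain (walk_kernel p) ->
  exists2 C, 0 < C & forall p' n i x,
    iter n (step p) (heat p' i) x <= C * rsq n ^+ d.
Proof.
move=> d0 /corners_reached[a [b [k [a0 b0 kp hk]]]].
pose c : R := Num.min 1 (2 ^+ d * \big[Num.min/1]_(e : {ffun 'I_d -> bool}) heat p k (corner a b e)).
have m0 : 0 < \big[Num.min/1]_(e : {ffun 'I_d -> bool}) heat p k (corner a b e).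
  by apply: lt_bigmin.
have c0 : 0 < c <= 1 by rewrite /c lt_min ltr01 mulr_gt0 ?exprn_gt0 //= ge_min lexx.
have hc e : 2 ^- d * c <= heat p k (corner a b e).
  rewrite ler_pdivrMl ?exprn_gt0 //; apply: (@le_trans _ _ (2 ^+ d * \big[Num.min/1]_(e : {ffun 'I_d -> bool}) heat p k (corner a b e))).
    by rewrite /c ge_min lexx orbT.
  by rewrite ler_wpM2l ?exprn_ge0 //; apply: bigmin_le_cond.
have minor h : bnd h -> (forall x, 0 <= h x) -> forall y,
    c * spread a b h y <= iter k (step p) h y.
  move=> hh h0 y.
  have ue : uniq [seq corner a b e | e <- enum {: {ffun 'I_d -> bool}}].
    by rewrite map_inj_uniq ?enum_uniq //; apply: corner_inj.
  apply: le_trans (iter_ge_atoms p k y ue hh h0).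
  rewrite /spread big_map [leRHS]big_enum /= mulrA mulr_sumr.
  apply: ler_sum => e _; apply: ler_wpM2r => //.
  by rewrite mulrC.
pose C0 : R := 2 ^+ d.
have k1 := kp d0.
exists (C0 * Num.sqrt (2 * d%:R / c) ^+ d * Num.sqrt k.+1%:R ^+ d).
  have c1 : 0 < c by case/andP: c0.
  by rewrite !mulr_gt0 ?exprn_gt0 ?sqrtr_gt0 ?divr_gt0 ?mulr_gt0 ?ltr0n.
move=> p' n i x.
pose g := heat p' i.
have hg : bnd g by apply: bnd_heat.
have Sg j y : iter j (spread a b) g y <= C0 * rsq j ^+ d.
  rewrite /g /heat iter_spread_iter_step; last exact: bnd_pt0.
  apply: iter_step_le_cst; first by apply: bnd_iter_spread; apply: bnd_pt0.
  by move=> z; apply: iter_spread_pt0.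
have C00 : 0 <= C0 by rewrite exprn_ge0.
have main : forall m j y, iter (k * m) (step p) (iter j (spread a b) g) y <= smooth c C0 d m j.
  elim=> [|m IH] j y; first by rewrite muln0; exact: Sg.
  rewrite mulnS iterD /=.
  set f := iter (k * m) (step p) (iter j (spread a b) g).
  have hf : bnd f by apply/bnd_iter/bnd_iter_spread.
  set M := smooth c C0 d m j.
  have fM z : f z <= M by apply: IH.
  (* The domination is applied to M - f, which is nonnegative: a lower bound for its average is an
     upper bound for the average of f. *)
  have h1 := minor (fun z => M - f z) (bndB (bnd_cst _ M) hf).
  have h2 : forall z, 0 <= M - f z by move=> z; rewrite subr_ge0.
  have h3 := h1 h2 y.
  have e1 : iter k (step p) f y + iter k (step p) (fun z => M - f z) y = M.
    have := congr1 (fun F => F y) (iter_stepD p k hf (bndB (bnd_cst _ M) hf)).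
    move=> /= <-; rewrite (_ : (fun x0 => _) = fun=> M) ?iter_step_cst //.
    by apply/funext => z; rewrite addrC subrK.
  have e2 : spread a b (fun z => M - f z) y = M - spread a b f y.
    rewrite /spread sumrB mulrBr; congr (_ - _).
    have t0 : 2 ^+ d != 0 :> R by rewrite expf_neq0 // pnatr_eq0.
    rewrite sumr_const card_ffun card_bool card_ord -[M *+ _]mulr_natl natrX.
    by rewrite mulrA mulVf // mul1r.
  have e3 : spread a b f y <= smooth c C0 d m j.+1.
    by rewrite /f spread_iter_step; [exact: (IH j.+1 y)|apply: bnd_iter_spread].
  have e4 : c * spread a b f y <= c * smooth c C0 d m j.+1.
    by rewrite ler_wpM2l //; case/andP: c0 => /ltW.
  rewrite e2 in h3; rewrite -/M; move: e1 h3 e4.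
  move: (iter k _ _ _) (iter k _ _ _) (spread _ _ _ _) (smooth _ _ _ _ _) => u v w s.
  lra.
(* The n mod k leftover steps cannot raise a supremum. *)
rewrite (divn_eq n k) addnC iterD.
apply: iter_step_le_cst; first exact: bnd_iter.
move=> y; rewrite mulnC; apply: le_trans (main _ 0%N y) _.
apply: le_trans (smooth_le _ c0 d0 C00) _.
rewrite -!mulrA ler_wpM2l // ler_wpM2l ?exprn_ge0 ?sqrtr_ge0 //.
rewrite -exprMn lerXn2r ?nnegrE ?rsq_ge0 ?mulr_ge0 ?rsq_ge0 ?sqrtr_ge0 //.
rewrite -(ler_pXn2r (n := 2)) ?nnegrE ?mulr_ge0 ?rsq_ge0 ?sqrtr_ge0 //.
rewrite exprMn !rsq_sqr sqr_sqrtr // ler_pdivlMr // ler_pdivrMl // -natrM ler_nat.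
have hm : (n %% k < k)%N by rewrite ltn_mod.
move: hm; move: (n %% k)%N (n %/ k)%N => u v; clear; nia.
Qed.

End LatticeMeans.

Arguments heat : simpl never.

(** * Escape probabilities and capacity *)

Section EscapeProbabilities.
Context {R : realType} {d : nat} (p : probability (lattice d) R).
Implicit Types (A : seq (lattice d)) (x y z : lattice d) (L n K : nat).
Local Notation heat := (heat p).
Local Notation mean := (mean p).

(* The probability that the walk from [x] avoids [A] at the times 1, ..., [L]. *)
Fixpoint esc A L x : R :=
  if L is K.+1 then mean (fun z => (x + z \notin A)%:R * esc A K (x + z)) else 1.

Lemma esc01 A L x : 0 <= esc A L x <= 1.
Proof.
elim: L x => [|L IH] x /=; first by rewrite ler01 lexx.
have h z : 0 <= (x + z \notin A)%:R * esc A L (x + z) <= 1.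
  have /andP[a b] := IH (x + z); rewrite mulr_ge0 //=.
  by case: (_ \notin _); rewrite ?mul1r ?mul0r.
apply/andP; split; first by apply: mean_ge0 => z; case/andP: (h z).
by apply: mean_le_cst => [|z]; [apply: bnd01|case/andP: (h z)].
Qed.

Lemma bnd_esc A L : bnd (esc A L).
Proof. by apply: bnd01 => x; exact: esc01. Qed.

Lemma esc_ge0 A L x : 0 <= esc A L x.
Proof. by case/andP: (esc01 A L x). Qed.

Lemma escS A L x : esc A L.+1 x <= esc A L x.
Proof.
have hb M y : bnd (fun z => (y + z \notin A)%:R * esc A M (y + z)).
  apply: bndM; first exact: bnd_bool.
  by apply: (bnd_comp (fun z => y + z)); apply: bnd_esc.
elim: L x => [|L IH] x; first by case/andP: (esc01 A 1 x).
rewrite -[leLHS]/(mean (fun z => (x + z \notin A)%:R * esc A L.+1 (x + z))).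
rewrite -[leRHS]/(mean (fun z => (x + z \notin A)%:R * esc A L (x + z))).
apply: mean_le => // z.
by apply: ler_wpM2l.
Qed.

Lemma le_esc A K L x : (K <= L)%N -> esc A L x <= esc A K x.
Proof.
move=> h; rewrite -(subnK h); elim: (L - K)%N => [//|i IH].
by rewrite addSn; apply: le_trans (escS _ _ _) IH.
Qed.

Definition last_exit A L x : R :=
  \sum_(n < L.+1) \sum_(y <- A) heat n (y - x) * esc A (L - n) y.

(** Decomposition at the last visit to [A] up to time [L]; the second term is the probability of no
    visit at the times 0, ..., L. The induction conditions on the first step. *)
Lemma last_exit_total A L x : uniq A ->
  last_exit A L x + (x \notin A)%:R * esc A L x = 1.
Proof.
move=> uA.
have start M y : \sum_(z <- A) heat 0 (z - y) * esc A M z = (y \in A)%:R * esc A M y.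
  case: (boolP (y \in A)) => hy.
    rewrite (bigD1_seq y) //= heat0 subrr eqxx big1 ?addr0 // => z zy.
    by rewrite heat0 subr_eq0 (negbTE zy) mul0r.
  rewrite mul0r big_seq big1 // => z zA; rewrite heat0 subr_eq0.
  by rewrite (_ : (z == y) = false) ?mul0r //; apply: contraNF hy => /eqP <-.
have split01 M y : (y \in A)%:R * esc A M y + (y \notin A)%:R * esc A M y = esc A M y.
  by case: (y \in A); rewrite /= mul1r mul0r ?addr0 ?add0r.
elim: L x => [|L IH] x.
  by rewrite /last_exit big_ord1 start split01.
rewrite /last_exit big_ord_recl start addrAC split01 /=.
have hb (n : nat) M : bnd (fun z => \sum_(y <- A) heat n (y - (x + z)) * esc A M y).
  apply: bnd_sum => y; apply: bndM; last exact: bnd_cst.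
  by apply: (bnd_comp (fun z => y - (x + z))); apply: bnd_heat.
have hb2 : bnd (fun z => (x + z \notin A)%:R * esc A L (x + z)).
  apply: bndM; first exact: bnd_bool.
  by apply: (bnd_comp (fun z => x + z)); apply: bnd_esc.
have -> : \sum_(i < L.+1) \sum_(y <- A) heat (bump 0 i) (y - x) * esc A (L.+1 - bump 0 i) y =
    mean (fun z => last_exit A L (x + z)).
  rewrite /last_exit mean_sum; last by move=> i; apply: hb.
  apply: eq_bigr => i _; rewrite mean_sum; last first.
    move=> y; apply: bndM; last exact: bnd_cst.
    by apply: (bnd_comp (fun z => y - (x + z))); apply: bnd_heat.
  apply: eq_bigr => y _; rewrite /bump leq0n add1n subSS heatS mulrC -meanZ.
    by congr mean; apply/funext => z; rewrite opprD addrA mulrC.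
  by apply: (bnd_comp (fun z => y - x - z)); apply: bnd_heat.
rewrite -meanD //; last by apply: bnd_sum => i; apply: hb.
rewrite -[RHS](mean_cst p); congr mean; apply/funext => z.
by rewrite addrC IH.
Qed.

Lemma last_exit_le1 A L x : uniq A -> last_exit A L x <= 1.
Proof.
move=> uA; rewrite -(last_exit_total L x uA) lerDl mulr_ge0 //.
exact: esc_ge0.
Qed.

Lemma last_exit_in A L x : uniq A -> x \in A -> last_exit A L x = 1.
Proof. by move=> uA xA; rewrite -(last_exit_total L x uA) xA mul0r addr0. Qed.

(** Potential of a list, not of a set: several vertices of a tree may share a position. The Green
    function is cut at time [n]. *)
Definition potential (vs : seq (lattice d)) n y : R :=
  \sum_(v <- vs) \sum_(j < n) heat j (y - v).

Lemma potential_ge0 vs n y : 0 <= potential vs n y.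
Proof. by apply: sumr_ge0 => v _; apply: sumr_ge0 => j _; exact: heat_ge0. Qed.

Lemma bnd_potential vs n : bnd (potential vs n).
Proof.
apply: bnd_sum => v; apply: bnd_sum => j.
by apply: (bnd_comp (fun y => y - v)); apply: bnd_heat.
Qed.

Lemma potentialS vs n y :
  potential vs n.+1 y = (count_mem y vs)%:R + mean (fun z => potential vs n (y - z)).
Proof.
have -> : mean (fun z => potential vs n (y - z)) =
    \sum_(v <- vs) \sum_(j < n) heat j.+1 (y - v).
  rewrite /potential mean_sum; last first.
    move=> v; apply: bnd_sum => j.
    by apply: (bnd_comp (fun z => y - z - v)); apply: bnd_heat.
  apply: eq_bigr => v _; rewrite mean_sum; last first.
    by move=> j; apply: (bnd_comp (fun z => y - z - v)); apply: bnd_heat.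
  apply: eq_bigr => j _; rewrite heatS; congr mean; apply/funext => z.
  by rewrite addrAC.
rewrite -sum1_count natr_sum big_mkcond /= -big_split /=; apply: eq_bigr => v _.
rewrite big_ord_recl; congr (_ + _).
rewrite heat0 subr_eq0 eq_sym.
by case: eqP.
Qed.

Lemma potential_mono vs n n' y : (n <= n')%N -> potential vs n y <= potential vs n' y.
Proof.
move=> h; apply: ler_sum => v _; rewrite (big_ord_widen n' (fun j => heat j (y - v))) //.
rewrite big_mkcond; apply: ler_sum => j _; case: ifP => // _; exact: heat_ge0.
Qed.

(** Maximum principle by induction on the horizon: off [vs] the potential is an average of the one
    with a step less, and on [vs] it is bounded by hypothesis. *)
Lemma potential_max vs n b : 0 <= b ->
  (forall v, v \in vs -> potential vs n v <= b) -> forall y, potential vs n y <= b.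
Proof.
move=> b0 hv.
suff h : forall m, (m <= n)%N -> forall y, potential vs m y <= b by apply: h.
elim=> [|m IH] hm y.
  by rewrite /potential big1 // => v _; rewrite big_ord0.
case: (boolP (y \in vs)) => hy.
  by apply: le_trans (hv y hy); apply: potential_mono.
rewrite potentialS (count_memPn hy) add0r; apply: mean_le_cst.
  by apply: (bnd_comp (fun z => y - z)); apply: bnd_potential.
by move=> z; apply: IH; apply: ltnW.
Qed.

(* By Markov's inequality half of the points have potential at most [2 * M / n];
   by the maximum principle so has every point of [A], and integrating against
   the escape probabilities gives the bound. *)
Lemma capacity_lower (C : R) A (vs : seq (lattice d)) (E M : R) :
  (2 < d)%N -> uniq A -> {subset vs <= A} -> (0 < size vs)%N ->
  (forall n x, heat n x <= C * rsq n ^+ d) -> 0 < M ->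
  (forall n, \sum_(u <- vs) potential vs n u <= M) ->
  (forall eps, 0 < eps -> exists K0, forall K, (K0 <= K)%N ->
     \sum_(y <- A) esc A K y <= E + eps) ->
  (size vs)%:R ^+ 2 <= 4 * M * E.
Proof.
move=> d2 uA vA n0 hC M0 hM hE.
set n := size vs in n0 *; have n0' : 0 < n%:R :> R by rewrite ltr0n.
have C0 : 0 <= C.
  have := le_trans (heat_ge0 p 0 0) (hC 0%N 0).
  by rewrite pmulr_lge0 // exprn_gt0 // rsq_gt0.
have main K : n%:R / 2 <= 2 * M / n%:R * \sum_(y <- A) esc A K y
     + n%:R * ((size A)%:R * (C * rsq K)).
  pose b := 2 * M / n%:R.
  have b0 : 0 < b by rewrite divr_gt0 // mulr_gt0.
  pose W := [seq v <- vs | potential vs K.+1 v <= b].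
  have sW : n%:R / 2 <= (size W)%:R :> R.
    have h1 : (n%:R - (size W)%:R) * b <= M.
      apply: le_trans (hM K.+1).
      have -> : n%:R - (size W)%:R = \sum_(v <- vs) (~~ (potential vs K.+1 v <= b))%:R :> R.
        rewrite /n -(count_predC (fun v => potential vs K.+1 v <= b) vs).
        rewrite natrD /W size_filter addrAC subrr add0r -sum1_count natr_sum big_mkcond.
        by apply: eq_bigr => v _ /=; case: (_ <= b).
      rewrite mulr_suml; apply: ler_sum => v _; case: (leP (potential vs K.+1 v) b) => h /=.
        by rewrite mul0r potential_ge0.
      by rewrite mul1r ltW.
    move: h1; rewrite /b mulrA ler_pdivrMr // => h1.
    rewrite ler_pdivrMr //; rewrite -(ler_pM2l M0); lra.
  have WP y : potential W K.+1 y <= b.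
    apply: potential_max; first exact: ltW.
    move=> v; rewrite mem_filter => /andP[hv _]; apply: le_trans hv.
    rewrite /potential big_filter big_mkcond /=; apply: ler_sum => u _.
    by case: ifP => // _; apply: sumr_ge0 => j _; exact: heat_ge0.
  have one v : v \in A -> 1 <= \sum_(y <- A) (\sum_(j < K.+1) heat j (y - v)) * esc A K y
      + (size A)%:R * (C * rsq K).
    (* With horizon K + K, visits up to time K still have at least K steps left to escape. The K
       later times cost at most C times the cube of [rsq K] per point, in total O([rsq K]). *)
    move=> vinA; rewrite -[leLHS](last_exit_in (K + K) uA vinA) /last_exit.
    rewrite -addSn big_split_ord /=; apply: lerD.
      under [leRHS]eq_bigr do rewrite mulr_suml.
      rewrite exchange_big /=; apply: ler_sum => y _; apply: ler_sum => j _.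
      apply: ler_wpM2l; first exact: heat_ge0.
      by apply: le_esc; rewrite -addnBA ?leq_addr // -ltnS.
    apply: (@le_trans _ _ (\sum_(j < K) \sum_(y <- A) C * rsq K ^+ 3)).
      apply: ler_sum => j _; apply: ler_sum => y _.
      have /andP[e0 e1] := esc01 A (K + K - (K.+1 + j)) y.
      apply: (@le_trans _ _ (C * rsq (K.+1 + j) ^+ d * 1)).
        by apply: ler_pM => //; exact: heat_ge0.
      rewrite mulr1; apply: ler_wpM2l => //.
      apply: (@le_trans _ _ (rsq (K.+1 + j) ^+ 3)).
        by apply: ler_wiXn2l; rewrite ?rsq_ge0 ?rsq_le1.
      rewrite lerXn2r ?nnegrE ?rsq_ge0 // ler_rsq //.
      by rewrite addSn leqW // leq_addr.
    rewrite sumr_const card_ord big_const_seq count_predT iter_addr_0.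
    rewrite -mulrnA -[leLHS]mulr_natl natrM -mulrA ler_wpM2l // mulrCA ler_wpM2l //.
    rewrite exprSr mulrA rsq_sqr ler_piMl ?rsq_ge0 // ler_pdivrMr // mul1r ler_nat.
    exact: leqnSn.
  apply: le_trans sW _.
  have -> : (size W)%:R = \sum_(v <- W) 1 :> R.
    by rewrite big_const_seq count_predT iter_addr_0.
  apply: (@le_trans _ _ (\sum_(v <- W) (\sum_(y <- A) (\sum_(j < K.+1) heat j (y - v)) * esc A K y
      + (size A)%:R * (C * rsq K)))).
    rewrite big_seq [leRHS]big_seq; apply: ler_sum => v; rewrite mem_filter => /andP[_ hv].
    by apply: one; apply: vA.
  rewrite big_split /=; apply: lerD.
    rewrite exchange_big /= mulr_sumr; apply: ler_sum => y _.
    rewrite -mulr_suml; apply: ler_wpM2r; first exact: esc_ge0.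
    exact: WP.
  rewrite big_const_seq count_predT iter_addr_0 -[leLHS]mulr_natl.
  apply: ler_wpM2r; first by rewrite mulr_ge0 // mulr_ge0 ?rsq_ge0.
  by rewrite ler_nat size_filter count_size.
suff h : n%:R / 2 <= 2 * M / n%:R * E.
  move: h; rewrite mulrAC ler_pdivlMr //; rewrite expr2; lra.
apply/ler_addgt0Pr => eps eps0.
pose e1 := eps / 2 / (2 * M / n%:R).
have bb : 0 < 2 * M / n%:R by rewrite divr_gt0 // mulr_gt0.
have e10 : 0 < e1 by rewrite !divr_gt0 // mulr_gt0.
have [K0 hK0] := hE e1 e10.
pose c := n%:R * ((size A)%:R * C).
have c0 : 0 <= c by rewrite !mulr_ge0 // ltW.
have [K1 hK1] := natr_large ((2 * c / eps) ^+ 2).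
pose K := maxn K0 K1.
have r1 : c * rsq K <= eps / 2.
  have hK : (2 * c / eps) ^+ 2 <= K.+1%:R.
    by apply: (le_trans (hK1 K (leq_maxr _ _))); rewrite ler_nat.
  rewrite -ler_pdivlMr ?rsq_gt0 // invrK.
  have : 2 * c / eps <= Num.sqrt K.+1%:R.
    rewrite -(ler_pXn2r (n := 2)) ?nnegrE ?sqrtr_ge0 ?divr_ge0 ?mulr_ge0 // ?(ltW eps0) //.
    by rewrite sqr_sqrtr.
  rewrite ler_pdivrMr // => h; lra.
apply: le_trans (main K) _.
have h2 := hK0 K (leq_maxl _ _).
have h3 : 2 * M / n%:R * \sum_(y <- A) esc A K y <= 2 * M / n%:R * E + eps / 2.
  apply: le_trans (ler_wpM2l (ltW bb) h2) _.
  rewrite mulrDr lerD2l /e1 mulrCA mulfV ?mulr1 //; exact: lt0r_neq0.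
have h4 : n%:R * ((size A)%:R * (C * rsq K)) = c * rsq K by rewrite /c !mulrA.
rewrite h4; lra.
Qed.

End EscapeProbabilities.

(** * Second moments and the capacity of a set contained in a box *)

Section SecondMoment.
Context {R : realType} {d : nat} (p : probability (lattice d) R).
Implicit Types (f g : lattice d -> R) (x y z a : lattice d) (n : nat).

Definition itg f := p.-integrable setT (EFin \o f).

Lemma itg_bnd f : bnd f -> itg f. Proof. exact: bnd_integrable. Qed.

Lemma itgD f g : itg f -> itg g -> itg (fun x => f x + g x).
Proof. by move=> hf hg; apply: (integrableD measurableT hf hg). Qed.

Lemma itgZ (c : R) f : itg f -> itg (fun x => c * f x).
Proof. by move=> hf; apply: (integrableZl measurableT c hf). Qed.

Lemma itg_sum (I : Type) (r : seq I) (F : I -> lattice d -> R) :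
  (forall i, itg (F i)) -> itg (fun x => \sum_(i <- r) F i x).
Proof.
move=> hF; elim: r => [|i r IH].
  by apply: itg_bnd; exists 0 => x; rewrite big_nil normr0.
have -> : (fun x => \sum_(j <- i :: r) F j x) = (fun x => F i x + \sum_(j <- r) F j x).
  by apply/funext => x; rewrite big_cons.
exact: itgD.
Qed.

Lemma mean_itgD f g : itg f -> itg g ->
  mean p (fun x => f x + g x) = mean p f + mean p g.
Proof. by move=> hf hg; rewrite /mean RintegralD. Qed.

Lemma mean_itgZ (c : R) f : itg f -> mean p (fun x => c * f x) = c * mean p f.
Proof. by move=> hf; rewrite /mean RintegralZl. Qed.

Lemma mean_itg_sum (I : Type) (r : seq I) (F : I -> lattice d -> R) :
  (forall i, itg (F i)) ->
  mean p (fun x => \sum_(i <- r) F i x) = \sum_(i <- r) mean p (F i).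
Proof.
move=> hF; elim: r => [|i r IH].
  rewrite big_nil -[RHS](mean_cst p); congr mean; apply/funext => x.
  by rewrite big_nil.
rewrite big_cons -IH -mean_itgD //; last exact: itg_sum.
by congr mean; apply/funext => x; rewrite big_cons.
Qed.

Hypotheses (c_itg : forall i : 'I_d, itg (lcoord R i))
  (c2_itg : forall i : 'I_d, itg (fun x => lcoord R i x ^+ 2))
  (c_mean : forall i : 'I_d, mean p (lcoord R i) = 0).

Lemma lcoordB (i : 'I_d) x y : lcoord R i (x - y) = lcoord R i x - lcoord R i y.
Proof. by rewrite /lcoord -rmorphB /=; congr (_%:~R); rewrite !mxE. Qed.

Definition dist2 x a : R := \sum_(i < d) (lcoord R i x - lcoord R i a) ^+ 2.

Definition variance2 : R := \sum_(i < d) mean p (fun z => lcoord R i z ^+ 2).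

Lemma variance2_ge0 : 0 <= variance2.
Proof. by apply: sumr_ge0 => i _; apply: mean_ge0 => z; rewrite sqr_ge0. Qed.

(** The mean is 0, so each step adds just the variance to the quadratic bound: Chebyshev's
    inequality in operator form. *)
Lemma step_quadratic f a (al be : R) n : bnd f -> 0 <= be ->
  (forall x, f x <= al + be * dist2 x a) ->
  forall x, iter n (step p) f x <= al + be * (dist2 x a + n%:R * variance2).
Proof.
move=> hf be0 hq; elim: n => [|n IH] x; first by rewrite mul0r addr0 hq.
have quad (i : 'I_d) : itg (fun z => (lcoord R i x - lcoord R i z - lcoord R i a) ^+ 2) /\
    mean p (fun z => (lcoord R i x - lcoord R i z - lcoord R i a) ^+ 2) =
    (lcoord R i x - lcoord R i a) ^+ 2 + mean p (fun z => lcoord R i z ^+ 2).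
  set u := lcoord R i x; set v := lcoord R i a.
  have -> : (fun z => (u - lcoord R i z - v) ^+ 2) =
     (fun z => ((u - v) ^+ 2 + lcoord R i z ^+ 2) + (- 2 * (u - v)) * lcoord R i z).
    by apply/funext => z; ring.
  have h1 : itg (fun z => (u - v) ^+ 2 + lcoord R i z ^+ 2).
    by apply: itgD => //; apply/itg_bnd/bnd_cst.
  have h2 : itg (fun z => (- 2 * (u - v)) * lcoord R i z) by apply: itgZ.
  split; first exact: itgD.
  rewrite mean_itgD // mean_itgZ // c_mean mulr0 addr0.
  by rewrite mean_itgD ?mean_cst //; apply/itg_bnd/bnd_cst.
rewrite /= /step.
have hb : bnd (fun z => iter n (step p) f (x - z)).
  by apply: (bnd_comp (fun z => x - z)); apply: bnd_iter.
pose G z := \sum_(i < d) (lcoord R i x - lcoord R i z - lcoord R i a) ^+ 2.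
have hG : itg G by apply: itg_sum => i; case: (quad i).
have hG2 : itg (fun z => al + be * n%:R * variance2 + be * G z).
  by apply: itgD; [apply/itg_bnd/bnd_cst|apply: itgZ].
apply: le_trans (mean_le_integrable hb hG2 _) _.
  move=> z; apply: le_trans (IH (x - z)) _; rewrite le_eqVlt; apply/orP; left; apply/eqP.
  have -> : dist2 (x - z) a = G z by apply: eq_bigr => i _; rewrite lcoordB.
  ring.
rewrite mean_itgD; [|by apply/itg_bnd/bnd_cst|exact: itgZ].
rewrite mean_cst mean_itgZ // /G mean_itg_sum; last by move=> i; case: (quad i).
under eq_bigr => i _ do rewrite (proj2 (quad i)).
rewrite big_split /= -/(dist2 x a) -/variance2 -natr1 le_eqVlt; apply/orP; left.
by apply/eqP; ring.
Qed.

Definition box (r : nat) : seq (lattice d) :=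
  [seq (\row_i ((e i)%:Z - r%:Z) : lattice d) | e : {ffun 'I_d -> 'I_(2 * r).+1}].

Lemma size_box r : size (box r) = ((2 * r).+1 ^ d)%N.
Proof. by rewrite size_map -cardE card_ffun !card_ord. Qed.

Lemma uniq_box r : uniq (box r).
Proof.
rewrite map_inj_uniq ?enum_uniq // => e e' h; apply/ffunP => i; apply/val_inj/eqP.
move/matrixP: h => /(_ ord0 i); rewrite !mxE => /(addIr _) /eqP.
by rewrite eqz_nat.
Qed.

Lemma mem_box r x : (forall i, `|lcoord R i x| <= r%:R) -> x \in box r.
Proof.
move=> hx.
have hx' i : `|(x : 'rV[int]_d) ord0 i| <= r%:Z.
  by rewrite -(ler_int R) intr_norm; apply: hx.
have hn i : exists k : 'I_(2 * r).+1, k%:Z = (x : 'rV[int]_d) ord0 i + r%:Z.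
  have := hx' i; rewrite ler_norml => /andP[h1 h2].
  have hk : (absz (((x : 'rV[int]_d) ord0 i) + r%:Z)%R < (2 * r).+1)%N by lia.
  by exists (Ordinal hk) => /=; lia.
have [e he] := choice hn.
apply/mapP; exists [ffun i => e i]; first by rewrite mem_enum.
by apply/matrixP => u i; rewrite ord1 !mxE ffunE he addrK.
Qed.

(** Sum the last-exit decomposition over all starting points in the box of radius 2 r. Seen
    backwards from a point of [A], the walk is in that box with probability at least 1/2 at each
    time up to N, of order r^2. So (N + 1) / 2 times the escape sum is at most the number of points
    of the box, (4 r + 1)^d <= (5 r)^d. *)
Lemma capacity_upper : exists2 C : R, 0 < C &
  forall (r : nat) (A : seq (lattice d)) (E : R), (0 < r)%N -> uniq A ->
  (forall y i, y \in A -> `|lcoord R i y| <= r%:R) ->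
  (forall L, E <= \sum_(y <- A) esc p A L y) ->
  E * r%:R ^+ 2 <= C * r%:R ^+ d.
Proof.
pose V := variance2 + 1.
have V0 : 0 < V by rewrite ltr_wpDl ?variance2_ge0.
exists (4 * V * 5 ^+ d); first by rewrite !mulr_gt0 // exprn_gt0.
move=> r A E r0 uA hA hE.
have r0' : 0 < r%:R :> R by rewrite ltr0n.
pose f x : R := (x \notin box (2 * r))%:R.
have hf : bnd f by apply: bnd_bool.
pose N := Num.truncn (r%:R ^+ 2 / (2 * V)).
have r2V : 0 <= r%:R ^+ 2 / (2 * V) by rewrite divr_ge0 ?exprn_ge0 ?mulr_ge0 // ltW.
have N1 : N%:R <= r%:R ^+ 2 / (2 * V) by have := truncn_le (r%:R ^+ 2 / (2 * V)); rewrite r2V.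
have N2 : r%:R ^+ 2 / (2 * V) <= N.+1%:R by apply/ltW/truncnS_gt.
have stay n y : (n <= N)%N -> y \in A ->
    1 / 2 <= \sum_(z <- box (2 * r)) heat p n (y - z).
  move=> hn yA.
  have fq x : f x <= 0 + r%:R ^- 2 * dist2 x y.
    rewrite add0r /f; case: (boolP (x \in box (2 * r))) => hx /=.
      rewrite mulr_ge0 ?invr_ge0 ?exprn_ge0 //; apply: sumr_ge0 => i _; exact: sqr_ge0.
    have [i hi] : exists i, (2 * r)%:R < `|lcoord R i x|.
      apply: contrapT => hno; move/negP: hx; apply; apply: mem_box => i.
      by rewrite leNgt; apply/negP => h; apply: hno; exists i.
    rewrite ler_pdivlMl ?exprn_gt0 // mulr1 /dist2 (bigD1 i) //=.
    rewrite -[leLHS]addr0; apply: lerD; last by apply: sumr_ge0 => j _; exact: sqr_ge0.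
    rewrite -[leRHS]ger0_norm ?sqr_ge0 // normrX lerXn2r ?nnegrE //.
    have := hA y i yA; have := ler_distD 0 (lcoord R i x) (lcoord R i y).
    have := lerB_dist (lcoord R i x) (lcoord R i y).
    by rewrite natrM in hi; lra.
  have h1 := step_quadratic n hf _ fq y.
  have b0 : 0 <= r%:R ^- 2 :> R by rewrite invr_ge0 exprn_ge0.
  have := h1 b0; rewrite add0r (_ : dist2 y y = 0); last first.
    by rewrite /dist2 big1 // => i _; rewrite subrr expr0n.
  rewrite add0r => h2.
  have h3 : iter n (step p) f y <= 1 / 2.
    apply: le_trans h2 _; rewrite ler_pdivrMl ?exprn_gt0 //.
    apply: (@le_trans _ _ (N%:R * V)).
      by apply: ler_pM; rewrite ?variance2_ge0 ?ler_nat // lerDl.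
    move: N1; rewrite ler_pdivlMr ?mulr_gt0 //; lra.
  have h4 : \sum_(z <- box (2 * r)) heat p n (y - z) + iter n (step p) f y = 1.
    have hp z : bnd (fun x => pt0 (x - z) : R).
      by apply: (bnd_comp (fun x => x - z)); apply: bnd_pt0.
    have -> : \sum_(z <- box (2 * r)) heat p n (y - z) =
        iter n (step p) (fun x => \sum_(z <- box (2 * r)) pt0 (x - z)) y.
      by rewrite iter_step_sum //; apply: eq_bigr => z _; rewrite iter_step_shift.
    have := congr1 (fun F => F y) (iter_stepD p n (bnd_sum (box (2 * r)) hp) hf).
    move=> /= <-; rewrite (_ : (fun x => _) = fun=> 1) ?iter_step_cst //.
    apply/funext => x; rewrite /f; case: (boolP (x \in box (2 * r))) => hx.
      rewrite (bigD1_seq x) ?uniq_box //= {1}/pt0 subrr eqxx big1 ?addr0 // => z zx.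
      by rewrite /pt0 subr_eq0 eq_sym (negbTE zx).
    rewrite big_seq big1 ?add0r // => z zb; rewrite /pt0 subr_eq0.
    by rewrite (_ : (x == z) = false) //; apply: contraNF hx => /eqP ->.
  lra.
have tot : \sum_(y <- A) esc p A N y * (N.+1%:R / 2) <= (5 * r%:R) ^+ d.
  apply: (@le_trans _ _ (\sum_(z <- box (2 * r)) last_exit p A N z)).
    rewrite /last_exit exchange_big /=.
    under [leRHS]eq_bigr do rewrite exchange_big /=.
    rewrite [leRHS]exchange_big /= big_seq [leRHS]big_seq; apply: ler_sum => y yA.
    apply: (@le_trans _ _ (\sum_(n < N.+1) esc p A N y * (1 / 2))).
      rewrite sumr_const card_ord -[leRHS]mulr_natr le_eqVlt; apply/orP; left.
      by apply/eqP; ring.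
    apply: ler_sum => n _.
    apply: (@le_trans _ _ (esc p A N y * \sum_(z <- box (2 * r)) heat p n (y - z))).
      by apply: ler_wpM2l; [exact: esc_ge0|apply: stay => //; rewrite -ltnS].
    rewrite mulr_sumr; apply: ler_sum => z _; rewrite mulrC ler_wpM2l ?heat_ge0 //.
    by apply: le_esc; apply: leq_subr.
  apply: (@le_trans _ _ (\sum_(z <- box (2 * r)) 1)).
    by apply: ler_sum => z _; exact: last_exit_le1.
  rewrite big_const_seq count_predT iter_addr_0 size_box natrX.
  rewrite lerXn2r ?nnegrE ?mulr_ge0 // -natrM ler_nat; lia.
rewrite -mulr_suml in tot.
have EN := hE N.
case: (leP E 0) => E0.
  apply: (@le_trans _ _ 0); first by rewrite mulr_le0_ge0 // exprn_ge0.
  by rewrite !mulr_ge0 ?exprn_ge0 // ltW.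
have h : E * (N.+1%:R / 2) <= (5 * r%:R) ^+ d.
  by apply: le_trans tot; rewrite ler_wpM2r // divr_ge0.
rewrite exprMn in h.
have h2 : E * (r%:R ^+ 2 / (2 * V)) <= E * N.+1%:R by rewrite ler_wpM2l // ltW.
move: h2; rewrite mulrA ler_pdivrMr ?mulr_gt0 // => h2.
apply: le_trans h2 _.
have -> : 4 * V * 5 ^+ d * r%:R ^+ d = 2 * (5 ^+ d * r%:R ^+ d) * (2 * V) by ring.
rewrite ler_wpM2r ?mulr_ge0 // ?(ltW V0) //; lra.
Qed.

End SecondMoment.

(** * Conditioning on independent variables *)

Section IndependenceOverSequences.
Context {disp : measure_display} {Omega : measurableType disp} {R : realType}
  (P : probability Omega R).

Lemma indep_seq (I : choiceType) (G : I -> set (set Omega)) (s : seq I)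
    (A : I -> set Omega) :
  mutually_independent P G -> uniq s -> (forall i, i \in s -> G i (A i)) ->
  P (\bigcap_(i in [set` s]) A i) = (\prod_(i <- s) P (A i))%E.
Proof.
move=> ind us hA.
have hJ : forall i, i \in [fset x in s]%fset -> G i (A i).
  by move=> i; rewrite inE; exact: hA.
have -> : [set` s] = [set` [fset x in s]%fset].
  by apply/seteqP; split => i /=; rewrite inE.
rewrite ind //; apply: perm_big; apply: uniq_perm => //.
by move=> i; rewrite inE.
Qed.

Lemma bigcap_cons (I : choiceType) (i : I) (s : seq I) (A : I -> set Omega) :
  \bigcap_(j in [set` i :: s]) A j = A i `&` \bigcap_(j in [set` s]) A j.
Proof.
apply/seteqP; split => w /=.
  move=> h; split; first by apply: h => /=; rewrite inE eqxx.
  by move=> j /= hj; apply: h => /=; rewrite inE hj orbT.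
by move=> [hi h] j /=; rewrite inE => /orP[/eqP ->|] //; apply: h.
Qed.

Lemma measurable_bigcap_seq (I : choiceType) (s : seq I) (A : I -> set Omega) :
  (forall i, i \in s -> measurable (A i)) ->
  measurable (\bigcap_(j in [set` s]) A j).
Proof.
elim: s => [|i s IH] hA.
  by rewrite (_ : \bigcap_(_ in _) _ = setT) //; apply/seteqP; split => // w _ j.
rewrite bigcap_cons; apply: measurableI; first by apply: hA; rewrite inE eqxx.
by apply: IH => j hj; apply: hA; rewrite inE hj orbT.
Qed.

End IndependenceOverSequences.

Section LatticeConditioning.
Context {disp : measure_display} {Omega : measurableType disp} {R : realType}
  (P : probability Omega R) {d : nat}.
Implicit Types (X : {RV P >-> lattice d}) (p : probability (lattice d) R).

Lemma measurable_fiber X B : measurable (X @^-1` B).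
Proof. by rewrite -[X @^-1` _]setTI; apply: measurable_funP. Qed.

(** Disintegration over a discrete variable: the fibres of [X] are indexed by the codes of lattice
    points, and the two integrals are series compared term by term. The prefactor [c] carries the
    probability of an independent event. *)
Lemma integral_fiber (X : Omega -> lattice d) p (E : set Omega) (F : Omega -> R) (h : lattice d -> R) (c : R) :
  (forall B, measurable (X @^-1` B)) ->
  measurable E -> measurable_fun E F -> (forall w, E w -> 0 <= F w) ->
  bnd h -> (forall z, 0 <= h z) -> 0 <= c ->
  (forall z, (\int[P]_(w in E `&` X @^-1` [set z]) (F w)%:E
     = (c * (fine (p [set z]) * h z))%:E)%E) ->
  (\int[P]_(w in E) (F w)%:E = (c * mean p h)%:E)%E.
Proof.
move=> mX mE mF F0 bh h0 c0 hz.
pose FX (i : nat) := E `&` X @^-1` [set z : lattice d | choice.pickle z = i].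
pose GX (i : nat) := [set z : lattice d | choice.pickle z = i].
have mGX i : measurable (GX i) by [].
have mFX i : measurable (FX i).
  exact: measurableI.
have EE : E = \bigcup_i FX i.
  apply/seteqP; split => w; first by move=> Ew; exists (choice.pickle (X w)).
  by move=> [i _ []].
have TE : setT = \bigcup_i GX i by apply/seteqP; split => // z _; exists (choice.pickle z).
have tF : trivIset setT FX.
  by apply/trivIsetP => i j _ _ ij; apply/seteqP; split => // w [[_ /= e1] [_ /= e2]]; move/eqP: ij; rewrite -e1 -e2.
have tG : trivIset setT GX.
  by apply/trivIsetP => i j _ _ ij; apply/seteqP; split => // z [/= e1 e2]; move/eqP: ij; rewrite -e1 -e2.
have bch : bnd (fun z => c * h z) by apply: bndZ.
have -> : c * mean p h = fine (\int[p]_z (c * h z)%:E)%E.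
  by rewrite -meanZ.
rewrite fineK; last first.
  by have := integrable_fin_num measurableT (bnd_integrable p bch).
rewrite [in LHS]EE ge0_integral_bigcup //; last 2 first.
- by rewrite -EE; apply/measurable_EFinP.
- by move=> w; rewrite -EE lee_fin; exact: F0.
rewrite TE ge0_integral_bigcup //; last by move=> z _; rewrite lee_fin mulr_ge0.
apply: eq_eseriesr => i _.
have [[z ez]|no] := pselect (exists z : lattice d, choice.pickle z = i).
  have -> : GX i = [set z].
    apply/seteqP; split => u /=; last by move=> ->.
    by rewrite -ez => /(pcan_inj choice.pickleK).
  have -> : FX i = E `&` X @^-1` [set z].
    apply/seteqP; split => w; rewrite /FX /= => -[Ew]; last by move=> ->.
    by rewrite -ez => /(pcan_inj choice.pickleK).
  rewrite hz.
  rewrite (eq_integral (cst (c * h z)%:E)); last first.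
    by move=> u /set_mem ->.
  rewrite integral_cst //.
  rewrite -[X in (_ * X)%E]fineK ?fin_num_measure //.
  by rewrite -EFinM mulrCA mulrC.
have -> : GX i = set0 by apply/seteqP; split => // z hzi; apply: no; exists z.
have -> : FX i = set0 by apply/seteqP; split => // w [_ hw]; apply: no; exists (X w).
by rewrite !integral_set0.
Qed.

End LatticeConditioning.

(** * Laws of signed sums of independent edge variables *)

Section SignedSums.
Context {disp : measure_display} {Omega : measurableType disp} {R : realType}
  (P : probability Omega R) {d : nat} (I S : choiceType)
  (G : I -> set (set Omega)) (X : S -> {RV P >-> lattice d}) (iota : S -> I)
  (p : probability (lattice d) R).
Hypotheses (iota_inj : injective iota) (ind : mutually_independent P G)
  (G_meas : forall i B, G i B -> measurable B)
  (GX : forall s, G (iota s) = sigma_rv (X s))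
  (pX : forall s, distribution P (X s) =1 p)
  (p_sym : forall h : lattice d -> R, bnd h ->
     mean p (fun z => h (- z)) = mean p h).

(** A path in the tree traverses edges against their orientation on the way up; symmetry of the law
    makes the sign harmless. *)
Definition signed (b : bool) (z : lattice d) : lattice d := if b then z else - z.

Definition signed_sum (ls : seq (S * bool)) (w : Omega) : lattice d :=
  \sum_(l <- ls) signed l.2 (X l.1 w).

Lemma prob_fiber s z : P (X s @^-1` [set z]) = p [set z].
Proof. by rewrite -(pX s). Qed.

Lemma sigma_fiber s z : G (iota s) (X s @^-1` [set z]).
Proof. by rewrite GX; exists [set z] => //; rewrite setTI. Qed.

Lemma measurable_signed_sum ls : measurable_fun setT (signed_sum ls).
Proof.
elim: ls => [|l ls IH].
  rewrite (_ : signed_sum _ = cst 0) //.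
  by apply/funext => w; rewrite /signed_sum big_nil.
move=> _ B _; rewrite setTI.
have -> : signed_sum (l :: ls) @^-1` B = \bigcup_(z in [set: lattice d])
    ((X l.1 @^-1` [set z]) `&` (signed_sum ls @^-1` [set u | B (signed l.2 z + u)])).
  apply/seteqP; split => w /=.
    by move=> hw; exists (X l.1 w) => //; split => //=; move: hw; rewrite /signed_sum big_cons.
  by move=> [z _ [/= <- hB]]; rewrite /signed_sum big_cons.
apply: countable_bigcupT_measurable; first exact: countableP.
move=> z; apply: measurableI; first exact: measurable_fiber.
by rewrite -[_ @^-1` _]setTI; apply: IH.
Qed.

(** One edge variable is peeled off at a time: fixing its value adds an event to the independent
    family indexed by [J], and averaging over the value is one application of [step]. *)
Lemma integral_signed_sum ls : uniq [seq l.1 | l <- ls] ->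
  forall (J : seq I) (A : I -> set Omega) (f : lattice d -> R) (y : lattice d),
  uniq J -> (forall i, i \in J -> G i (A i)) ->
  (forall l, l \in ls -> iota l.1 \notin J) ->
  bnd f -> (forall x, 0 <= f x) ->
  (\int[P]_(w in \bigcap_(i in [set` J]) A i) (f (y - signed_sum ls w))%:E
   = (fine (\prod_(i <- J) P (A i)) * iter (size ls) (step p) f y)%:E)%E.
Proof.
elim: ls => [|[s b] ls IH] /= us J A f y uJ hA disj hf f0.
  have mE : measurable (\bigcap_(i in [set` J]) A i).
    by apply: measurable_bigcap_seq => i /hA; apply: G_meas.
  rewrite (eq_integral (cst (f y)%:E)); last first.
    by move=> w _; rewrite /signed_sum big_nil subr0.
  have -> : (\int[P]_(x in \bigcap_(i in [set` J]) A i) cst (f y)%:E x =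
      (f y)%:E * P (\bigcap_(i in [set` J]) A i))%E by rewrite integral_cst.
  have pf : (\prod_(i <- J) P (A i))%E \is a fin_num.
    by rewrite -(indep_seq ind uJ hA) fin_num_measure.
  by rewrite (indep_seq ind uJ hA) /= -[X in (_ * X)%E](fineK pf) -EFinM mulrC.
case/andP: us => sls us.
have mE : measurable (\bigcap_(i in [set` J]) A i).
  by apply: measurable_bigcap_seq => i /hA; apply: G_meas.
have prodfin : (\prod_(i <- J) P (A i))%E \is a fin_num.
  by rewrite -(indep_seq ind uJ hA) fin_num_measure.
have snJ : iota s \notin J by apply: (disj (s, b)); rewrite inE eqxx.
have -> : step p (iter (size ls) (step p) f) y =
    mean p (fun x => iter (size ls) (step p) f (y - signed b x)).
  have bs : bnd (fun x => iter (size ls) (step p) f (y - signed b x)).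
    by apply: (bnd_comp (fun x => y - signed b x)); apply: bnd_iter.
  case: b bs {disj} => // bs; rewrite -[RHS]p_sym //.
  by congr mean; apply/funext => z /=; rewrite opprK.
apply: (integral_fiber (X := X s)) => //; first exact: measurable_fiber.
- move=> _ B mB; apply: measurableI => //.
  have mD : measurable [set z : lattice d | B (f (y - z))] by [].
  have := measurable_signed_sum ((s, b) :: ls) measurableT mD.
  by rewrite setTI; apply.
- by apply: (bnd_comp (fun x => y - signed b x)); apply: bnd_iter.
- by move=> z; apply: iter_step_ge0.
- by apply: fine_ge0; rewrite -(indep_seq ind uJ hA).
move=> z.
pose A' i := if i == iota s then X s @^-1` [set z] else A i.
have A'J i : i \in J -> A' i = A i.
  by move=> iJ; rewrite /A' (_ : (i == iota s) = false) //; apply: contraNF snJ => /eqP <-.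
have -> : \bigcap_(i in [set` J]) A i `&` X s @^-1` [set z] =
    \bigcap_(i in [set` iota s :: J]) A' i.
  rewrite bigcap_cons setIC /A' eqxx; congr (_ `&` _).
  by apply: eq_bigcapr => i /= iJ; rewrite -[LHS]A'J.
rewrite (eq_integral (fun w => (f (y - signed b z - signed_sum ls w))%:E)); last first.
  move=> w /set_mem; rewrite bigcap_cons => -[]; rewrite {1}/A' eqxx => /= e _.
  by rewrite /signed_sum big_cons /= e opprD addrA.
rewrite IH //; first last.
- move=> l ll; rewrite inE negb_or; apply/andP; split; last by apply: disj; rewrite inE ll orbT.
  by rewrite (inj_eq iota_inj); apply: contraNneq sls => <-; apply: map_f.
- move=> i; rewrite inE => /orP[/eqP ->|iJ]; first by rewrite /A' eqxx; exact: sigma_fiber.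
  by rewrite A'J //; apply: hA.
- by rewrite /= snJ.
congr (_%:E); rewrite big_cons /A' eqxx prob_fiber mulrCA mulrA; congr (_ * _).
rewrite fineM //; last 2 first.
- exact: fin_num_measure.
- by rewrite (eq_big_seq (fun i => P (A i))) // => i iJ; rewrite -/(A' i) A'J.
congr (_ * fine _); apply: eq_big_seq => i iJ.
by rewrite -/(A' i) A'J.
Qed.

End SignedSums.

(** * Escape probabilities as probabilities of events of the walk *)

Section EscapeLink.
Context {disp : measure_display} {Omega : measurableType disp} {R : realType}
  (P : probability Omega R) {d : nat} (eta : probability (lattice d) R)
  (xi : nat -> {RV P >-> lattice d}).
Hypothesis hxi : iid_steps eta xi.
Implicit Types (B : seq (lattice d)) (x y z : lattice d) (L m n : nat).

(** The steps used start at index [m], so that after one step the same event reappears with m + 1;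
    this replaces the Markov property. *)
Definition avoid B L m y : set Omega :=
  [set w | forall n, (n < L)%N -> y + \sum_(i < n.+1) xi (m + i) w \notin B].

Lemma avoidS B L m y : avoid B L.+1 m y =
  [set w | y + xi m w \notin B /\ avoid B L m.+1 (y + xi m w) w].
Proof.
apply/seteqP; split => w /=.
  move=> h; split; first by have := h 0%N isT; rewrite big_ord1 addn0.
  move=> n nL; have := h n.+1 nL; rewrite big_ord_recl addn0 addrA.
  by under eq_bigr do rewrite lift0 addnS -addSn.
move=> [h0 h] [|n] nL; first by rewrite big_ord1 addn0.
rewrite big_ord_recl addn0 addrA; under eq_bigr do rewrite lift0 addnS -addSn.
exact: h.
Qed.

Lemma measurable_avoid B L m y : measurable (avoid B L m y).
Proof.
elim: L m y => [|L IH] m y.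
  by rewrite (_ : avoid _ _ _ _ = setT) //; apply/seteqP; split => // w _ n.
rewrite avoidS.
rewrite (_ : [set _ | _] = \bigcup_(z in [set: lattice d]) ((xi m @^-1` [set z]) `&`
    (if y + z \notin B then avoid B L m.+1 (y + z) else set0))); last first.
  apply/seteqP; split => w /=.
    by move=> [h1 h2]; exists (xi m w) => //; rewrite h1.
  by move=> [z _ [/= <-]]; case: ifP.
apply: countable_bigcupT_measurable; first exact: countableP.
move=> z; apply: measurableI; first exact: measurable_fiber.
by case: ifP.
Qed.

Let G (i : nat) := sigma_rv (xi i).

Let G_meas i C : G i C -> measurable C.
Proof. by move=> [D mD <-]; exact: measurable_funP. Qed.

(** Events on the steps before [m] are carried along as independent factors, since the induction
    reveals [xi m] and adds it to them. *)
Lemma prob_avoid B L : forall (m : nat) (J : seq nat) (A : nat -> set Omega) y,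
  uniq J -> (forall i, i \in J -> (i < m)%N) -> (forall i, i \in J -> G i (A i)) ->
  P (\bigcap_(i in [set` J]) A i `&` avoid B L m y) =
  (fine (\prod_(i <- J) P (A i)) * esc eta B L y)%:E.
Proof.
have [dxi ind] := hxi.
elim: L => [|L IH] m J A y uJ Jm hA;
  have mE : measurable (\bigcap_(i in [set` J]) A i)
    by apply: measurable_bigcap_seq => i /hA; apply: G_meas.
  rewrite (_ : avoid _ _ _ _ = setT); last by apply/seteqP; split => // w _ n.
  rewrite setIT (indep_seq ind uJ hA) /= mulr1 fineK //.
  by rewrite -(indep_seq ind uJ hA) fin_num_measure.
set E := _ `&` _.
have mE' : measurable E by apply: measurableI => //; exact: measurable_avoid.
have mJ : m \notin J by apply/negP => /Jm; rewrite ltnn.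
have -> : (P E = \int[P]_(w in E) 1%:E)%E by rewrite integral_cst ?mul1e.
apply: (integral_fiber (X := xi m) (F := fun=> 1)) => //; first exact: measurable_fiber.
- apply: bndM; first exact: bnd_bool.
  by apply: (bnd_comp (fun z => y + z)); apply: bnd_esc.
- by move=> z; rewrite mulr_ge0 // esc_ge0.
- by apply: fine_ge0; rewrite -(indep_seq ind uJ hA).
move=> z.
have -> : (\int[P]_(w in E `&` xi m @^-1` [set z]) 1%:E = P (E `&` xi m @^-1` [set z]))%E.
  rewrite integral_cst ?mul1e //; apply: measurableI => //; exact: measurable_fiber.
case: (boolP (y + z \in B)) => hz.
  rewrite (_ : E `&` _ = set0) ?measure0 ?mul0r ?mulr0 //.
  by apply/seteqP; split => // w [[_]]; rewrite avoidS => -[h _] /= e; move: h; rewrite e hz.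
rewrite mul1r.
pose A' i := if i == m then xi m @^-1` [set z] else A i.
have A'J i : i \in J -> A' i = A i.
  by move=> iJ; rewrite /A' (_ : (i == m) = false) //; apply: contraNF mJ => /eqP <-.
have -> : E `&` xi m @^-1` [set z] =
    \bigcap_(i in [set` m :: J]) A' i `&` avoid B L m.+1 (y + z).
  rewrite bigcap_cons {1}/A' eqxx /E avoidS.
  rewrite (_ : \bigcap_(j in [set` J]) A' j = \bigcap_(j in [set` J]) A j); last first.
    by apply: eq_bigcapr => i /= iJ; rewrite A'J.
  apply/seteqP; split => w /=.
    by move=> [[h1 [h2 h3]] e]; rewrite -e.
  by move=> [[e h1] h2]; rewrite e.
rewrite IH; first last.
- move=> i; rewrite inE => /orP[/eqP ->|iJ].
    by rewrite /A' eqxx /G; exists [set z] => //; rewrite setTI.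
  by rewrite A'J //; apply: hA.
- by move=> i; rewrite inE => /orP[/eqP ->|/Jm /ltnW].
- by rewrite /= mJ.
have prodfin : (\prod_(i <- J) P (A i))%E \is a fin_num.
  by rewrite -(indep_seq ind uJ hA) fin_num_measure.
have prodE : (\prod_(i <- J) P (A' i))%E = (\prod_(i <- J) P (A i))%E.
  by apply: eq_big_seq => i iJ; rewrite A'J.
congr (_%:E); rewrite big_cons {1}/A' eqxx prodE fineM //; last by apply: fin_num_measure; exact: measurable_fiber.
have -> : P (xi m @^-1` [set z]) = eta [set z] by rewrite -(dxi m).
by rewrite mulrA (mulrC (fine (eta _))).
Qed.

Lemma prob_avoid0 B L y : P (avoid B L 0 y) = (esc eta B L y)%:E.
Proof.
have := @prob_avoid B L 0 [::] (fun=> setT) y isT.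
rewrite big_nil mul1r => <- //.
by rewrite (_ : \bigcap_(_ in _) _ = setT) ?setTI //; apply/seteqP; split.
Qed.

Lemma no_returnE B y : no_return xi [set` B] y = \bigcap_L avoid B L 0 y.
Proof.
apply/seteqP; split => w /=.
  move=> h L _ n nL; have := h n.+1 isT; rewrite /walk /= => /negP.
  by under [in X in _ -> X]eq_bigr do rewrite add0n.
move=> h [|n] // _; rewrite /walk /=; apply/negP.
by have := h n.+1 I n (ltnSn n); under [in X in X -> _]eq_bigr do rewrite add0n.
Qed.

Lemma no_return_cvg B y :
  (fun L => esc eta B L y) @ \oo --> fine (P (no_return xi [set` B] y)).
Proof.
have h : P \o (fun L => avoid B L 0 y) @ \oo --> P (\bigcap_L avoid B L 0 y).
  apply: nonincreasing_cvg_mu.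
  - by rewrite -ge0_fin_numE // fin_num_measure //; exact: measurable_avoid.
  - by move=> L; exact: measurable_avoid.
  - by apply: bigcapT_measurable => L; exact: measurable_avoid.
  - move=> i j ij; apply/subsetPset => w hw n nL; apply: hw.
    exact: leq_trans nL ij.
rewrite no_returnE.
have mB : measurable (\bigcap_L avoid B L 0 y).
  by apply: bigcapT_measurable => L; exact: measurable_avoid.
rewrite -(fineK (fin_num_measure P _ mB)) in h.
have -> : (fun L => esc eta B L y) = fine \o (P \o (fun L => avoid B L 0 y)).
  by apply/funext => L /=; rewrite prob_avoid0.
exact: fine_cvg h.
Qed.

End EscapeLink.

(** * The tree of a branching walk *)

Section TreesOfOffspringNumbers.
Implicit Types (k : seq nat -> nat) (t : ptree) (u v : seq nat).
Local Notation leaf := (PNode [::]).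

Definition consistent k t := forall u, u \in verts t -> k u = deg u t.

Lemma gw_tree_cons k i u :
  gw_tree k (i :: u) <-> (i < k [::])%N /\ gw_tree (fun v => k (i :: v)) u.
Proof.
split => [h|[h0 h] [|j] //]; last exact: h.
by split => [|j hj]; [exact: (h 0%N) | exact: (h j.+1)].
Qed.

Lemma gw_tree_root k : gw_tree k [::]. Proof. by []. Qed.

Lemma consistent_child k ts i : consistent k (PNode ts) -> (i < size ts)%N ->
  consistent (fun v => k (i :: v)) (nth leaf ts i).
Proof. by move=> h hi u hu; rewrite h // mem_verts hi. Qed.

Lemma consistent_root k ts : consistent k (PNode ts) -> k [::] = size ts.
Proof. by move=> h; rewrite h ?root_verts. Qed.

Lemma consistentP k ts : k [::] = size ts ->
  (forall i, (i < size ts)%N -> consistent (fun v => k (i :: v)) (nth leaf ts i)) ->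
  consistent k (PNode ts).
Proof. by move=> h0 h [|i u] //; rewrite mem_verts => /andP[hi hu]; rewrite h. Qed.

Lemma consistent_inj k t t' : consistent k t -> consistent k t' -> t = t'.
Proof.
elim/ptree_ind_nth: t k t' => ts IH k [ts'] h h'.
have e : size ts = size ts' by rewrite -(consistent_root h) -(consistent_root h').
congr PNode; apply: (eq_from_nth (x0 := leaf) e) => i hi.
by apply: (IH i hi (fun v => k (i :: v))); apply: consistent_child => //; rewrite -e.
Qed.

Lemma gw_tree_verts k t : consistent k t -> gw_tree k = [set` verts t].
Proof.
move=> h; apply/seteqP; suff e u : gw_tree k u <-> u \in verts t by split => u /e.
elim: u k t h => [|i u IH] k [ts] h; first by rewrite root_verts.
rewrite mem_verts gw_tree_cons (consistent_root h); split.
  by move=> [hi hu]; rewrite hi; apply/(IH _ _ (consistent_child h hi)).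
by move=> /andP[hi /(IH _ _ (consistent_child h hi))].
Qed.

(** Induction on the length of a list containing the tree: the labels below child i, with the letter
    i removed, form a shorter list because the root is left out. *)
Lemma exists_consistent k (s : seq (seq nat)) : gw_tree k `<=` [set` s] ->
  exists t, consistent k t.
Proof.
move: {2}(size s) (leqnn (size s)) => n; elim: n s k => [|n IH] s k hs sub.
  by have := sub _ (gw_tree_root k); case: s hs {sub}.
pose s' i := [seq behead u | u <- [seq u <- s | (u != [::]) && (head 0 u == i)]].
have hs' i : (size (s' i) <= n)%N.
  rewrite size_map size_filter -ltnS; apply: leq_trans hs.
  rewrite -(count_predC (pred1 [::]) s) -add1n leq_add //.
    by rewrite -has_count has_pred1; apply: (sub _ (gw_tree_root k)).
  by apply: sub_count => u /= /andP[].
have ex i : exists t, (i < k [::])%N -> consistent (fun v => k (i :: v)) t.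
  have [hi|hi] := ltnP i (k [::]); last by exists leaf.
  have [|t ht] := IH (s' i) (fun v => k (i :: v)) (hs' i); last by exists t.
  move=> u hu /=; apply/mapP; exists (i :: u) => //.
  by rewrite mem_filter /= eqxx; apply: sub; apply/gw_tree_cons.
have [T hT] := choice ex.
exists (PNode (mkseq T (k [::]))); apply: consistentP; first by rewrite size_mkseq.
by move=> i; rewrite size_mkseq => hi; rewrite nth_mkseq //; apply: hT.
Qed.

Lemma card_verts t : ([set` verts t] #= `I_(psize t))%card.
Proof.
have -> : [set` verts t] = nth [::] (verts t) @` `I_(psize t).
  apply/seteqP; split => u /=.
    by move=> /(nthP [::])[i hi <-]; exists i => //=; rewrite -size_verts.
  by move=> [i /= hi <-]; apply: mem_nth; rewrite size_verts.
apply: inj_card_eq => i j /set_mem /= hi /set_mem /= hj.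
by move/eqP; rewrite nth_uniq ?size_verts ?uniq_verts // => /eqP.
Qed.

(** This turns the cardinality event into a finite union over plane trees. *)
Lemma finite_gw_tree k n : (gw_tree k #= `I_n)%card <->
  exists t, [/\ t \in trees n n, psize t = n & consistent k t].
Proof.
split => [h|[t [_ <- /gw_tree_verts ->]]]; last exact: card_verts.
have /finite_seqP[s hs] : finite_set (gw_tree k) by exists n.
have [|t ht] := @exists_consistent k s; first by rewrite hs.
have pt : psize t = n.
  apply/(@card_eq_II (psize t) n); rewrite -card_eq_sym.
  by apply: card_eq_trans (card_verts t); rewrite -(gw_tree_verts ht) card_eq_sym.
by exists t; split => //; apply: mem_trees; rewrite pt.
Qed.

Fixpoint labels (p : seq nat) u : seq (seq nat) :=
  if u is i :: u' then rcons p i :: labels (rcons p i) u' else [::].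

Definition seplabels p u v : seq (seq nat * bool) :=
  [seq (l, false) | l <- labels p u] ++ [seq (l, true) | l <- labels p v].

(* The edges on the path from u to v, with the direction in which each is
   traversed; [p] is the common ancestor already passed. *)
Fixpoint difflabels p u v : seq (seq nat * bool) :=
  match u, v with
  | i :: u', j :: v' =>
    if i == j then difflabels (rcons p i) u' v' else seplabels p u v
  | _, _ => seplabels p u v
  end.

Lemma size_labels p u : size (labels p u) = size u.
Proof. by elim: u p => [//|i u IH] p /=; rewrite IH. Qed.

Lemma difflabels_cons p i u j v : difflabels p (i :: u) (j :: v) =
  if i == j then difflabels (rcons p i) u v else seplabels p (i :: u) (j :: v).
Proof. by []. Qed.

Lemma dist_cons i u j v : dist (i :: u) (j :: v) =
  if i == j then dist u v else ((size u).+1 + (size v).+1)%N.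
Proof. by []. Qed.

Lemma size_seplabels p u v : size (seplabels p u v) = (size u + size v)%N.
Proof. by rewrite size_cat !size_map !size_labels. Qed.

Lemma size_difflabels p u v : size (difflabels p u v) = dist u v.
Proof.
elim: u p v => [|i u IH] p [|j v]; try exact: size_seplabels.
rewrite difflabels_cons dist_cons.
by case: eqP => _; [exact: IH | exact: size_seplabels].
Qed.

Lemma mem_labels p u l : l \in labels p u ->
  exists i u' r, u = i :: u' /\ l = p ++ i :: r.
Proof.
elim: u p => [//|i u IH] p /=; rewrite inE => /orP[/eqP ->|/IH].
  by exists i, u, [::]; rewrite cats1.
by move=> [j [u' [r [_ ->]]]]; exists i, u, (j :: r); rewrite cat_rcons.
Qed.

Lemma uniq_labels p u : uniq (labels p u).
Proof.
elim: u p => [//|i u IH] p /=; rewrite IH andbT.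
apply/negP => /mem_labels[j [u' [r [_ /eqP]]]].
by rewrite -[X in X == _]cats0 eqseq_cat // eqxx.
Qed.

Lemma uniq_seplabels p u v :
  (forall i u' j v', u = i :: u' -> v = j :: v' -> i != j) ->
  uniq [seq l.1 | l <- seplabels p u v].
Proof.
move=> ij; rewrite map_cat -!map_comp !map_id cat_uniq !uniq_labels /= andbT.
apply/hasPn => l /mem_labels[j [v' [r [ev ->]]]]; apply/negP.
move=> /mem_labels[i [u' [r' [eu /eqP]]]].
by rewrite eqseq_cat // eqxx /= eqseq_cons eq_sym (negbTE (ij _ _ _ _ eu ev)).
Qed.

(** Edges above the last common ancestor are omitted, and below it the two branches start with
    different children. With no edge repeated, the independence hypothesis applies to the whole
    path. *)
Lemma uniq_difflabels p u v : uniq [seq l.1 | l <- difflabels p u v].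
Proof.
elim: u p v => [|i u IH] p [|j v]; try by apply: uniq_seplabels.
rewrite difflabels_cons.
by case: eqP => [_|/eqP ij]; [exact: IH | apply: uniq_seplabels => ? ? ? ? [<- _] [<- _]].
Qed.

End TreesOfOffspringNumbers.

Section Positions.
Context {d : nat}.
Implicit Types (X : seq nat -> lattice d) (u v p : seq nat).

Lemma position_labels X u : position X u = \sum_(l <- labels [::] u) X l.
Proof.
have h p : \sum_(j < size u) X (p ++ take j.+1 u) = \sum_(l <- labels p u) X l.
  elim: u p => [|i u IH] p /=; first by rewrite big_ord0 big_nil.
  rewrite big_cons -IH big_ord_recl take0 cats1; congr (_ + _).
  by apply: eq_bigr => j _; rewrite lift0 -cat_rcons.
by rewrite -h.
Qed.

Lemma difflabels_position X u v :
  \sum_(l <- difflabels [::] u v) signed l.2 (X l.1) = position X v - position X u.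
Proof.
rewrite !position_labels; move: [::] => p.
have e p' u' v' : \sum_(l <- seplabels p' u' v') signed l.2 (X l.1) =
    \sum_(l <- labels p' v') X l - \sum_(l <- labels p' u') X l.
  by rewrite big_cat !big_map /= sumrN addrC.
elim: u p v => [|i u IH] p [|j v]; rewrite [difflabels _ _ _]/= ?e //.
case: eqP => [<-|_]; last by rewrite e.
by rewrite IH /= !big_cons opprD addrACA subrr add0r.
Qed.

End Positions.
(** Symmetry is given on points; [integral_fiber] for the map z -> -z carries it to nonnegative
    functions, and adding a constant reaches all bounded ones. *)
Lemma symmetric_mean (R : realType) d (p : probability (lattice d) R) (h : lattice d -> R) :
  symmetric_law p -> bnd h -> mean p (fun z => h (- z)) = mean p h.
Proof.
move=> sym bh.
have pos (g : lattice d -> R) : bnd g -> (forall z, 0 <= g z) ->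
    mean p (fun z => g (- z)) = mean p g.
  move=> bg g0; apply: EFin_inj; rewrite -[in RHS](mul1r (mean p g)).
  have bg' : bnd (fun z => g (- z)) by apply: (bnd_comp (fun z => - z)).
  rewrite -(@integral_fiber _ _ _ p d (fun z => - z) p setT (fun z => g (- z)) g 1) //.
  - by rewrite /mean fineK // (integrable_fin_num measurableT (bnd_integrable p bg')).
  move=> z; rewrite setTI mul1r.
  have -> : (fun z => - z) @^-1` [set z] = [set - z].
    by apply/seteqP; split => w /= => [<-|->]; rewrite opprK.
  rewrite (eq_integral (cst (g z)%:E)); last by move=> w /set_mem /= ->; rewrite opprK.
  have -> : (\int[p]_(x in [set (- z)%R]) cst (g z)%:E x = (g z)%:E * p [set (- z)%R])%E.
    by rewrite integral_cst.
  rewrite -(sym z) EFinM fineK ?fin_num_measure // muleC //.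
have [C hC] := bh.
have b1 : bnd (fun z => h z + C) by apply: bndD => //; apply: bnd_cst.
have := pos (fun z => h z + C) b1 (fun z => _).
rewrite !meanD; last 4 first.
- exact: bh.
- exact: bnd_cst.
- by apply: (bnd_comp (fun z => - z)).
- exact: bnd_cst.
by move=> e; apply: (addIr (mean p (fun=> C))); apply: e => z; have := hC z; rewrite ler_norml => /andP[]; lra.
Qed.

(** * Probabilities attached to a fixed tree shape *)

Section TreeEvents.
Context {disp : measure_display} {Omega : measurableType disp} {R : realType}
  (P : probability Omega R) {d : nat} (mu : probability nat R)
  (theta : probability (lattice d) R)
  (k : seq nat -> {RV P >-> nat}) (X : seq nat -> {RV P >-> lattice d}).
Hypothesis hkX : branching_walk mu theta k X.
Implicit Types (t : ptree) (u v : seq nat) (n : nat).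

Definition atom (j : nat) : R := fine (mu [set j]).

(** Only finitely many offspring numbers are constrained; those of the leaves are constrained to be
    0, so the tree is exactly [t]. *)
Definition tree_event t : set Omega :=
  \bigcap_(u in [set` verts t]) (k u @^-1` [set deg u t]).

Lemma measurable_tree_event t : measurable (tree_event t).
Proof.
apply: measurable_bigcap_seq => u _; rewrite -[X in measurable X]setTI.
exact: measurable_funP.
Qed.

Lemma atom_ge0 j : 0 <= atom j.
Proof. exact: fine_ge0. Qed.

Let G (a : seq nat + seq nat) := match a with
  | inl u => sigma_rv (k u) | inr u => sigma_rv (X u) end.

Let G_meas a B : G a B -> measurable B.
Proof. by case: a => u [D mD <-]; exact: measurable_funP. Qed.

Let fiber t (a : seq nat + seq nat) : set Omega :=
  if a is inl u then k u @^-1` [set deg u t] else setT.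

Let tree_event_fiber t :
  tree_event t = \bigcap_(a in [set` [seq inl u | u <- verts t]]) fiber t a.
Proof.
apply/seteqP; split => w h.
  by move=> _ /mapP[u hu ->]; apply: h.
by move=> u hu; apply: (h (inl u)); apply: map_f.
Qed.

Let G_fiber t a : a \in [seq inl u | u <- verts t] -> G a (fiber t a).
Proof. by move=> /mapP[u _ ->]; exists [set deg u t] => //; rewrite setTI. Qed.

Let prod_fiber t : (\prod_(a <- [seq inl u | u <- verts t]) P (fiber t a))%E =
  (tweight atom t)%:E.
Proof.
rewrite big_map -prod_verts.
transitivity (\prod_(u <- verts t) (atom (deg u t))%:E)%E; last first.
  by elim: (verts t) => [|u s IH]; rewrite ?big_nil // !big_cons IH.
apply: eq_bigr => u _; have [hk _ _] := hkX.
by rewrite /atom fineK ?fin_num_measure // -(hk u).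
Qed.

Let uniq_inl t : uniq [seq (inl u : seq nat + seq nat) | u <- verts t].
Proof. by rewrite map_inj_uniq ?uniq_verts // => ? ? []. Qed.

Lemma prob_tree_event t : P (tree_event t) = (tweight atom t)%:E.
Proof.
have [_ _ ind] := hkX.
by rewrite tree_event_fiber (indep_seq ind (uniq_inl t) (@G_fiber t)) prod_fiber.
Qed.

(** Offspring numbers and edge variables are disjoint parts of one independent family: the shape
    factors out as [tweight], and the displacement is that of a walk with [dist u v] steps. *)
Lemma integral_tree_event t u v f : symmetric_law theta -> bnd f -> (forall x, 0 <= f x) ->
  (\int[P]_(w in tree_event t)
     (f (position (X ^~ w) u - position (X ^~ w) v))%:E
   = (tweight atom t * iter (dist u v) (step theta) f 0)%:E)%E.
Proof.
move=> sym bf f0; have [_ hX ind] := hkX.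
have := @integral_signed_sum _ _ _ P d (seq nat + seq nat)%type (seq nat) G X inr theta
  _ ind G_meas (fun=> erefl) hX (fun h bh => symmetric_mean sym bh)
  (difflabels [::] u v) (uniq_difflabels [::] u v)
  [seq inl u | u <- verts t] (fiber t) f 0 (uniq_inl t) (@G_fiber t) _ bf f0.
rewrite -tree_event_fiber prod_fiber size_difflabels => <-.
- apply: eq_integral => w _; congr (f _)%:E.
  by rewrite /signed_sum (difflabels_position (X ^~ w)) sub0r opprB.
- by move=> ? ? [].
- by move=> l _; apply/mapP => -[].
Qed.

Lemma tree_size_eventP n w : tree_size_event k n w <->
  exists2 t, t \in [seq t <- trees n n | psize t == n] & tree_event t w.
Proof.
split => [/finite_gw_tree[t [h1 /eqP h2 h3]]|[t]].
  by exists t => //; rewrite mem_filter h1 h2.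
rewrite mem_filter => /andP[/eqP h1 h2] h3.
by apply/finite_gw_tree; exists t.
Qed.

Lemma tree_event_inj t t' w : tree_event t w -> tree_event t' w -> t = t'.
Proof. exact: consistent_inj. Qed.

Lemma measurable_exists_tree (s : seq ptree) :
  measurable [set w | exists2 t, t \in s & tree_event t w].
Proof.
rewrite (_ : [set _ | _] = \bigcup_(t in [set` s]) tree_event t) //.
by apply: fin_bigcup_measurable => [|t _]; [exact: finite_seq | exact: measurable_tree_event].
Qed.

Lemma tree_size_event_exists n : tree_size_event k n =
  [set w | exists2 t, t \in [seq t <- trees n n | psize t == n] & tree_event t w].
Proof. by apply/seteqP; split => w /tree_size_eventP. Qed.

Lemma measurable_tree_size_event n : measurable (tree_size_event k n).
Proof. by rewrite tree_size_event_exists; apply: measurable_exists_tree. Qed.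

Lemma exists_tree_cons t (s : seq ptree) :
  [set w | exists2 t', t' \in t :: s & tree_event t' w] =
  tree_event t `|` [set w | exists2 t, t \in s & tree_event t w].
Proof.
apply/seteqP; split => w /=.
  by move=> [t']; rewrite inE => /orP[/eqP ->|h1] h2; [left | right; exists t'].
by move=> [h|[t' h1 h2]]; [exists t | exists t'] => //; rewrite inE ?eqxx // h1 orbT.
Qed.

Lemma prob_exists_tree (s : seq ptree) : uniq s ->
  P [set w | exists2 t, t \in s & tree_event t w] = (\sum_(t <- s) tweight atom t)%:E.
Proof.
elim: s => [_|t s IH /= /andP[ts us]].
  by rewrite big_nil (_ : [set _ | _] = set0) ?measure0 //; apply/seteqP; split => // w [].
have mt := measurable_tree_event t; have ms := measurable_exists_tree s.
rewrite exists_tree_cons big_cons EFinD -(IH us) -prob_tree_event -measureU //.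
by apply/seteqP; split => // w [h [t' h1 /(tree_event_inj h) e]]; move: ts; rewrite e h1.
Qed.

Lemma prob_tree_size_event n : P (tree_size_event k n) =
  (\sum_(t <- trees n n | psize t == n) tweight atom t)%:E.
Proof.
by rewrite -big_filter -prob_exists_tree ?tree_size_event_exists // filter_uniq // uniq_trees.
Qed.

Lemma prob_tree_size_eventI_le n (B : set Omega) : measurable B ->
  (P (B `&` tree_size_event k n) <=
   \sum_(t <- trees n n | psize t == n) P (B `&` tree_event t))%E.
Proof.
move=> mB; rewrite -big_filter tree_size_event_exists.
elim: [seq _ <- _ | _] => [|t s IH].
  by rewrite (_ : [set _ | _] = set0) ?setI0 ?measure0 ?big_nil //; apply/seteqP; split => // w [].
rewrite big_cons exists_tree_cons setIUr; apply: le_trans (leeD2l _ IH).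
apply: measureU2; apply: measurableI => //; first exact: measurable_tree_event.
exact: measurable_exists_tree.
Qed.

End TreeEvents.

(** * Green function and displacement along a tree *)

Section SumsOfInverseRoots.
Context {R : realType}.
Local Notation rsq := (@rsq R).

(** For the two inverse roots u >= v one has u^2 - v^2 = u^2 v^2, which makes the sum of the
    (j+1)^(-3/2) telescope. *)
Lemma rsq_diff j : rsq j.+1 ^+ 3 <= 2 * (rsq j - rsq j.+1).
Proof.
have u0 : 0 < rsq j := rsq_gt0 _; have v0 : 0 < rsq j.+1 := rsq_gt0 _.
have vu : rsq j.+1 <= rsq j by apply: ler_rsq.
have e : rsq j ^+ 2 - rsq j.+1 ^+ 2 = rsq j ^+ 2 * rsq j.+1 ^+ 2.
  have key (y : R) : 0 < y -> y^-1 - (y + 1)^-1 = y^-1 * (y + 1)^-1.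
    by move=> y0; field; rewrite !gt_eqF // addr_gt0.
  by rewrite !rsq_sqr -[j.+2%:R]natr1 key.
move: u0 v0 vu e; set u := rsq j; set v := rsq j.+1 => u0 v0 vu e.
have h : u * v ^+ 2 <= 2 * (u - v).
  rewrite -(ler_pM2l u0).
  have -> : u * (u * v ^+ 2) = (u - v) * (u + v) by rewrite -subr_sqr e; ring.
  rewrite mulrA [leRHS]mulrC ler_wpM2l ?subr_ge0 //.
  by rewrite mulr_natr mulr2n lerD2l.
by apply: le_trans h; rewrite exprS ler_wpM2r // exprn_ge0 // ltW.
Qed.

Lemma sum_rsq_cube a H : \sum_(b < H) rsq (a + b) ^+ 3 <= 3 * rsq a.
Proof.
have a0 : 0 <= rsq a := rsq_ge0 _.
case: H => [|H]; first by rewrite big_ord0 mulr_ge0.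
suff h : \sum_(b < H.+1) rsq (a + b) ^+ 3 <= rsq a + 2 * (rsq a - rsq (a + H)).
  by apply: le_trans h _; have := rsq_ge0 (R := R) (a + H); lra.
elim: H => [|H IH].
  rewrite big_ord1 addn0 subrr mulr0 addr0 -[leRHS]mulr1 exprS ler_wpM2l //.
  by rewrite exprn_ile1 // rsq_le1.
rewrite big_ord_recr /=; have := rsq_diff (a + H); rewrite -addnS; lra.
Qed.

Lemma sum_rsq H : \sum_(a < H) rsq a <= 2 * Num.sqrt H%:R.
Proof.
elim: H => [|H IH]; first by rewrite big_ord0 sqrtr0 mulr0.
rewrite big_ord_recr /=; apply: le_trans (lerD IH (lexx _)) _.
have s0 : 0 < Num.sqrt H.+1%:R :> R by rewrite sqrtr_gt0.
have t0 : 0 <= Num.sqrt H%:R :> R by rewrite sqrtr_ge0.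
have e : Num.sqrt H.+1%:R ^+ 2 = Num.sqrt H%:R ^+ 2 + 1 :> R by rewrite !sqr_sqrtr // -natr1.
rewrite rsqE; move: s0 t0 e; set s := Num.sqrt H.+1%:R; set t := Num.sqrt H%:R => s0 t0 e.
rewrite -(ler_pM2l s0) mulrDr mulfV ?gt_eqF //.
have : 0 <= (s - t) ^+ 2 by rewrite sqr_ge0.
rewrite sqrrB; move: e; rewrite !expr2; lra.
Qed.

(** Exponent 1: drop b. Exponent 2: 1 / (a + b + 1) is at most the product of the two inverse roots,
    so no logarithm appears. Exponent 3: the sum over b is already O([rsq a]). *)
Lemma sum_rsq_pairs d H : d \in [:: 3; 4; 5]%N ->
  \sum_(a < H) \sum_(b < H) rsq (a + b) ^+ (d - 2) <= 6 * Num.sqrt H%:R ^+ (6 - d).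
Proof.
have s0 : 0 <= Num.sqrt H%:R :> R := sqrtr_ge0 _.
have sH : Num.sqrt H%:R ^+ 2 = H%:R :> R by rewrite sqr_sqrtr.
have hS : 0 <= \sum_(a < H) rsq a by apply: sumr_ge0 => a _; apply: rsq_ge0.
move: s0 sH (sum_rsq H); move: (Num.sqrt H%:R) => s s0 sH hs.
have hs6 : 3 * \sum_(a < H) rsq a <= 6 * s by lra.
have hs6' : \sum_(a < H) rsq a <= 6 * s by lra.
have s24 : 2 ^+ 2 <= 6 :> R by rewrite expr2; lra.
rewrite !inE => /or3P[] /eqP ->; rewrite /=.
- apply: (@le_trans _ _ (\sum_(a < H) \sum_(b < H) rsq a)).
    apply: ler_sum => a _; apply: ler_sum => b _.
    by rewrite expr1 ler_rsq // leq_addr.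
  under eq_bigr do rewrite sumr_const card_ord -mulr_natr.
  rewrite -mulr_suml -sH -[(6 - 3)%N]/3%N [X in _ <= _ * X]exprS [leRHS]mulrA.
  rewrite ler_wpM2r ?sqr_ge0 //; exact: hs6'.
- apply: (@le_trans _ _ (\sum_(a < H) \sum_(b < H) rsq a * rsq b)).
    apply: ler_sum => a _; apply: ler_sum => b _.
    by rewrite -[(4 - 2)%N]/2%N expr2 ler_pM ?rsq_ge0 // ler_rsq // ?leq_addr // leq_addl.
  under eq_bigr do rewrite -mulr_sumr.
  rewrite -mulr_suml -expr2 -[(6 - 4)%N]/2%N.
  apply: (@le_trans _ _ ((2 * s) ^+ 2)).
    by rewrite ler_pXn2r ?nnegrE ?mulr_ge0.
  by rewrite exprMn ler_wpM2r ?sqr_ge0.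
apply: (@le_trans _ _ (\sum_(a < H) 3 * rsq a)).
  by apply: ler_sum => a _; apply: sum_rsq_cube.
rewrite -mulr_sumr -[(6 - 5)%N]/1%N expr1.
exact: hs6.
Qed.

End SumsOfInverseRoots.

Section GreenFunctionAlongTree.
Context {R : realType} {d : nat}.
Implicit Types (theta eta : probability (lattice d) R).

Lemma sum_heat_tail eta (C : R) N N' y : (2 < d)%N -> 0 < C ->
  (forall n x, heat eta n x <= C * rsq n ^+ d) ->
  \sum_(j < N') heat eta j y <= \sum_(j < N) heat eta j y + 3 * C * rsq N.
Proof.
move=> d2 C0 hC.
apply: (@le_trans _ _ (\sum_(j < N + N') heat eta j y)).
  rewrite addnC big_split_ord /= lerDl; apply: sumr_ge0 => j _; exact: heat_ge0.
rewrite big_split_ord /= lerD2l.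
apply: (@le_trans _ _ (\sum_(b < N') C * rsq (N + b) ^+ 3)).
  apply: ler_sum => b _; apply: le_trans (hC _ _) _.
  rewrite ler_wpM2l ?(ltW C0) // -[X in rsq _ ^+ X](subnKC d2) exprD ler_piMr ?exprn_ge0 ?rsq_ge0 //.
  by rewrite exprn_ile1 ?rsq_ge0 // rsq_le1.
rewrite -mulr_sumr [leRHS]mulrAC [leRHS]mulrC ler_wpM2l ?(ltW C0) //.
exact: sum_rsq_cube.
Qed.

(** For the times j <= m of the Green function, the m steps of [theta] bound each of the m + 1 terms
    by O(m^(-d/2)). For later times the kernel of [eta] itself is small, and its tail sums to the
    same order m^(1-d/2). *)
Lemma walk_green_bound theta eta : (2 < d)%N ->
  irreducible_chain (walk_kernel theta) -> irreducible_chain (walk_kernel eta) ->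
  exists2 C, 0 < C & forall m N x,
    iter m (step theta) (fun y => \sum_(j < N) heat eta j y) x <= C * rsq m ^+ (d - 2).
Proof.
move=> d2 ith ieta; have d0 : (0 < d)%N by apply: ltn_trans d2.
have [C1 C10 h1] := heat_kernel_bound d0 ith.
have [C2 C20 h2] := heat_kernel_bound d0 ieta.
exists (C1 + 3 * C2); first by rewrite addr_gt0 // mulr_gt0.
move=> m N x; rewrite iter_step_sum; last by move=> j; exact: bnd_heat.
pose B j := iter m (step theta) (heat eta j) x.
have B0 j : 0 <= B j by apply: iter_step_ge0 => y; exact: heat_ge0.
apply: (@le_trans _ _ (\sum_(j < m.+1 + N) B j)).
  rewrite addnC big_split_ord /= lerDl; apply: sumr_ge0 => j _; exact: B0.
have r0 n : 0 <= rsq n :> R := rsq_ge0 n.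
rewrite big_split_ord mulrDl; apply: lerD.
  apply: (@le_trans _ _ (\sum_(j < m.+1) C1 * rsq m ^+ d)).
    by apply: ler_sum => j _; apply: h1.
  rewrite sumr_const card_ord -mulr_natr -mulrA ler_wpM2l ?(ltW C10) //.
  rewrite -[X in rsq m ^+ X](subnK (ltnW d2)) exprD -mulrA rsq_sqr mulVf ?mulr1 //.
apply: (@le_trans _ _ (\sum_(b < N) C2 * (rsq m ^+ (d - 3) * rsq (m + b) ^+ 3))).
  apply: ler_sum => b _; rewrite /B.
  apply: (@le_trans _ _ (C2 * rsq (m.+1 + b) ^+ d)).
    apply: iter_step_le_cst => [|y]; first exact: bnd_heat.
    exact: (h2 eta (m.+1 + b)%N 0%N y).
  rewrite ler_wpM2l ?(ltW C20) // -[X in rsq _ ^+ X](subnK d2) exprD.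
  have l1 : rsq (m.+1 + b) <= rsq (m + b) :> R by rewrite ler_rsq // leq_add2r.
  have l2 : rsq (m.+1 + b) <= rsq m :> R by rewrite ler_rsq // addSn ltnW // ltnS leq_addr.
  by apply: ler_pM; rewrite ?exprn_ge0 //; apply: lerXn2r; rewrite ?nnegrE.
rewrite -!mulr_sumr [3 * C2]mulrC -!mulrA ler_wpM2l ?(ltW C20) //.
apply: (@le_trans _ _ (rsq m ^+ (d - 3) * (3 * rsq m))).
  by rewrite ler_wpM2l ?exprn_ge0 // sum_rsq_cube.
by rewrite mulrCA -exprSr -(subnSK d2).
Qed.

End GreenFunctionAlongTree.

(** * Exponential moments and the displacement along a path *)

Section Displacement.
Context {R : realType} {d : nat} (theta : probability (lattice d) R).

Lemma lcoord_le_enorm (i : 'I_d) x : `|lcoord R i x| <= enorm R x.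
Proof.
rewrite -sqrtr_sqr ler_wsqrtr // (bigD1 i) //= lerDl.
by apply: sumr_ge0 => j _; rewrite sqr_ge0.
Qed.

(** The identity e^y + e^(-y) - 2 = (1 - e^(-y))^2 e^y shows that the linear term cancels, so a
    small y costs only y^2. *)
Lemma cosh_le (y : R) : expR y + expR (- y) <= 2 + y ^+ 2 * expR `|y|.
Proof.
wlog y0 : y / 0 <= y.
  move=> h; have [/h //|y0] := leP 0 y.
  by have := h (- y); rewrite opprK sqrrN normrN addrC; apply; rewrite oppr_ge0 ltW.
rewrite ger0_norm //.
have h1 : 1 - expR (- y) <= y by have := expR_ge1Dx (- y); lra.
have h2 : 0 <= 1 - expR (- y) by rewrite subr_ge0 -expR0 ler_expR oppr_le0.
have e : expR y * expR (- y) = 1 by rewrite -expRD subrr expR0.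
have -> : expR y + expR (- y) = 2 + (1 - expR (- y)) ^+ 2 * expR y.
  rewrite sqrrB expr1n mul1r; move: e; rewrite expr2.
  set a := expR y; set b := expR (- y) => e.
  have e' : b * b * a = b by rewrite -mulrA [b * a]mulrC e mulr1.
  by rewrite !mulrDl mulNr mul1r e' mulr2n mulrDl [b * a]mulrC e; ring.
by rewrite lerD2l ler_wpM2r ?expR_ge0 // ler_pXn2r.
Qed.

Lemma sqr_le_expR (z : R) : 0 <= z -> z ^+ 2 <= 4 * expR z.
Proof.
move=> z0; have h : z <= 2 * expR (z / 2) by have := expR_ge1Dx (z / 2); lra.
have -> : 4 * expR z = (2 * expR (z / 2)) ^+ 2.
  by rewrite exprMn [expR _ ^+ 2]expr2 -expRD -splitr expr2 -natrM.
by rewrite ler_pXn2r // nnegrE mulr_ge0 // expR_ge0.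
Qed.

(** For t of order h^(-1/2), a symmetric step multiplies the function e^(t c) + e^(-t c) of a
    coordinate c by at most 1 + O(1/h), hence n <= h steps multiply it by O(1). It exceeds e^(t r)
    wherever |c| > r. *)
Lemma displacement_tail (lam : R) : symmetric_law theta -> 0 < lam ->
  itg theta (fun x => expR (lam * enorm R x)) ->
  exists C : R, exists2 eps : R, 0 < eps & forall h n i (r : R), (n <= h)%N ->
    iter n (step theta) (fun x => (r < `|lcoord R i x|)%R%:R) 0 <=
      expR (C - eps * rsq h * r).
Proof.
move=> sym lam0 hg; set g := fun x : lattice d => expR (lam * enorm R x).
pose M := mean theta g.
have M0 : 0 <= M by apply: mean_ge0 => x; apply: expR_ge0.
exists (1 + 4 * M), (lam / 2); first by rewrite divr_gt0.
(* Half of [lam]: one factor e^(nu |c|) pays for the square in [cosh_le], the other for its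
   exponential. *)
move=> h n i r nh; set nu := lam / 2; have nu0 : 0 < nu by rewrite divr_gt0.
set t := nu * rsq h.
have t0 : 0 < t by rewrite mulr_gt0 // rsq_gt0.
have tnu : t <= nu by rewrite ler_piMr ?(ltW nu0) // rsq_le1.
pose H (y : lattice d) := expR (t * lcoord R i y) + expR (- (t * lcoord R i y)).
have H0 y : 0 <= H y by rewrite addr_ge0 // expR_ge0.
pose q := 1 + 4 * M / h.+1%:R.
have q0 : 0 <= q by rewrite addr_ge0 // divr_ge0 // mulr_ge0.
set f := fun x => _; pose F k := iter k (step theta) f.
have bf : bnd f by apply: bnd_bool.
have bF k : bnd (F k) by apply: bnd_iter.
have cosh_g x : (expR (t * lcoord R i x) + expR (- (t * lcoord R i x))) / 2 <=
    1 + 4 / h.+1%:R * g x.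
  set c := lcoord R i x.
  have c0 : 0 <= `|c| by [].
  have h1 := cosh_le (t * c).
  have e1 : `|t * c| = t * `|c| by rewrite normrM gtr0_norm.
  have h2 : expR `|t * c| <= expR (nu * `|c|) by rewrite ler_expR e1 ler_wpM2r.
  have h3 : (t * c) ^+ 2 <= h.+1%:R^-1 * (4 * expR (nu * `|c|)).
    rewrite /t mulrAC exprMn rsq_sqr mulrC ler_wpM2l ?invr_ge0 //.
    rewrite -real_normK ?num_real // normrM gtr0_norm // sqr_le_expR // mulr_ge0 // ltW //.
  have h4 : expR (nu * `|c|) * expR (nu * `|c|) <= g x.
    rewrite -expRD ler_expR -mulrDl /nu -splitr ler_wpM2l ?(ltW lam0) //.
    exact: lcoord_le_enorm.
  have h5 : (t * c) ^+ 2 * expR `|t * c| <= 4 / h.+1%:R * g x.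
    apply: (@le_trans _ _ (h.+1%:R^-1 * (4 * expR (nu * `|c|)) * expR (nu * `|c|))).
      by apply: ler_pM => //; rewrite ?sqr_ge0 ?expR_ge0.
    have -> : h.+1%:R^-1 * (4 * expR (nu * `|c|)) * expR (nu * `|c|) =
      4 / h.+1%:R * (expR (nu * `|c|) * expR (nu * `|c|)) by ring.
    by rewrite ler_wpM2l // divr_ge0.
  have h6 : 0 <= 4 / h.+1%:R * g x by rewrite mulr_ge0 ?divr_ge0 // expR_ge0.
  move: h1 h5 h6; clear; set a := _ ^+ 2 * _; set b := _ * g x; set e := _ + _; lra.
have stepF k (c : R) : 0 <= c -> (forall y, F k y <= c * H y) -> forall y, F k.+1 y <= c * q * H y.
  move=> c0 hF y.
  have bm : bnd (fun x => F k (y - x)) by apply: (bnd_comp (fun x => y - x)).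
  have bp : bnd (fun x => F k (y + x)) by apply: (bnd_comp (fun x => y + x)).
  have e : mean theta (fun x => F k (y - x)) = mean theta (fun x => F k (y + x)).
    by rewrite -[RHS](symmetric_mean sym bp).
  have -> : F k.+1 y = mean theta (fun x => 2^-1 * (F k (y - x) + F k (y + x))).
    rewrite meanZ ?meanD //; last exact: bndD.
    by rewrite /F iterS -/(F k) {1}/step e; lra.
  have -> : c * q * H y = mean theta (fun x => c * H y * (1 + 4 / h.+1%:R * g x)).
    rewrite mean_itgZ ?mean_itgD ?mean_itgZ ?mean_cst // -/M; last first.
    - by apply: itgD; [apply: itg_bnd; apply: bnd_cst | apply: itgZ].
    - by apply: itgZ.
    - by apply: itg_bnd; apply: bnd_cst.
    by rewrite /q; ring.
  apply: mean_le_integrable.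
  - by apply: bndZ; apply: bndD.
  - by apply: itgZ; apply: itgD; [apply: itg_bnd; apply: bnd_cst | apply: itgZ].
  move=> x; apply: (@le_trans _ _ (c * H y * ((expR (t * lcoord R i x) + expR (- (t * lcoord R i x))) / 2))).
    have -> : c * H y * ((expR (t * lcoord R i x) + expR (- (t * lcoord R i x))) / 2) =
        2^-1 * (c * H (y - x) + c * H (y + x)).
      rewrite /H lcoordB (_ : lcoord R i (y + x) = lcoord R i y + lcoord R i x); last first.
        by rewrite /lcoord mxE intrD.
      rewrite (mulrBr t) (mulrDr t) !opprD opprK !expRD; ring.
    by rewrite ler_wpM2l ?invr_ge0 // lerD.
  by rewrite ler_wpM2l ?mulr_ge0.
have Fle k y : F k y <= expR (- (t * r)) * q ^+ k * H y.
  elim: k y => [|k IH] y.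
    rewrite expr0 mulr1 /F /= /f; case: ltP => [hr|_]; last by rewrite mulr_ge0 ?expR_ge0.
    rewrite /H mulrDr -!expRD.
    have [c0|c0] := leP 0 (lcoord R i y).
      rewrite ger0_norm // in hr.
      apply: (@le_trans _ _ (expR (- (t * r) + t * lcoord R i y))); last by rewrite lerDl expR_ge0.
      by rewrite -[leLHS]expR0 ler_expR addrC subr_ge0 ler_pM2l // ltW.
    rewrite ltr0_norm // in hr.
    apply: (@le_trans _ _ (expR (- (t * r) - t * lcoord R i y))); last by rewrite lerDr expR_ge0.
    by rewrite -[leLHS]expR0 ler_expR addrC -mulrN subr_ge0 ler_pM2l // ltW.
  rewrite exprSr mulrA; apply: stepF => //.
  by rewrite mulr_ge0 ?expR_ge0 // exprn_ge0.
apply: le_trans (Fle n 0) _.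
have -> : H 0 = 2 by rewrite /H /lcoord mxE mulr0 oppr0 expR0; ring.
have q1 : q ^+ n <= expR (4 * M).
  apply: (@le_trans _ _ (expR (4 * M / h.+1%:R) ^+ n)).
    by apply: lerXn2r; rewrite ?nnegrE ?expR_ge0 // expR_ge1Dx.
  rewrite -expRM_natl ler_expR mulrCA ler_piMr ?mulr_ge0 //.
  by rewrite ler_pdivrMr ?ltr0n // mul1r ler_nat ltnW.
have h2 : 2 <= expR 1 :> R by have := expR_ge1Dx (1 : R); lra.
have -> : expR (1 + 4 * M - t * r) = expR (- (t * r)) * expR (4 * M) * expR 1.
  by rewrite -!expRD; congr expR; ring.
apply: ler_pM => //; first by rewrite mulr_ge0 ?expR_ge0 // exprn_ge0.
by rewrite ler_wpM2l ?expR_ge0.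
Qed.

End Displacement.

(** * Moments of the offspring and jump laws *)

Section OffspringMoments.
Context {R : realType} (mu : probability nat R).
Implicit Types (phi psi : nat -> R) (D j : nat).
Local Notation m := (atom mu).
Local Notation E phi := (\int[mu]_k (phi k)%:E)%E.

Lemma integral_truncated phi D : (forall k, 0 <= phi k) ->
  (E (fun k => (k < D)%N%:R * phi k) = (\sum_(j < D) m j * phi j)%:E)%E.
Proof.
move=> phi0.
pose F (j : 'I_D) (k : nat) : \bar R := ((phi j)%:E * (\1_[set (j : nat)] k)%:E)%E.
have F0 (j : 'I_D) k : [set: nat] k -> (0 <= F j k)%E.
  by move=> _; rewrite mule_ge0 // lee_fin.
rewrite (eq_integral (fun k => (\sum_(j <- index_enum 'I_D) F j k)%R)); last first.
  move=> k _; rewrite /F.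
  rewrite (eq_bigr (fun j : 'I_D => (phi j * \1_[set (j : nat)] k)%:E)); last first.
    by move=> j _; rewrite EFinM.
  rewrite sumEFin.
  congr (_%:E); case: (ltnP k D) => hk; last first.
    rewrite mul0r big1 // => j _; rewrite indicE (_ : (k \in _) = false) ?mulr0 //.
    apply/negbTE/negP => /set_mem /= e.
    by have := ltn_ord j; rewrite -e ltnNge hk.
  rewrite mul1r (bigD1 (Ordinal hk)) //= big1 ?addr0.
    by rewrite indicE (_ : (k \in _) = true) ?mulr1 // mem_set.
  move=> j jk; rewrite indicE (_ : (k \in _) = false) ?mulr0 //.
  apply/negbTE/negP => /set_mem /= e; move/eqP: jk; apply.
  by apply: val_inj.
rewrite ge0_integral_sum //.
rewrite -sumEFin; apply: eq_bigr => j _.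
rewrite /F ge0_integralZl_EFin //.
rewrite integral_indic // setIT mulrC EFinM; congr (_ * _)%E.
by rewrite /atom fineK // fin_num_measure.
Qed.

Lemma sum_atom_le phi D : (forall k, 0 <= phi k) ->
  ((\sum_(j < D) m j * phi j)%:E <= E phi)%E.
Proof.
move=> phi0; rewrite -integral_truncated //; apply: ge0_le_integral => //.
- by move=> k _; rewrite lee_fin mulr_ge0.
- by move=> k _; rewrite lee_fin; case: (_ < _)%N; rewrite ?mul1r // mul0r.
Qed.

Lemma sum_atom_ge phi psi D : (forall k, 0 <= phi k) -> (forall k, 0 <= psi k) ->
  (forall k, (D <= k)%N -> phi k <= psi k) ->
  (E phi <= (\sum_(j < D) m j * phi j)%:E + E psi)%E.
Proof.
move=> phi0 psi0 hpsi; rewrite -integral_truncated // -ge0_integralD //.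
- apply: ge0_le_integral => //.
  + by move=> k _; rewrite lee_fin.
  + move=> k _; rewrite -EFinD lee_fin; case: ltnP => hk; rewrite ?mul1r ?mul0r ?add0r ?lerDl //.
    exact: hpsi.
- by move=> k _; rewrite lee_fin mulr_ge0.
- by move=> k _; rewrite lee_fin.
Qed.

Hypotheses (mu_mean : ('E_mu[fun k : nat => k%:R%R] = 1)%E)
  (mu_third : ('E_mu[fun k : nat => ((k%:R : R) ^+ 3)%R] < +oo)%E)
  (mu_nontrivial : ~ (mu =1 @dirac _ nat 1%N R)).

Definition third_moment : R := fine (E (fun k => k%:R ^+ 3)).

Let third_momentE : (E (fun k => k%:R ^+ 3) = third_moment%:E)%E.
Proof.
rewrite fineK // ge0_fin_numE; last first.
  by apply: integral_ge0 => k _; rewrite lee_fin exprn_ge0.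
by move: mu_third; rewrite unlock.
Qed.

Let mean1 : (E (fun k => k%:R) = 1%:E)%E.
Proof. by rewrite -mu_mean unlock. Qed.

Let total1 : (E (fun=> 1) = 1%:E)%E.
Proof.
have := integral_cst mu measurableT 1%:E; rewrite mul1e => e.
by rewrite -[RHS](@probability_setT _ _ _ mu) -e.
Qed.

Let natr0 (k : nat) : 0 <= k%:R :> R. Proof. by []. Qed.

Lemma sum_atom D : \sum_(k < D) m k <= 1.
Proof.
have := @sum_atom_le (fun=> 1) D (fun=> ler01); rewrite total1 lee_fin.
by under eq_bigr do rewrite mulr1.
Qed.

Lemma sum_atom_mean D : \sum_(k < D) m k * k%:R <= 1.
Proof. by rewrite -lee_fin -mean1; apply: sum_atom_le. Qed.

Lemma sum_atom_third D : \sum_(k < D) m k * k%:R ^+ 3 <= third_moment.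
Proof. by rewrite -lee_fin -third_momentE; apply: sum_atom_le => k; rewrite exprn_ge0. Qed.

Let tail D : (0 < D)%N ->
  (E (fun k => D%:R ^- 2 * k%:R ^+ 3) = (third_moment / D%:R ^+ 2)%:E)%E.
Proof.
move=> D0; under eq_integral do rewrite EFinM.
rewrite ge0_integralZl_EFin ?third_momentE ?invr_ge0 ?exprn_ge0 //.
by rewrite -EFinM mulrC.
Qed.

Let tail_le D k : (0 < D)%N -> (D.+1 <= k)%N -> k%:R <= D%:R ^- 2 * k%:R ^+ 3 :> R.
Proof.
move=> D0 Dk; have D0' : 0 < D%:R :> R by rewrite ltr0n.
rewrite mulrC ler_pdivlMr ?exprn_gt0 // exprS ler_wpM2l //.
by rewrite expr1; apply: ler_pM => //; rewrite ler_nat ltnW.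
Qed.

Let tail_ge0 D k : 0 <= D%:R ^- 2 * k%:R ^+ 3 :> R.
Proof. by rewrite mulr_ge0 ?exprn_ge0 // invr_ge0 exprn_ge0. Qed.

(** Beyond D one has 1 <= k <= k^3 / D^2, so the third moment pays for the mass cut off, and in the
    next lemma for the mean. *)
Lemma sum_atom_lower D : (0 < D)%N -> 1 - third_moment / D%:R ^+ 2 <= \sum_(k < D.+1) m k.
Proof.
move=> D0; have := @sum_atom_ge (fun=> 1) _ D.+1 (fun=> ler01) (tail_ge0 D).
rewrite tail // total1 -EFinD lee_fin => h.
rewrite lerBlDr; apply: le_trans (h _) _ => [k Dk|].
  by apply: le_trans (tail_le D0 Dk); rewrite ler1n (leq_trans _ Dk).
by under eq_bigr do rewrite mulr1.
Qed.

Lemma sum_atom_mean_lower D : (0 < D)%N ->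
  1 - third_moment / D%:R ^+ 2 <= \sum_(k < D.+1) m k * k%:R.
Proof.
move=> D0; have := @sum_atom_ge (fun k => k%:R) _ D.+1 natr0 (tail_ge0 D).
rewrite tail // mean1 -EFinD lee_fin => h.
by rewrite lerBlDr; apply: h => k; apply: tail_le.
Qed.

Let third_ge0 : 0 <= third_moment.
Proof. by have := sum_atom_third 0; rewrite big_ord0. Qed.

Let small_tail (e : R) : 0 < e -> exists2 D, (0 < D)%N & third_moment / D%:R ^+ 2 <= e.
Proof.
move=> e0; have [D hD] := natr_large (third_moment / e).
exists D.+1 => //; rewrite ler_pdivrMr ?exprn_gt0 // -ler_pdivrMl // mulrC.
apply: le_trans (hD D.+1 (leqnSn _)) _.
by rewrite expr2 ler_peMr // ler1n.
Qed.

(** Otherwise [mu] lives on 0 and 1, mean 1 forces mass 1 at 1, and [mu] is the Dirac mass. *)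
Lemma exists_atom_gt1 : exists2 k0, (1 < k0)%N & 0 < m k0.
Proof.
apply: contrapT => no.
have m0 k : (1 < k)%N -> m k = 0.
  move=> k1; apply/eqP; rewrite eq_le atom_ge0 andbT leNgt; apply/negP => h.
  by apply: no; exists k.
have m1 : m 1%N = 1.
  apply/eqP; rewrite eq_le; apply/andP; split.
    by have := sum_atom 2; rewrite !big_ord_recr big_ord0 /= add0r; have := atom_ge0 mu 0%N; lra.
  apply/ler_addgt0Pr => e e0; have [D D0 hD] := small_tail e0.
  have := sum_atom_mean_lower D0.
  have -> : \sum_(k < D.+1) m k * k%:R = m 1%N.
    case: D D0 {hD} => // D _; rewrite big_ord_recl mulr0 add0r big_ord_recl mulr1 big1 ?addr0 //.
    by move=> i _; rewrite m0 ?mul0r.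
  by move: hD; lra.
have mu1 : mu [set 1%N] = 1%E by rewrite -[LHS]fineK ?fin_num_measure // -/(atom mu 1) m1.
apply: mu_nontrivial => A; rewrite diracE.
case: (boolP (1%N \in A)) => hA.
  apply/eqP; rewrite eq_le probability_le1 //= -mu1 le_measure ?inE //.
  by move=> x /= ->; apply: set_mem.
have : (mu ([set 1%N] `|` A) <= 1)%E by apply: probability_le1.
have dj : [set 1%N] `&` A = set0.
  by apply/seteqP; split => // x [/= ->] h; move: hA; rewrite mem_set.
have -> : (mu ([set 1%N] `|` A) = mu [set 1%N] + mu A)%E by rewrite measureU.
rewrite mu1 -[X in (_ <= X)%E]adde0 leeD2lE // => h.
by apply/eqP; rewrite eq_le h measure_ge0.
Qed.

(** With no mass at 0, the atom at [k0] > 1 would push the mean above the mass by at least [m k0];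
    the truncation error is made at most half of that. *)
Lemma atom0_gt0 : 0 < m 0%N.
Proof.
have [k0 k1 mk] := exists_atom_gt1.
rewrite lt_def atom_ge0 andbT; apply/eqP => m00.
have [D D0 hD] := small_tail (e := m k0 / 2) ltac:(by rewrite divr_gt0).
pose N := (D + k0)%N.
have N0 : (0 < N)%N by rewrite addn_gt0 D0.
have hN : third_moment / N%:R ^+ 2 <= m k0 / 2.
  apply: le_trans hD; rewrite ler_wpM2l // lef_pV2 ?posrE ?exprn_gt0 ?ltr0n //.
  by apply: lerXn2r; rewrite ?nnegrE // ler_nat leq_addr.
have k0N : (k0 < N.+1)%N by rewrite ltnS leq_addl.
have h1 := sum_atom_lower N0; have h2 := sum_atom_mean N.+1.
have h3 : \sum_(k < N.+1) m k + m k0 <= \sum_(k < N.+1) m k * k%:R.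
  rewrite (bigD1 (Ordinal k0N)) //= [leRHS](bigD1 (Ordinal k0N)) //=.
  set A := \sum_(_ < _ | _) _; set B := \sum_(_ < _ | _) _.
  have hA : A <= B.
    apply: ler_sum => -[[|i] hi] _ /=; first by rewrite m00 mul0r.
    by rewrite ler_peMr ?atom_ge0 // ler1n.
  have hk : m k0 * 2 <= m k0 * k0%:R by rewrite ler_pM2l // ler_nat.
  lra.
lra.
Qed.

End OffspringMoments.

Section JumpMoments.
Context {R : realType} {d : nat} (p : probability (lattice d) R).

Lemma expectation_itg (f : lattice d -> R) : (forall x, 0 <= f x) ->
  ('E_p[f] < +oo)%E -> itg p f.
Proof.
move=> f0; rewrite unlock => h; apply/integrableP; split => //.
by rewrite (eq_integral (fun x => (f x)%:E)) // => x _ /=; rewrite ger0_norm.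
Qed.

Lemma enorm_ge0 (x : lattice d) : 0 <= enorm R x.
Proof. exact: sqrtr_ge0. Qed.

Lemma expr_le_1D (a : R) i j : (i <= j)%N -> 0 <= a -> a ^+ i <= 1 + a ^+ j.
Proof.
move=> ij a0; have [a1|a1] := leP a 1.
  by apply: (@le_trans _ _ 1); [rewrite exprn_ile1 | rewrite lerDl exprn_ge0].
by apply: le_trans (ler_weXn2l (ltW a1) ij) _; rewrite lerDr.
Qed.

Lemma lcoord_expr_itg k (i : 'I_d) : (k <= d.+1)%N ->
  ('E_p[fun x => (enorm R x ^+ d.+1)%R] < +oo)%E ->
  itg p (fun x => lcoord R i x ^+ k).
Proof.
move=> kd h.
have hi : itg p (fun x => 1 + enorm R x ^+ d.+1).
  apply: itgD; first by apply: itg_bnd; apply: bnd_cst.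
  by apply: expectation_itg => // x; rewrite exprn_ge0 // enorm_ge0.
apply: (le_integrable measurableT) hi => // x _ /=.
rewrite lee_fin normrX [leRHS]ger0_norm; last by rewrite addr_ge0 // exprn_ge0 // enorm_ge0.
apply: le_trans (expr_le_1D kd (enorm_ge0 x)).
by apply: lerXn2r; rewrite ?nnegrE ?enorm_ge0 // lcoord_le_enorm.
Qed.

Lemma expectation_mean (f : lattice d -> R) (c : R) : ('E_p[f] = c%:E)%E -> mean p f = c.
Proof. by rewrite unlock /mean /Rintegral => ->. Qed.

End JumpMoments.

(** * Capacity and energy of the range *)

Section CapacityOfFiniteSets.
Context {disp : measure_display} {Omega : measurableType disp} {R : realType}
  (P : probability Omega R) {d : nat} (eta : probability (lattice d) R)
  (xi : nat -> {RV P >-> lattice d}).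
Hypothesis hxi : iid_steps eta xi.
Implicit Types (A vs : seq (lattice d)) (L n : nat).

Lemma capacity_cvg A : uniq A ->
  (fun L => \sum_(y <- A) esc eta A L y) @ \oo --> capacity xi [set` A].
Proof.
move=> uA; rewrite /capacity -fsbig_seq //.
have h (s : seq (lattice d)) : (fun L => \sum_(y <- s) esc eta A L y) @ \oo -->
    \sum_(y <- s) fine (P (no_return xi [set` A] y)).
  elim: s => [|y s IH].
    rewrite big_nil (_ : (fun _ => _) = fun=> 0); last by apply/funext => L; rewrite big_nil.
    exact: cvg_cst.
  rewrite big_cons (_ : (fun _ => _) =
      (fun L => esc eta A L y + \sum_(y <- s) esc eta A L y)); last first.
    by apply/funext => L; rewrite big_cons.
  by apply: cvgD => //; apply: no_return_cvg.
exact: h.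
Qed.

Lemma capacity_le_esc A L : uniq A -> capacity xi [set` A] <= \sum_(y <- A) esc eta A L y.
Proof.
move=> uA; have h := capacity_cvg uA.
rewrite -(cvg_lim (@Rhausdorff R) h).
apply: (nonincreasing_cvgn_ge (u_ := fun L => \sum_(y <- A) esc eta A L y)).
  by move=> K L' KL; apply: ler_sum => y _; apply: le_esc.
by apply/cvg_ex; exists (capacity xi [set` A]).
Qed.

Lemma capacity_esc_le A eps : uniq A -> 0 < eps -> exists K0, forall K, (K0 <= K)%N ->
  \sum_(y <- A) esc eta A K y <= capacity xi [set` A] + eps.
Proof.
move=> uA e0; have /cvgrPdist_le /(_ _ e0) [K0 _ hK] := capacity_cvg uA.
exists K0 => K /hK /=; rewrite distrC ler_norml => /andP[_]; by rewrite lerBlDl.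
Qed.

Lemma set_undup vs : [set` vs] = [set` undup vs].
Proof. by apply/seteqP; split => x /=; rewrite mem_undup. Qed.

Lemma capacity_seq_upper : (2 < d)%N ->
  (forall i : 'I_d, itg eta (lcoord R i)) ->
  (forall i : 'I_d, itg eta (fun x => lcoord R i x ^+ 2)) ->
  (forall i : 'I_d, mean eta (lcoord R i) = 0) ->
  exists2 C : R, 0 < C & forall (r : nat) vs, (0 < r)%N ->
  (forall v i, v \in vs -> `|lcoord R i v| <= r%:R) ->
  capacity xi [set` vs] <= C * r%:R ^+ (d - 2).
Proof.
move=> d2 h1 h2 h3; have [C C0 hC] := capacity_upper h1 h2 h3.
exists C => // r vs r0 hr; rewrite set_undup.
have r0' : 0 < r%:R :> R by rewrite ltr0n.
rewrite -(ler_pM2r (exprn_gt0 2 r0')) -mulrA -exprD subnK ?(ltnW d2) //.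
apply: (hC r (undup vs)) => //; first exact: undup_uniq.
  by move=> v i; rewrite mem_undup; apply: hr.
by move=> L; apply: capacity_le_esc; apply: undup_uniq.
Qed.

(** Repeated positions count both in [size vs] and in the energy; only the capacity forgets them,
    hence [undup]. *)
Lemma capacity_seq_lower (C : R) vs (M : R) : (2 < d)%N -> (0 < size vs)%N ->
  (forall n x, heat eta n x <= C * rsq n ^+ d) -> 0 < M ->
  (forall n, \sum_(u <- vs) potential eta vs n u <= M) ->
  (size vs)%:R ^+ 2 <= 4 * M * capacity xi [set` vs].
Proof.
move=> d2 s0 hC M0 hM; rewrite [in capacity xi _]set_undup.
apply: (@capacity_lower R d eta C (undup vs) vs) => //; first exact: undup_uniq.
- by move=> v; rewrite mem_undup.
- by move=> eps e0; apply: capacity_esc_le => //; apply: undup_uniq.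
Qed.

(** The energy is cut at one fixed time N, for which its expectation can be bounded; the remainder
    is uniform in the horizon and vanishes as N grows. *)
Lemma potential_le_tail (C : R) vs N n : (2 < d)%N -> 0 < C ->
  (forall n x, heat eta n x <= C * rsq n ^+ d) ->
  \sum_(u <- vs) potential eta vs n u <=
  \sum_(u <- vs) potential eta vs N u + (size vs)%:R ^+ 2 * (3 * C * rsq N).
Proof.
move=> d2 C0 hC.
have sum_cst (c : R) : \sum_(v <- vs) c = (size vs)%:R * c.
  by rewrite big_const_seq count_predT iter_addr addr0 mulr_natl.
have h u : potential eta vs n u <= potential eta vs N u + (size vs)%:R * (3 * C * rsq N).
  rewrite -sum_cst.
  by rewrite -big_split; apply: ler_sum => v _; apply: sum_heat_tail.
apply: le_trans (ler_sum _ (fun u _ => h u)) _.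
by rewrite big_split /= lerD2l sum_cst mulrA -expr2.
Qed.

(** A crude energy bound from the heat kernel suffices. Positivity is what allows the logarithm of
    the capacity to be taken. *)
Lemma capacity_seq_gt0 vs : (2 < d)%N -> irreducible_chain (walk_kernel eta) ->
  (0 < size vs)%N -> 0 < capacity xi [set` vs].
Proof.
move=> d2 irr s0; have [C C0 hC] := heat_kernel_bound (ltn_trans (isT : (0 < 2)%N) d2) irr.
have hC' n x : heat eta n x <= C * rsq n ^+ d by apply: (hC eta n 0%N x).
pose M := (size vs)%:R ^+ 2 * (3 * C * rsq 0) : R.
have s0' : 0 < (size vs)%:R ^+ 2 :> R by rewrite exprn_gt0 // ltr0n.
have M0 : 0 < M by rewrite mulr_gt0 // mulr_gt0 ?rsq_gt0 // mulr_gt0.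
have h := @capacity_seq_lower C vs M d2 s0 hC' M0 _.
have {}h : (size vs)%:R ^+ 2 <= 4 * M * capacity xi [set` vs].
  apply: h => n; apply: le_trans (@potential_le_tail C vs 0 n d2 C0 hC') _.
  by rewrite big1 ?add0r // => u _; rewrite /potential big1 // => v _; rewrite big_ord0.
rewrite ltNge; apply/negP => c0; move: (lt_le_trans s0' h); rewrite ltNge => /negP; apply.
by rewrite mulr_ge0_le0 // mulr_ge0 // ltW.
Qed.

End CapacityOfFiniteSets.

Section TreeEstimates.
Context {disp : measure_display} {Omega : measurableType disp} {R : realType}
  (P : probability Omega R) {d : nat} (mu : probability nat R)
  (theta eta : probability (lattice d) R)
  (k : seq nat -> {RV P >-> nat}) (X : seq nat -> {RV P >-> lattice d}).
Hypotheses (hkX : branching_walk mu theta k X) (sym : symmetric_law theta).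
Implicit Types (t : ptree) (u v : seq nat) (n : nat).
Local Notation m := (atom mu).
Local Notation pos w u := (position (X ^~ w) u).

Definition positions t w : seq (lattice d) := [seq pos w u | u <- verts t].

Definition energy N t w : R :=
  \sum_(u <- positions t w) potential eta (positions t w) N u.

Lemma position_fibers u (B : set (lattice d)) : measurable [set w | B (pos w u)].
Proof.
have e : (fun w => pos w u) = signed_sum X [seq (l, true) | l <- labels [::] u].
  apply/funext => w; rewrite position_labels /signed_sum big_map /=.
  by apply: eq_bigr.
have := measurable_signed_sum X [seq (l, true) | l <- labels [::] u] measurableT
  (_ : measurable B).
by rewrite setTI -e; apply.
Qed.

Lemma positions_fibers t (s : seq (lattice d)) : measurable [set w | positions t w = s].
Proof.
rewrite /positions; elim: (verts t) s => [|u r IH] [|z s] /=.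
- by rewrite (_ : [set _ | _] = setT) //; apply/seteqP; split.
- by rewrite (_ : [set _ | _] = set0) //; apply/seteqP; split => // w.
- by rewrite (_ : [set _ | _] = set0) //; apply/seteqP; split => // w.
rewrite (_ : [set _ | _] = [set w | [set z] (pos w u)] `&` [set w | [seq pos w u | u <- r] = s]).
  by apply: measurableI => //; exact: position_fibers.
by apply/seteqP; split => w /= [-> ->].
Qed.

(** The positions along [t] take countably many values, so every condition on them is measurable,
    including one on the capacity. *)
Lemma measurable_positions_event t (Q : set (seq (lattice d))) :
  measurable [set w | Q (positions t w)].
Proof.
rewrite (_ : [set _ | _] = \bigcup_(s in Q) [set w | positions t w = s]).
  rewrite bigcup_mkcond; apply: countable_bigcupT_measurable; first exact: countableP.
  by move=> s; case: ifP => _ //; exact: positions_fibers.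
by apply/seteqP; split => w /=; [move=> h; exists (positions t w) | move=> [s /= h ->]].
Qed.

Lemma measurable_positions (d' : measure_display) (T : sigmaRingType d') t
  (g : seq (lattice d) -> T) D : measurable D -> measurable_fun D (fun w => g (positions t w)).
Proof.
move=> mD _ B mB; apply: measurableI => //.
exact: (measurable_positions_event t [set s | B (g s)]).
Qed.

Lemma size_verts_lt t H u : generation H t = 0%N -> u \in verts t -> (size u < H)%N.
Proof.
elim: u H t => [|i u IH] [|H] [ts] //= hH.
rewrite -[_ \in _]/(i :: u \in verts (PNode ts)) mem_verts => /andP[hi hu].
by rewrite ltnS; apply: (IH _ (nth (PNode [::]) ts i)) => //; apply: (generationS0 (Ordinal hi) hH).
Qed.

(** The displacement bound is applied to the path from the root to [u], shorter than H. *)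
Lemma prob_far (C eps : R) t u H (i : 'I_d) (r : R) :
  (forall h n i (r : R), (n <= h)%N ->
    iter n (step theta) (fun x => (r < `|lcoord R i x|)%R%:R) 0 <= expR (C - eps * rsq h * r)) ->
  generation H t = 0%N -> u \in verts t ->
  (P (tree_event k t `&` [set w | (r < `|lcoord R i (pos w u)|)%R]) <=
    (tweight m t * expR (C - eps * rsq H * r))%:E)%E.
Proof.
move=> hdisp hH hu; set f := fun x : lattice d => (r < `|lcoord R i x|)%R%:R : R.
have mE := measurable_tree_event k t.
have mF : measurable [set w | r < `|lcoord R i (pos w u)|].
  exact: (position_fibers u [set z | r < `|lcoord R i z|]).
have := integral_tree_event hkX t u [::] sym (bnd_bool (fun x : lattice d => r < `|lcoord R i x|)%R)
  (fun x => ler0n _ _).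
have -> : dist u [::] = size u by case: (u) => [|? ?] //=; rewrite addn0.
rewrite (eq_integral (fun w => (\1_[set w | r < `|lcoord R i (pos w u)|] w)%:E)); last first.
  move=> w _; rewrite (_ : position _ [::] = 0); last by rewrite /position big_ord0.
  rewrite subr0 indicE; congr ((nat_of_bool _)%:R%:E).
  by apply/idP/idP => [h|/set_mem //]; rewrite mem_set.
rewrite integral_indic // setIC => ->.
rewrite lee_fin; apply: ler_wpM2l; first by apply: tweight_ge0; exact: atom_ge0.
by apply: hdisp; apply: ltnW; apply: size_verts_lt hu.
Qed.

(** Markov's inequality: each pair contributes the Green function averaged over [dist u v] steps of
    [theta]. *)
Lemma prob_energy (C : R) N t (M : R) : 0 < M ->
  (forall j N x, iter j (step theta) (fun y => \sum_(i < N) heat eta i y) x <= C * rsq j ^+ (d - 2)) ->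
  (P (tree_event k t `&` [set w | (M <= energy N t w)%R]) <=
    (tweight m t * (\sum_(u <- verts t) \sum_(v <- verts t) C * rsq (dist u v) ^+ (d - 2)) / M)%:E)%E.
Proof.
move=> M0 hG; have mE := measurable_tree_event k t.
have mf : measurable_fun (tree_event k t) (fun w => (energy N t w)%:E).
  exact: (measurable_positions t (fun s => (\sum_(u <- s) potential eta s N u)%:E) mE).
have e0 w : 0 <= energy N t w by apply: sumr_ge0 => u _; exact: potential_ge0.
have markov := le_integral_abse P mE mf M0.
have eset : tree_event k t `&` [set w | (M%:E <= `|(energy N t w)%:E|)%E] =
    tree_event k t `&` [set w | (M <= energy N t w)%R].
  by congr (_ `&` _); apply/seteqP; split => w /=; rewrite lee_fin ger0_norm.
rewrite eset in markov.
rewrite -(@lee_pmul2l _ M%:E) // ?lte_fin //.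
apply: le_trans markov _.
pose G (y : lattice d) := \sum_(i < N) heat eta i y.
have bG : bnd G by apply: bnd_sum => i; exact: bnd_heat.
have G0 y : 0 <= G y by apply: sumr_ge0 => i _; exact: heat_ge0.
have -> : (\int[P]_(w in tree_event k t) `|(energy N t w)%:E| =
   \sum_(u <- verts t) \sum_(v <- verts t) \int[P]_(w in tree_event k t) (G (pos w u - pos w v))%:E)%E.
  have mG u v : measurable_fun (tree_event k t) (fun w => (G (pos w u - pos w v))%:E).
    move=> _ B mB; apply: measurableI => //.
    rewrite (_ : _ @^-1` B = \bigcup_(z in [set: lattice d]) ([set w | [set z] (pos w u)] `&`
       [set w | [set z' | B (G (z - z'))%:E] (pos w v)])).
      apply: countable_bigcupT_measurable; first exact: countableP.
      by move=> z; apply: measurableI; exact: position_fibers.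
    by apply/seteqP; split => w /=; [move=> h; exists (pos w u) | move=> [z _ [/= ->]]].
  under [RHS]eq_bigr => u _.
    rewrite -ge0_integral_sum //; last by move=> v w _; rewrite lee_fin.
    over.
  rewrite -ge0_integral_sum //; first last.
  - by move=> u w _; apply: sume_ge0 => v _; rewrite lee_fin.
  - by move=> u; apply: emeasurable_sum.
  apply: eq_integral => w _; rewrite gee0_abs ?lee_fin // /energy /positions big_map -sumEFin.
  by apply: eq_bigr => u _; rewrite /potential big_map -sumEFin.
have intE u v : (\int[P]_(w in tree_event k t) (G (pos w u - pos w v))%:E =
   (tweight m t * iter (dist u v) (step theta) G 0)%:E)%E.
  exact: integral_tree_event.
under eq_bigr => u _ do [under eq_bigr => v _ do rewrite intE; rewrite sumEFin].
rewrite sumEFin -EFinM lee_fin mulrC mulrVK ?unitfE ?gt_eqF // mulr_sumr.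
apply: ler_sum => u _; rewrite mulr_sumr; apply: ler_sum => v _.
by apply: ler_wpM2l; [apply: tweight_ge0; exact: atom_ge0 | exact: hG].
Qed.

End TreeEstimates.

Section UnionBound.
Context {disp : measure_display} {Omega : measurableType disp} {R : realType}
  (P : probability Omega R).

Lemma measure_le_sum_seq (I : eqType) (s : seq I) (F : I -> set Omega) (A : set Omega) :
  (forall i, measurable (F i)) -> measurable A ->
  (forall w, A w -> exists2 i, i \in s & F i w) ->
  (P A <= \sum_(i <- s) P (F i))%E.
Proof.
move=> mF; elim: s A => [|i s IH] A mA h.
  by rewrite big_nil (_ : A = set0) ?measure0 //; apply/seteqP; split => // w /h[].
rewrite big_cons; have -> : A = (A `&` F i) `|` (A `\` F i) by rewrite setUIDK.
apply: le_trans (measureU2 _ _ _) _; [exact: measurableI | exact: measurableD |].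
apply: leeD; first by apply: le_measure; rewrite ?inE //; exact: measurableI.
apply: IH; first exact: measurableD.
move=> w [Aw nF]; have [j] := h w Aw; rewrite inE => /orP[/eqP ->|hj] // Fj.
by exists j.
Qed.

End UnionBound.

Lemma three_lt H n h a b : (6 * H <= n)%N -> (h < H)%N -> (a < H)%N -> (b < H)%N ->
  (h + a + b < 3 * H)%N /\ (2 * (h + a + b) <= n)%N.
Proof. lia. Qed.

Lemma sqr_double_ge n : (0 < n)%N -> (n.+1 <= 2 ^ 2 * n ^ 2)%N.
Proof. by move=> n0; rewrite -!mulnn; nia. Qed.

Lemma sum_mul_le (R : realDomainType) (x1 x2 x3 y1 y2 y3 : R) :
  0 <= x1 -> 0 <= x2 -> 0 <= x3 -> 0 <= y1 -> 0 <= y2 -> 0 <= y3 ->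
  x1 * y1 + x2 * y2 + x3 * y3 <= (x1 + x2 + x3) * (y1 + y2 + y3).
Proof.
move=> a1 a2 a3 b1 b2 b3; rewrite mulrDl mulrDl.
apply: lerD; first apply: lerD; apply: ler_wpM2l => //.
- by rewrite -addrA lerDl addr_ge0.
- by rewrite addrAC lerDr addr_ge0.
- by rewrite lerDr addr_ge0.
Qed.

(** * Union bound over tree shapes, vertices and coordinates *)

Section BadEvents.
Context {disp : measure_display} {Omega : measurableType disp} {R : realType}
  (P : probability Omega R) {d : nat} (mu : probability nat R)
  (theta eta : probability (lattice d) R)
  (k : seq nat -> {RV P >-> nat}) (X : seq nat -> {RV P >-> lattice d}).
Hypotheses (hkX : branching_walk mu theta k X) (sym : symmetric_law theta)
  (hd : d \in [:: 3; 4; 5]%N)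
  (mu_mean : ('E_mu[fun k : nat => k%:R%R] = 1)%E)
  (mu_third : ('E_mu[fun k : nat => ((k%:R : R) ^+ 3)%R] < +oo)%E)
  (mu_nontrivial : ~ (mu =1 @dirac _ nat 1%N R))
  (eta_irr : irreducible_chain (walk_kernel eta))
  (theta_irr : irreducible_chain (walk_kernel theta))
  (theta_exp : exists lambda : R, 0 < lambda /\
    ('E_theta[fun x => expR (lambda * enorm R x)%R] < +oo)%E).
Local Notation m := (atom mu).
Local Notation pos w u := (position (X ^~ w) u).

Let d2 : (2 < d)%N.
Proof. by move: hd; rewrite !inE => /or3P[] /eqP ->. Qed.

(** [B] is known only through what excludes it: on the shape [t] it cannot hold when all positions
    lie within r and the energy is below M. It is therefore covered by n d displacement events and
    one energy event. *)
Lemma prob_tree_bad (C eps Cg : R) n Hc N (r M : R) B t :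
  (forall h n i (r : R), (n <= h)%N ->
    iter n (step theta) (fun x => (r < `|lcoord R i x|)%R%:R) 0 <= expR (C - eps * rsq h * r)) ->
  (forall j N x, iter j (step theta) (fun y => \sum_(i < N) heat eta i y) x <= Cg * rsq j ^+ (d - 2)) ->
  measurable B -> 0 < M -> psize t = n -> generation Hc t = 0%N ->
  (forall w, tree_event k t w -> B w ->
     (forall u (i : 'I_d), u \in verts t -> `|lcoord R i (pos w u)| <= r) ->
     energy eta X N t w < M -> False) ->
  (P (B `&` tree_event k t) <= (tweight m t * (n%:R * d%:R * expR (C - eps * rsq Hc * r)) +
    tweight m t * (\sum_(u <- verts t) \sum_(v <- verts t) Cg * rsq (dist u v) ^+ (d - 2)) / M)%:E)%E.
Proof.
move=> hC hG mB M0 pt gt hbad.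
have mE := measurable_tree_event k t.
pose far (ui : seq nat * 'I_d) : set Omega :=
  tree_event k t `&` [set w | (r < `|lcoord R ui.2 (pos w ui.1)|)%R].
have mfar ui : measurable (far ui).
  apply: measurableI => //.
  exact: (position_fibers X ui.1 [set z | r < `|lcoord R ui.2 z|]).
pose loaded : set Omega := tree_event k t `&` [set w | (M <= energy eta X N t w)%R].
have mload : measurable loaded.
  apply: measurableI => //.
  exact: (measurable_positions_event X t [set s | M <= \sum_(u <- s) potential eta s N u]).
pose s := [seq (u, i) | u <- verts t, i <- enum 'I_d].
pose F (o : option (seq nat * 'I_d)) := if o is Some ui then far ui else loaded.
have mF o : measurable (F o) by case: o.
apply: le_trans (@measure_le_sum_seq _ _ _ P _ (None :: [seq Some ui | ui <- s]) F _ mF _ _) _.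
- exact: measurableI.
- move=> w [Bw Ew]; apply: contrapT => no.
  apply: (hbad w Ew Bw) => [u i hu|].
    rewrite leNgt; apply/negP => hr; apply: no; exists (Some (u, i)) => //.
    rewrite inE map_f ?orbT //; apply/allpairsP; exists (u, i); split => //=.
    by rewrite mem_enum.
  by rewrite ltNge; apply/negP => hM; apply: no; exists None; rewrite ?inE ?eqxx.
rewrite big_cons addeC EFinD; apply: leeD; last exact: (prob_energy hkX sym N t M0 hG).
rewrite big_map big_allpairs_dep /=.
have h u : u \in verts t -> (\sum_(i <- enum 'I_d) P (F (Some (u, i))) <=
   (tweight m t * (d%:R * expR (C - eps * rsq Hc * r)))%:E)%E.
  move=> hu; rewrite mulrCA -[X in (X%:R * _)](card_ord d) mulr_natl -sumr_const -sumEFin big_enum /=.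
  by apply: lee_sum => i _; exact: (prob_far hkX sym i r hC gt hu).
rewrite big_seq; apply: le_trans (lee_sum _ h) _.
rewrite -big_seq sumEFin lee_fin big_const_seq count_predT iter_addr addr0 size_verts pt.
by rewrite -mulr_natl le_eqVlt; apply/orP; left; apply/eqP; ring.
Qed.

(** Sums over shapes are divided by the total weight, at least [kap * q] with q of order n^(-3/2).
    In the energy term this cancels the n^(-3/2) of [pair_count]; in the height term 1/q <= 2 n^2
    explains the factor n^2; the displacement term holds shape by shape and loses nothing. The power
    10 - d of the root of [Hc] collects Hc for the sum over h, Hc for the linear factor, and
    Hc^((6-d)/2) for the sum over a and b. *)
Lemma bad_event_bound : exists K c : R, exists n0, [/\ 0 < K, 0 < c &
  forall n Hc N (r M : R) B, (n0 <= n)%N -> (6 * Hc <= n)%N -> measurable B -> 0 < M -> 0 <= r ->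
  (0 < P (tree_size_event k n))%E ->
  (forall t w, psize t = n -> generation Hc t = 0%N -> tree_event k t w -> B w ->
     (forall u (i : 'I_d), u \in verts t -> `|lcoord R i (pos w u)| <= r) ->
     energy eta X N t w < M -> False) ->
  cond_prob P B (tree_size_event k n) <=
    K * (n%:R ^+ 2 * expR (- (c * rsq n * Hc%:R)) + n%:R * expR (- (c * rsq Hc * r))
       + Num.sqrt Hc%:R ^+ (10 - d) / M)].
Proof.
have m0 := atom_ge0 mu.
have hs := sum_atom mu; have hm := sum_atom_mean mu_mean; have h3 := sum_atom_third mu_third.
have hs' := sum_atom_lower mu_third; have hm' := sum_atom_mean_lower mu_mean mu_third.
have hm0 := atom0_gt0 mu_mean mu_third mu_nontrivial.
have [k0 k1 mk0] := exists_atom_gt1 mu_mean mu_third mu_nontrivial.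
have [Cp Cp0 hp] := pair_count m0 hs hm h3 hm0 k1 mk0.
have [kap kap0 [n1 hkap]] := tree_size_lower m0 hs hm h3 hs' hm' hm0 k1 mk0.
have [ch ch0 [n2 hh]] := height_tail m0 hs hm h3 hm' k1 mk0.
have [lam [lam0 hlam]] := theta_exp.
have itlam : itg theta (fun x => expR (lam * enorm R x)).
  by apply: expectation_itg => // x; apply: expR_ge0.
have [C [eps eps0 hC]] := displacement_tail sym lam0 itlam.
have [Cg Cg0 hG] := walk_green_bound d2 theta_irr eta_irr.
pose K1 := 2 * expR 2 / kap; pose K2 := d%:R * expR C; pose K3 := 18 * Cp * Cg / kap.
have K10 : 0 < K1 by rewrite divr_gt0 // mulr_gt0 // expR_gt0.
have K20 : 0 < K2 by rewrite mulr_gt0 ?expR_gt0 // ltr0n (ltn_trans _ d2).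
have K30 : 0 < K3 by rewrite divr_gt0 // !mulr_gt0.
exists (K1 + K2 + K3), (Num.min ch eps), (maxn (maxn n1 n2) (maxn k0 1)); split.
- by rewrite !addr_gt0.
- by rewrite lt_min ch0.
move=> n Hc N r M B; rewrite !geq_max => /andP[/andP[n1n n2n] /andP[k0n n0]] Hcn mB M0 r0 pS hbad.
have nR : 0 < n%:R :> R by rewrite ltr0n.
set S := \sum_(t <- trees n n | psize t == n) tweight m t.
have PS : P (tree_size_event k n) = S%:E := prob_tree_size_event hkX n.
have S0 : 0 < S by rewrite -lte_fin -PS.
pose q : R := rsq n / n%:R; have q0 : 0 < q by rewrite divr_gt0 // rsq_gt0.
have kS : kap * q <= S by apply: hkap.
set E1 := expR (2 - ch * rsq n * Hc%:R).
set E2 := n%:R * d%:R * expR (C - eps * rsq Hc * r).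
set W := fun t => \sum_(u <- verts t) \sum_(v <- verts t) Cg * rsq (dist u v) ^+ (d - 2).
set sH := Num.sqrt Hc%:R : R.
have sH0 : 0 <= sH by rewrite sqrtr_ge0.
have tw0 t : 0 <= tweight m t by apply: tweight_ge0.
have W0 t : 0 <= W t.
  apply: sumr_ge0 => u _; apply: sumr_ge0 => v _.
  by rewrite mulr_ge0 ?(ltW Cg0) // exprn_ge0 // rsq_ge0.
have E20 : 0 <= E2 by rewrite mulr_ge0 ?expR_ge0 // mulr_ge0.
(* Trees reaching generation [Hc] are given up entirely: the number of vertices there is at least 1,
   and its weighted sum is what [height_tail] bounds. *)
have tree_le t : psize t == n -> (P (B `&` tree_event k t) <=
   (tweight m t * (generation Hc t)%:R + tweight m t * E2 +
    (generation Hc t == 0)%:R * (tweight m t * W t) / M)%:E)%E.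
  move=> /eqP pt; case: eqP => [gt|/eqP gt].
    rewrite gt mulr0 add0r mul1r; apply: (prob_tree_bad (N := N)) => //.
    by move=> w Ew Bw; apply: hbad.
  apply: (@le_trans _ _ (P (tree_event k t))).
    apply: le_measure; rewrite ?inE //; first exact: measurableI (measurable_tree_event k t).
      exact: measurable_tree_event.
  rewrite (prob_tree_event hkX) lee_fin mul0r mul0r addr0 -[leLHS]addr0 lerD ?mulr_ge0 //.
  by rewrite ler_peMr // ler1n lt0n.
have sumW : \sum_(t <- trees n n | psize t == n) (generation Hc t == 0)%:R * (tweight m t * W t)
    <= 18 * Cp * Cg * q * sH ^+ (10 - d).
  pose g a b : R := Cg * rsq (a + b) ^+ (d - 2).
  have g0 a b : 0 <= g a b by rewrite mulr_ge0 ?(ltW Cg0) // exprn_ge0 // rsq_ge0.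
  apply: (@le_trans _ _ (\sum_(t <- trees n n | psize t == n) tweight m t *
     \sum_(h < Hc) \sum_(a < Hc) \sum_(b < Hc) (npairs h a b t)%:R * g a b)).
    apply: ler_sum => t _; case: eqP => [gt|_].
      rewrite mul1r ler_wpM2l // /W.
      by rewrite (sum_verts_dist (fun j => Cg * rsq j ^+ (d - 2)) gt (leqnn _)).
    rewrite mul0r mulr_ge0 //; apply: sumr_ge0 => h _; apply: sumr_ge0 => a _.
    by apply: sumr_ge0 => b _; rewrite mulr_ge0.
  have -> : \sum_(t <- trees n n | psize t == n) tweight m t *
     (\sum_(h < Hc) \sum_(a < Hc) \sum_(b < Hc) (npairs h a b t)%:R * g a b) =
     \sum_(h < Hc) \sum_(a < Hc) \sum_(b < Hc) g a b *
       \sum_(t <- trees n n | psize t == n) tweight m t * (npairs h a b t)%:R.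
    under eq_bigr => t _ do rewrite mulr_sumr.
    rewrite exchange_big; apply: eq_bigr => h _.
    under eq_bigr => t _ do rewrite mulr_sumr.
    rewrite exchange_big; apply: eq_bigr => a _.
    under eq_bigr => t _ do rewrite mulr_sumr.
    rewrite exchange_big; apply: eq_bigr => b _.
    by rewrite mulr_sumr; apply: eq_bigr => t _; rewrite mulrA mulrC.
  apply: (@le_trans _ _ (\sum_(h < Hc) \sum_(a < Hc) \sum_(b < Hc)
      g a b * (Cp * (3 * Hc%:R) * q))).
    apply: ler_sum => h _; apply: ler_sum => a _; apply: ler_sum => b _.
    apply: ler_wpM2l => //.
    have [l1 l2] := three_lt Hcn (ltn_ord h) (ltn_ord a) (ltn_ord b).
    apply: le_trans (hp n n n h a b k0n n0 l2) _.
    by rewrite -/q ler_pM2r // ler_pM2l // -natrM ler_nat.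
  have hg : \sum_(a < Hc) \sum_(b < Hc) g a b <= Cg * (6 * sH ^+ (6 - d)).
    rewrite (eq_bigr (fun a : 'I_Hc => Cg * \sum_(b < Hc) rsq (a + b) ^+ (d - 2))); last first.
      by move=> a _; rewrite mulr_sumr.
    by rewrite -mulr_sumr ler_pM2l // sum_rsq_pairs.
  under eq_bigr => h _ do under eq_bigr => a _ do rewrite -mulr_suml.
  under eq_bigr => h _ do rewrite -mulr_suml.
  rewrite sumr_const card_ord -[leLHS]mulr_natl.
  have HcE : Hc%:R = sH ^+ 2 :> R by rewrite sqr_sqrtr.
  have sHd : sH ^+ (10 - d) = sH ^+ 2 * sH ^+ 2 * sH ^+ (6 - d).
    by rewrite -!exprD; congr (_ ^+ _); move: hd; rewrite !inE => /or3P[] /eqP ->.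
  rewrite sHd HcE; move: (sH ^+ 2) (sqr_ge0 sH) => x x0.
  have cq : 0 <= Cp * (3 * x) * q by rewrite mulr_ge0 ?(ltW q0) // mulr_ge0 ?(ltW Cp0) // mulr_ge0.
  apply: (@le_trans _ _ (x * (Cg * (6 * sH ^+ (6 - d)) * (Cp * (3 * x) * q)))).
    by rewrite ler_wpM2l // ler_wpM2r.
  by rewrite le_eqVlt; apply/orP; left; apply/eqP; ring.
have mBS : measurable (B `&` tree_size_event k n).
  by apply: measurableI => //; exact: measurable_tree_size_event.
have total : fine (P (B `&` tree_size_event k n)) <=
    E1 + S * E2 + 18 * Cp * Cg * q * sH ^+ (10 - d) / M.
  rewrite -lee_fin fineK ?fin_num_measure //.
  apply: le_trans (prob_tree_size_eventI_le k n mB) _.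
  apply: le_trans (lee_sum _ tree_le) _.
  rewrite sumEFin lee_fin !big_split /= -mulr_suml -mulr_suml -/S.
  apply: lerD; last by rewrite ler_pM2r ?invr_gt0.
  by rewrite lerD2r; apply: hh.
rewrite /cond_prob PS [fine _%:E]/=.
rewrite ler_pdivrMr //; apply: le_trans total _.
set c := Num.min ch eps.
have cch : c <= ch by rewrite ge_min lexx.
have ceps : c <= eps by rewrite ge_min lexx orbT.
set e1 := expR (- (c * rsq n * Hc%:R)); set e2 := expR (- (c * rsq Hc * r)).
set x := sH ^+ (10 - d) / M.
have x0 : 0 <= x by rewrite divr_ge0 ?exprn_ge0 // ltW.
have e10 : 0 <= e1 by apply: expR_ge0.
have e20 : 0 <= e2 by apply: expR_ge0.
have rn0 : 0 <= rsq n :> R by apply: rsq_ge0.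
have hE1 : E1 <= expR 2 * e1.
  rewrite /E1 /e1 -expRD ler_expR lerD2l lerN2 ler_wpM2r // ler_wpM2r //.
have hE2 : E2 <= K2 * (n%:R * e2).
  rewrite /E2 /K2 /e2 [leRHS]mulrACA -[leRHS]mulrA [d%:R * _]mulrC -[leRHS]mulrA.
  rewrite [X in _ <= X](_ : _ = n%:R * d%:R * (expR C * e2)); last by rewrite /e2; ring.
  rewrite ler_wpM2l ?mulr_ge0 // /e2 -expRD ler_expR lerD2l lerN2.
  by rewrite ler_wpM2r // ler_wpM2r // rsq_ge0.
have hq : 1 <= 2 * n%:R ^+ 2 * q.
  have h1 : 1 <= 2 * n%:R * rsq n :> R.
    rewrite -(@ler_pXn2r _ 2) ?nnegrE ?mulr_ge0 // expr1n exprMn rsq_sqr.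
    rewrite ler_pdivlMr ?ltr0n // mul1r exprMn -!natrX -natrM ler_nat.
    exact: sqr_double_ge.
  rewrite /q (_ : _ * _ = 2 * n%:R * rsq n) //.
  by rewrite expr2; field; rewrite gt_eqF.
have t1 : E1 <= K1 * (n%:R ^+ 2 * e1) * S.
  apply: le_trans hE1 _.
  apply: (@le_trans _ _ (K1 * (n%:R ^+ 2 * e1) * (kap * q))); last first.
    by rewrite ler_wpM2l // mulr_ge0 ?(ltW K10) // mulr_ge0 // exprn_ge0.
  rewrite (_ : K1 * _ * _ = expR 2 * e1 * (2 * n%:R ^+ 2 * q)); last first.
    by rewrite /K1; field; rewrite gt_eqF.
  by rewrite ler_peMr // mulr_ge0 // expR_ge0.
have t2 : S * E2 <= K2 * (n%:R * e2) * S by rewrite mulrC ler_pM2r.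
have t3 : 18 * Cp * Cg * q * sH ^+ (10 - d) / M <= K3 * x * S.
  rewrite (_ : _ / M = K3 * x * (kap * q)); last first.
    by rewrite /K3 /x; field; rewrite !gt_eqF.
  by rewrite ler_wpM2l // mulr_ge0 // ltW.
apply: le_trans (lerD (lerD t1 t2) t3) _.
rewrite -!mulrDl ler_pM2r //.
have a0 : 0 <= n%:R ^+ 2 * e1 by rewrite mulr_ge0 // exprn_ge0.
have b0 : 0 <= n%:R * e2 by rewrite mulr_ge0.
exact: sum_mul_le (ltW K10) (ltW K20) (ltW K30) a0 b0 x0.
Qed.

End BadEvents.

(** * Choice of the scales *)

Section Scales.
Context {R : realType}.
Implicit Types (x y z c : R) (n p d h : nat).

Lemma exists_nat_between x : 1 <= x -> exists2 h, (0 < h)%N & x <= h%:R <= 2 * x.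
Proof.
move=> x1; exists (Num.truncn x).+1 => //.
have /andP[h1 h2] := truncn_itv (le_trans ler01 x1).
rewrite (ltW h2) -natr1; lra.
Qed.

Lemma expR_beats_power c p : 0 < c -> exists2 K, 0 < K & forall y, 1 <= y ->
  y ^+ p * expR (- (c * y)) <= K / y.
Proof.
move=> c0; exists ((p.+1)`!%:R / c ^+ p.+1).
  by rewrite divr_gt0 ?exprn_gt0 // ltr0n fact_gt0.
move=> y y1; have y0 : 0 < y := lt_le_trans ltr01 y1.
have cy : 0 <= c * y by rewrite mulr_ge0 // ltW.
have f0 : 0 < (p.+1)`!%:R :> R by rewrite ltr0n fact_gt0.
have h : (c * y) ^+ p.+1 / (p.+1)`!%:R <= expR (c * y).
  by have := expR_ge1Dxn p cy; lra.
rewrite expRN ler_pdivlMr // mulrAC -exprSr ler_pdivrMr ?expR_gt0 //.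
rewrite mulrAC ler_pdivlMr ?exprn_gt0 // mulrC -exprMn.
by move: h; rewrite ler_pdivrMr // [leRHS]mulrC.
Qed.

Lemma rsq_ge n x : 0 < x -> n%:R <= x ^+ 2 -> 1 <= x -> (2 * x)^-1 <= rsq n :> R.
Proof.
move=> x0 nx x1; rewrite rsqE lef_pV2 ?posrE ?sqrtr_gt0 ?mulr_gt0 //.
rewrite -[leRHS]ger0_norm ?mulr_ge0 ?(ltW x0) // -sqrtr_sqr ler_wsqrtr // -natr1 exprMn.
have : 1 <= x ^+ 2 by rewrite exprn_ege1.
by rewrite -natrX; lra.
Qed.

(** With z = n^(1/4) and y = n^(1/p), take h about z^2 y and r about sqrt(h) y, each a factor y
    above its natural scale. Both exponentials are then at most exp(-c y / 2), which beats every
    power of n = y^p. *)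
Lemma scale_choice p c : 0 < c -> exists2 K, 0 < K & forall n y z,
  1 <= y -> 1 <= z -> y ^+ p = n%:R -> z ^+ 4 = n%:R ->
  exists h r : nat, [/\ (0 < r)%N /\ (0 < h)%N, h%:R <= 2 * z ^+ 2 * y,
    Num.sqrt h%:R <= 2 * z * y, r%:R <= 4 * z * y ^+ 2 &
    n%:R ^+ 2 * expR (- (c * rsq n * h%:R)) + n%:R * expR (- (c * rsq h * r%:R)) <= K / y].
Proof.
move=> c0; have [K K0 hK] := @expR_beats_power (c / 2) (p * 2) ltac:(by rewrite divr_gt0).
exists (2 * K); first by rewrite mulr_gt0.
move=> n y z y1 z1 yn zn.
have y0 : 0 < y := lt_le_trans ltr01 y1; have z0 : 0 < z := lt_le_trans ltr01 z1.
have z21 : 1 <= z ^+ 2 by rewrite exprn_ege1.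
have z20 : 0 < z ^+ 2 by rewrite exprn_gt0.
have zy1 : 1 <= z ^+ 2 * y by rewrite mulr_ege1.
have [h h0 /andP[h1 h2]] := exists_nat_between zy1.
set s := Num.sqrt h%:R : R.
have s1 : 1 <= s by rewrite -[leLHS]sqrtr1 ler_wsqrtr // ler1n.
have s0 : 0 < s := lt_le_trans ltr01 s1.
have sh : s ^+ 2 = h%:R by rewrite sqr_sqrtr.
have [r r0 /andP[r1 r2]] := exists_nat_between (mulr_ege1 s1 y1).
have n1 : 1 <= n%:R :> R by rewrite -zn exprn_ege1.
have szy : s <= 2 * z * y.
  rewrite -(@ler_pXn2r _ 2) ?nnegrE ?(ltW s0) // ?mulr_ge0 ?(ltW z0) ?(ltW y0) // sh.
  apply: le_trans h2 _; rewrite !exprMn.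
  have yy : y <= y ^+ 2 by rewrite expr2 ler_peMr // ltW.
  apply: (@le_trans _ _ (2 * (z ^+ 2 * y ^+ 2))); first by rewrite ler_pM2l // ler_pM2l.
  by rewrite -mulrA ler_wpM2r ?mulr_ge0 ?exprn_ge0 ?(ltW y0) ?(ltW z0) // expr2; lra.
have e1 : y / 2 <= rsq n * h%:R.
  have l1 : (2 * z ^+ 2)^-1 <= rsq n.
    by apply: rsq_ge => //; rewrite -zn -exprM.
  apply: (@le_trans _ _ ((2 * z ^+ 2)^-1 * (z ^+ 2 * y))).
    by rewrite le_eqVlt; apply/orP; left; apply/eqP; field; rewrite gt_eqF.
  by apply: ler_pM => //; rewrite ?invr_ge0 ?mulr_ge0 // ltW.
have e2 : y / 2 <= rsq h * r%:R.
  have l1 : (2 * s)^-1 <= rsq h by apply: rsq_ge => //; rewrite sh.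
  apply: (@le_trans _ _ ((2 * s)^-1 * (s * y))).
    by rewrite le_eqVlt; apply/orP; left; apply/eqP; field; rewrite gt_eqF.
  by apply: ler_pM => //; rewrite ?invr_ge0 ?mulr_ge0 // ltW.
have exp_le x : y / 2 <= x -> n%:R ^+ 2 * expR (- (c * x)) <= K / y.
  move=> hx; apply: le_trans (hK y y1).
  rewrite exprM yn ler_wpM2l ?exprn_ge0 // ler_expR lerN2 -mulrA (mulrC 2^-1).
  by rewrite ler_wpM2l // ltW.
exists h, r; split => //.
- by rewrite -mulrA.
- apply: le_trans r2 _.
  have -> : 4 * z * y ^+ 2 = 2 * ((2 * z * y) * y) by ring.
  by rewrite ler_pM2l // ler_wpM2r // ltW.
rewrite [leRHS](_ : _ = K / y + K / y); last by ring.
apply: lerD; first by rewrite -(mulrA c) exp_le.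
apply: le_trans (exp_le _ e2); rewrite -(mulrA c) ler_wpM2r ?expR_ge0 //.
by rewrite expr2 ler_peMr // (le_trans ler01).
Qed.

(** Here ln y = ln n / p and ln z = ln n / 4, so a factor y^9 in either direction moves the exponent
    by at most 9 / p. *)
Lemma log_exponent p d n (cap y z : R) : (1 < n)%N -> (0 < p)%N -> (2 <= d)%N ->
  0 < y -> 0 < z -> 0 < cap -> y ^+ p = n%:R -> z ^+ 4 = n%:R ->
  cap <= z ^+ (d - 2) * y ^+ 9 -> z ^+ (d - 2) <= cap * y ^+ 9 ->
  `|ln cap / ln n%:R - (d%:R - 2) / 4| <= 9 / p%:R.
Proof.
move=> n1 p0 d2 y0 z0 cap0 yn zn up lo.
have l0 : 0 < ln n%:R :> R by rewrite ln_gt0 // ltr1n.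
have p0' : 0 < p%:R :> R by rewrite ltr0n.
have ly : ln y = ln n%:R / p%:R :> R.
  by rewrite -yn lnXn // -[ln y *+ _]mulr_natr mulfK // gt_eqF.
have lz : ln z = ln n%:R / 4 :> R.
  by rewrite -zn lnXn // -[ln z *+ _]mulr_natr mulfK // pnatr_eq0.
have up' : ln cap <= (d - 2)%:R * ln z + 9 * ln y.
  rewrite mulr_natl -lnXn // mulr_natl -lnXn // -lnM ?posrE ?exprn_gt0 //.
  by rewrite ler_ln ?posrE ?mulr_gt0 ?exprn_gt0.
have lo' : (d - 2)%:R * ln z <= ln cap + 9 * ln y.
  rewrite mulr_natl -lnXn // mulr_natl -lnXn // -lnM ?posrE ?exprn_gt0 //.
  by rewrite ler_ln ?posrE ?mulr_gt0 ?exprn_gt0.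
have dR : (d - 2)%:R = d%:R - 2 :> R by rewrite natrB.
have e1 : ((d%:R - 2) / 4 - 9 / p%:R) * ln n%:R <= ln cap.
  have -> : ((d%:R - 2) / 4 - 9 / p%:R) * ln n%:R = (d - 2)%:R * ln z - 9 * ln y.
    by rewrite dR ly lz; field; rewrite gt_eqF.
  by rewrite lerBlDr.
have e2 : ln cap <= ((d%:R - 2) / 4 + 9 / p%:R) * ln n%:R.
  have -> : ((d%:R - 2) / 4 + 9 / p%:R) * ln n%:R = (d - 2)%:R * ln z + 9 * ln y.
    by rewrite dR ly lz; field; rewrite gt_eqF.
  by [].
rewrite -ler_pdivlMr // in e1; rewrite -ler_pdivrMr // in e2.
by rewrite ler_distl e1 e2.
Qed.

(** The nine powers of y: at most seven from x^(10-d), one from the energy threshold, and one to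
    absorb the constant 8 * 2^7 = 1024. *)
Lemma power_lower d (z y x cap : R) n : d \in [:: 3; 4; 5]%N ->
  1 <= y -> 1 <= z -> z ^+ 4 = n%:R -> 1 <= x -> x <= 2 * z * y -> 0 < cap -> 1024 <= y ->
  (n%:R) ^+ 2 <= 4 * (x ^+ (10 - d) * y + 1) * cap ->
  z ^+ (d - 2) <= cap * y ^+ 9.
Proof.
move=> hd y1 z1 zn x1 xzy cap0 y1024 h.
have y0 : 0 < y := lt_le_trans ltr01 y1; have z0 : 0 < z := lt_le_trans ltr01 z1.
have d7 : (10 - d <= 7)%N by move: hd; rewrite !inE => /or3P[] /eqP ->.
have zz : (n%:R) ^+ 2 = z ^+ (d - 2) * z ^+ (10 - d).
  by rewrite -zn -exprM -exprD; congr (_ ^+ _); move: hd; rewrite !inE => /or3P[] /eqP ->.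
have x10 : 1 <= x ^+ (10 - d) * y by rewrite mulr_ege1 // exprn_ege1.
have xle : x ^+ (10 - d) <= 2 ^+ 7 * (z ^+ (10 - d) * y ^+ 7).
  apply: (@le_trans _ _ ((2 * z * y) ^+ (10 - d))).
    by apply: lerXn2r => //; rewrite nnegrE ?mulr_ge0 ?(ltW z0) ?(ltW y0) // (le_trans ler01).
  rewrite !exprMn -mulrA; apply: ler_pM; rewrite ?exprn_ge0 // ?mulr_ge0 ?exprn_ge0 ?(ltW z0) ?(ltW y0) //.
    by apply: ler_weXn2l => //; rewrite ler1n.
  by rewrite ler_wpM2l ?exprn_ge0 ?(ltW z0) // ler_weXn2l.
rewrite -(@ler_pM2r _ (z ^+ (10 - d))) ?exprn_gt0 // -zz; apply: le_trans h _.
apply: (@le_trans _ _ (8 * (2 ^+ 7 * (z ^+ (10 - d) * y ^+ 7) * y) * cap)).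
  rewrite ler_pM2r //; apply: (@le_trans _ _ (8 * (x ^+ (10 - d) * y))); first by lra.
  by rewrite ler_pM2l // ler_pM2r.
have -> : 8 * (2 ^+ 7 * (z ^+ (10 - d) * y ^+ 7) * y) * cap =
   1024 * (cap * y ^+ 8 * z ^+ (10 - d)) by ring.
have -> : cap * y ^+ 9 * z ^+ (10 - d) = y * (cap * y ^+ 8 * z ^+ (10 - d)) by ring.
by rewrite ler_wpM2r // !mulr_ge0 ?exprn_ge0 // ltW.
Qed.

(** At most y^6 comes from r^(d-2) and one more y absorbs 64 C; the exponent 9 is kept to match
    [power_lower]. *)
Lemma power_upper d (z y C r cap : R) : d \in [:: 3; 4; 5]%N ->
  1 <= y -> 1 <= z -> 0 < C -> 64 * C <= y -> 0 <= r -> r <= 4 * z * y ^+ 2 ->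
  cap <= C * r ^+ (d - 2) -> cap <= z ^+ (d - 2) * y ^+ 9.
Proof.
move=> hd y1 z1 C0 Cy r0 rz h.
have y0 : 0 < y := lt_le_trans ltr01 y1; have z0 : 0 < z := lt_le_trans ltr01 z1.
have d3 : (d - 2 <= 3)%N by move: hd; rewrite !inE => /or3P[] /eqP ->.
apply: le_trans h _.
have rle : r ^+ (d - 2) <= 4 ^+ 3 * (z ^+ (d - 2) * y ^+ 6).
  apply: (@le_trans _ _ ((4 * z * y ^+ 2) ^+ (d - 2))).
    by apply: lerXn2r => //; rewrite nnegrE !mulr_ge0 ?exprn_ge0 // ltW.
  rewrite exprMn exprMn -mulrA; apply: ler_pM; rewrite ?exprn_ge0 // ?mulr_ge0 ?exprn_ge0 ?(ltW z0) ?(ltW y0) //.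
    by apply: ler_weXn2l => //; rewrite ler1n.
  by rewrite ler_wpM2l ?exprn_ge0 ?(ltW z0) // -exprM ler_weXn2l // (leq_mul (leqnn 2) d3).
apply: (@le_trans _ _ (C * (4 ^+ 3 * (z ^+ (d - 2) * y ^+ 6)))); first by rewrite ler_pM2l.
have -> : C * (4 ^+ 3 * (z ^+ (d - 2) * y ^+ 6)) = 64 * C * (z ^+ (d - 2) * y ^+ 6) by ring.
have zy0 : 0 <= z ^+ (d - 2) * y ^+ 6 by rewrite mulr_ge0 ?exprn_ge0 // ltW.
apply: (@le_trans _ _ (y * (z ^+ (d - 2) * y ^+ 6))); first by rewrite ler_wpM2r.
rewrite mulrCA ler_wpM2l ?exprn_ge0 ?(ltW z0) // -exprS ler_weXn2l //.
Qed.

End Scales.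

(** * The random exponent and the final estimate *)

Section Exponent.
Context {disp : measure_display} {Omega : measurableType disp} {R : realType}
  (P : probability Omega R) {d : nat}
  (k : seq nat -> {RV P >-> nat}) (X : seq nat -> {RV P >-> lattice d}).
Implicit Types (n : nat) (f : set (lattice d) -> R).

Lemma tree_range_positions t w : tree_event k t w ->
  tree_range k X w = [set` positions X t w].
Proof.
move=> Ew; have e : tree k w = [set` verts t] := gw_tree_verts Ew.
rewrite /tree_range e; apply/seteqP; split => x /=.
  by move=> [u hu <-]; apply: map_f.
by move=> /mapP[u hu ->]; exists u.
Qed.

(** The default 0 gives a variable on the whole space, although off the event the range may be
    infinite and its capacity meaningless. On the event only finitely many shapes occur, whence
    measurability. *)
Definition on_size_event n f : Omega -> R :=
  fun w => if w \in tree_size_event k n then f (tree_range k X w) else 0.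

Lemma measurable_on_size_event n f : measurable_fun setT (on_size_event n f).
Proof.
move=> _ B mB; rewrite setTI.
set s := [seq t <- trees n n | psize t == n].
have -> : on_size_event n f @^-1` B =
    (\bigcup_(t in [set` s]) (tree_event k t `&` [set w | B (f [set` positions X t w])])) `|`
    (~` tree_size_event k n `&` [set w | B 0]).
  apply/seteqP; split => w; rewrite /on_size_event /=.
    case: (boolP (w \in _)) => hw.
      have /tree_size_eventP[t ts Ew] := set_mem hw.
      by rewrite (tree_range_positions Ew) => hB; left; exists t.
    by move=> hB; right; split => // h; move: hw; rewrite mem_set.
  move=> [[t ts [Ew hB]]|[nS hB]].
    have hw : tree_size_event k n w by apply/tree_size_eventP; exists t.
    by rewrite mem_set // (tree_range_positions Ew).
  by rewrite (_ : (w \in _) = false) //; apply/negbTE/negP => /set_mem.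
apply: measurableU.
  apply: fin_bigcup_measurable => [|t _]; first exact: finite_seq.
  apply: measurableI; first exact: measurable_tree_event.
  exact: (measurable_positions_event X t [set l : seq (lattice d) | B (f [set` l])]).
apply: measurableI; first by apply: measurableC; exact: measurable_tree_size_event.
have [hB|hB] := pselect (B 0).
  by rewrite (_ : [set _ | _] = setT) //; apply/seteqP; split.
by rewrite (_ : [set _ | _] = set0) //; apply/seteqP; split.
Qed.

HB.instance Definition _ n f :=
  isMeasurableFun.Build _ _ _ _ (on_size_event n f) (measurable_on_size_event n f).

Definition size_event_rv n f : {RV P >-> R} := on_size_event n f.

End Exponent.

Lemma size_positions (disp : measure_display) (Omega : measurableType disp) (R : realType)
  (P : probability Omega R) (d : nat) (X : seq nat -> {RV P >-> lattice d}) t w :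
  size (positions X t w) = psize t.
Proof. by rewrite size_map size_verts. Qed.

Theorem mainTheorem2 (R : realType) (d : nat)
  (hd : d \in [:: 3; 4; 5]%N)
  (mu : probability nat R)
  (theta eta : probability (lattice d) R)
  (mu_mean : ('E_mu[fun k : nat => k%:R%R] = 1)%E)
  (mu_var : ('V_mu[fun k : nat => k%:R%R : R] < +oo)%E)
  (mu_nontrivial : ~ (mu =1 @dirac _ nat 1%N R))
  (eta_aperiodic : aperiodic_chain (walk_kernel eta))
  (eta_irreducible : irreducible_chain (walk_kernel eta))
  (eta_mean : forall i : 'I_d, ('E_eta[lcoord R i] = 0)%E)
  (eta_moment : ('E_eta[fun x => (enorm R x ^+ d.+1)%R] < +oo)%E)
  (theta_symmetric : symmetric_law theta)
  (theta_irreducible : irreducible_chain (walk_kernel theta))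
  (theta_exp_moment : exists lambda : R, 0 < lambda /\
    ('E_theta[fun x => expR (lambda * enorm R x)%R] < +oo)%E)
  (mu_third_moment : ('E_mu[fun k : nat => ((k%:R : R) ^+ 3)%R] < +oo)%E)
  (disp disp' : measure_display)
  (Omega : measurableType disp) (Omega' : measurableType disp')
  (P : probability Omega R) (P' : probability Omega' R)
  (k : seq nat -> {RV P >-> nat})
  (X : seq nat -> {RV P >-> lattice d})
  (hkX : branching_walk mu theta k X)
  (xi : nat -> {RV P' >-> lattice d})
  (hxi : iid_steps eta xi) :
  let sizes := [set n | (0 < P (tree_size_event k n))%E] in
  exists o : nat -> {RV P >-> R},
    (\forall n \near within sizes \oo,
      forall w, tree_size_event k n w ->
        capacity xi (tree_range k X w) = n%:R `^ ((d%:R - 2) / 4 + o n w)) /\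
    (forall eps : R, 0 < eps ->
      cond_prob P [set w | eps < `|o n w|] (tree_size_event k n)
        @[n --> within sizes \oo] --> (0 : R)).
Proof.
move=> sizes.
have d2 : (2 < d)%N by move: hd; rewrite !inE => /or3P[] /eqP ->.
(* The error term is forced: the claimed identity is solved for the exponent, and the work lies in
   showing that the solution is small. *)
pose g n (A : set (lattice d)) : R := ln (capacity xi A) / ln n%:R - (d%:R - 2) / 4.
have gt0 n t w : (0 < n)%N -> psize t = n -> 0 < capacity xi [set` positions X t w].
  move=> n0 pt; apply: (capacity_seq_gt0 hxi) => //.
  by rewrite size_positions pt.
exists (fun n => size_event_rv k X n (g n)); split.
  (* From n = 2 on, ln n is positive and the division in [g] can be undone. *)
  rewrite near_withinE; exists 2 => //= n n2 _ w Sw.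
  have [t ts Ew] : exists2 t, t \in [seq t <- trees n n | psize t == n] & tree_event k t w.
    exact/tree_size_eventP.
  have pt : psize t = n by move: ts; rewrite mem_filter => /andP[/eqP].
  rewrite /size_event_rv /= /on_size_event mem_set // /g addrC subrK.
  rewrite (tree_range_positions X Ew).
  have n0 : 0 < n%:R :> R by rewrite ltr0n (leq_trans _ n2).
  have l0 : ln n%:R != 0 :> R by rewrite gt_eqF // ln_gt0 // ltr1n.
  rewrite /powR gt_eqF // divfK // lnK // posrE; apply: gt0 pt.
  exact: leq_trans n2.
move=> eps eps0; apply/cvgrPdist_le => e e0; rewrite near_withinE.
have [C0 C00 hC0] := heat_kernel_bound (ltn_trans (isT : (0 < 2)%N) d2) eta_irreducible.
have hC0' n x : heat eta n x <= C0 * rsq n ^+ d by apply: (hC0 eta n 0%N x).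
have d1 : (1 <= d.+1)%N by [].
have it1 (i : 'I_d) : itg eta (lcoord R i).
  by have := lcoord_expr_itg i d1 eta_moment; under eq_fun do rewrite expr1.
have it2 (i : 'I_d) : itg eta (fun x => lcoord R i x ^+ 2).
  by apply: lcoord_expr_itg eta_moment; rewrite ltnS ltnW // ltnW.
have mean0 (i : 'I_d) : mean eta (lcoord R i) = 0 by apply: expectation_mean.
have [Cu Cu0 hCu] := capacity_seq_upper hxi d2 it1 it2 mean0.
have [K [c [n0 [K0 c0 hbad]]]] := bad_event_bound hkX theta_symmetric hd mu_mean
  mu_third_moment mu_nontrivial eta_irreducible theta_irreducible theta_exp_moment.
have [p0 hp0] := natr_large (9 / eps).
(* 9 / p <= eps is the precision obtained through y = n^(1/p); p >= 4 gives y <= z, which is used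
   for 6 Hc <= n. *)
pose p := maxn p0 4; have p4 : (4 <= p)%N by rewrite leq_maxr.
have hp : 9 / p%:R <= eps.
  have p_gt0 : 0 < p%:R :> R by rewrite ltr0n (leq_trans _ p4).
  by rewrite ler_pdivrMr // mulrC -ler_pdivrMr // hp0 // leq_maxl.
have [Ks Ks0 hKs] := @scale_choice R p c c0.
(* Thresholds for y: 1024 and 64 Cu absorb the constants of the two capacity bounds, and the last
   one makes the final probability at most [e]. *)
pose T : R := Num.max 1024 (Num.max (64 * Cu) (K * (Ks + 1) / e)).
have [nT hnT] := natr_large (T ^+ p).
exists (maxn (maxn n0 nT) 2) => // n hn; have {hn} : (maxn (maxn n0 nT) 2 <= n)%N := hn.
rewrite !geq_max => /andP[/andP[n0n nTn] n2] Sn.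
have nR : 0 < n%:R :> R by rewrite ltr0n (leq_trans _ n2).
(* [y] is [n^delta] with [delta = 1/p], and [z] is [n^(1/4)]. *)
pose y : R := n%:R `^ (p%:R^-1).
have y0 : 0 < y by apply: powR_gt0.
have yn : y ^+ p = n%:R.
  rewrite -powR_mulrn ?(ltW y0) // -powRrM mulVf ?powRr1 ?(ltW nR) //.
  by rewrite pnatr_eq0 -lt0n (leq_trans _ p4).
have Ty : T <= y.
  have T0 : 0 <= T by rewrite le_max ler0n.
  rewrite -(@ler_pXn2r _ p) ?nnegrE ?(ltW y0) // ?yn ?hnT //.
  exact: leq_trans p4.
have /and3P[y1024 yCu yK] : [&& 1024 <= y, 64 * Cu <= y & K * (Ks + 1) / e <= y].
  by move: Ty; rewrite !ge_max.
have y1 : 1 <= y by apply: le_trans y1024; rewrite ler1n.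
pose z : R := Num.sqrt (Num.sqrt n%:R).
have zn : z ^+ 4 = n%:R.
  by rewrite (exprM z 2 2) !sqr_sqrtr // ?sqrtr_ge0.
have z1 : 1 <= z by rewrite -[leLHS]sqrtr1 ler_wsqrtr // -[leLHS]sqrtr1 ler_wsqrtr // ler1n (leq_trans _ n2).
have yz : y <= z.
  rewrite -(@ler_pXn2r _ 4) ?nnegrE ?(ltW y0) ?(le_trans ler01) // zn -yn.
  exact: ler_weXn2l.
have [Hc [r [[r0 Hc0] HcE sHc rE sumE]]] := hKs n y z y1 z1 yn zn.
set x := Num.sqrt Hc%:R : R.
have x1 : 1 <= x by rewrite -[leLHS]sqrtr1 ler_wsqrtr // ler1n.
(* A factor y above the order of the expected energy, so that the energy term of the bound is
   exactly 1 / y. *)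
pose M := x ^+ (10 - d) * y.
have M0 : 0 < M by rewrite mulr_gt0 ?exprn_gt0 // (lt_le_trans ltr01).
have Hcn : (6 * Hc <= n)%N.
  rewrite -(ler_nat R) natrM; apply: (@le_trans _ _ (6 * (2 * z ^+ 2 * y))).
    by rewrite ler_pM2l.
  rewrite -zn (exprM z 2 2) [leRHS]expr2.
  have -> : 6 * (2 * z ^+ 2 * y) = z ^+ 2 * (12 * y) by ring.
  rewrite ler_pM2l ?exprn_gt0 ?(lt_le_trans ltr01) // [leRHS]expr2.
  apply: ler_pM => //; first exact: ltW.
  by apply: le_trans yz; apply: le_trans y1024; rewrite ler_nat.
(* A horizon, depending on n, beyond which the whole energy tail is at most 1: this is the 1 in M +
   1 below. *)
have [N hN] : exists N, n%:R ^+ 2 * (3 * C0 * rsq N) <= 1 :> R.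
  have [N hN] := natr_large ((n%:R ^+ 2 * (3 * C0)) ^+ 2).
  exists N; rewrite mulrA; set b := n%:R ^+ 2 * (3 * C0).
  have b0 : 0 <= b by rewrite mulr_ge0 ?exprn_ge0 // mulr_ge0 // ltW.
  have b1 : 0 <= b * rsq N by rewrite mulr_ge0 // rsq_ge0.
  rewrite -(@expr_le1 _ 2) // exprMn rsq_sqr.
  by rewrite ler_pdivrMr ?ltr0n // mul1r hN.
set o := size_event_rv k X n (g n).
set B := [set w | eps < `|o w|].
have mB : measurable B.
  have mo : measurable_fun setT (fun w => `|o w|).
    by apply: measurableT_comp => //; exact: measurable_normr.
  have := mo measurableT _ (measurable_itv `]eps, +oo[).
  rewrite setTI (_ : _ @^-1` _ = B) //.
  by apply/seteqP; split => w /=; rewrite in_itv /= andbT.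
have hcond := hbad n Hc N r%:R M B n0n Hcn mB M0 (ler0n _ _) Sn.
rewrite sub0r normrN ger0_norm; last by rewrite divr_ge0 // fine_ge0.
apply: le_trans (hcond _) _ => [t w pt gen Ew Bw hfar hM|]; last first.
  have -> : Num.sqrt Hc%:R ^+ (10 - d) / M = y^-1.
    rewrite /M -/x invfM mulrA divff ?mul1r // gt_eqF // exprn_gt0 // (lt_le_trans ltr01) //.
  apply: (@le_trans _ _ (K * (Ks / y + y^-1))); first by rewrite ler_pM2l // lerD2r.
  have -> : K * (Ks / y + y^-1) = K * (Ks + 1) / y by ring.
  by rewrite ler_pdivrMr // [leRHS]mulrC -ler_pdivrMr.
(* For a low tree with small displacement and small energy both capacity bounds hold, and they put
   [o w] within 9 / p <= eps, against [Bw]. *)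
have Sw : tree_size_event k n w.
  apply/tree_size_eventP; exists t => //.
  by rewrite mem_filter pt eqxx mem_trees // pt.
set cap := capacity xi [set` positions X t w].
have cap0 : 0 < cap by apply: gt0 pt; apply: leq_trans n2.
have ow : o w = ln cap / ln n%:R - (d%:R - 2) / 4.
  by rewrite /o /size_event_rv /= /on_size_event mem_set // /g (tree_range_positions X Ew).
have up : cap <= Cu * r%:R ^+ (d - 2).
  apply: hCu => // v i /mapP[u hu ->]; exact: hfar.
have lo : n%:R ^+ 2 <= 4 * (M + 1) * cap.
  rewrite -[X in X%:R ^+ 2]pt -(size_positions X t w).
  apply: (capacity_seq_lower hxi d2 _ hC0') => [||j].
  - by rewrite size_positions pt (leq_trans _ n2).
  - by rewrite addr_gt0.
  apply: le_trans (@potential_le_tail _ _ eta C0 _ N j d2 C00 hC0') _.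
  by rewrite size_positions pt lerD // ltW.
have z0 : 0 < z by apply: lt_le_trans z1.
have up' := power_upper hd y1 z1 Cu0 yCu (ler0n _ _) rE up.
have lo' := power_lower hd y1 z1 zn x1 sHc cap0 y1024 lo.
have p_gt0 : (0 < p)%N by apply: leq_trans p4.
have := log_exponent n2 p_gt0 (ltnW d2) y0 z0 cap0 yn zn up' lo'.
rewrite -ow => h.
by have := lt_le_trans Bw (le_trans h hp); rewrite ltxx.
Qed.
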